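(* Let $f:[0,1]^2\to\mathbb{R}$ be a function such that the second partial derivatives $f''_{xx}$ and $f''_{yy}$ exist at every point of $[0,1]^2$ and are square integrable on $[0,1]^2$. Then: (i) at almost every point of $[0,1]^2$ the mixed derivatives $f''_{xy}$ and $f''_{yx}$ exist and are equal, and they are square integrable on $[0,1]^2$; (ii) there exists a set $A\subseteq[0,1]$ with $\mu(A)=1$ such that $f'_x$ is continuous with respect to $y$ at every point of $A\times[0,1]$, i.e. for every $x\in A$ the function $y\mapsto f'_x(x,y)$ is continuous on $[0,1]$; (iii) $f$ is jointly continuous on $[0,1]^2$.
   Context: $\mu$ denotes Lebesgue measure, and ''almost every'', ''integrable'' and ''square integrable'' refer to Lebesgue measure. Derivatives are finite and pointwise (one-sided at endpoints of the interval). $f''_{xx}$ is the second derivative of $x\mapsto f(x,y)$ and $f''_{yy}$ the second derivative of $y\mapsto f(x,y)$; their existence includes the existence of $f'_x$, respectively $f'_y$, everywhere. The mixed derivatives are $f''_{xy}=(f'_x)'_y$ and $f''_{yx}=(f'_y)'_x$. No joint continuity or measurability of $f$ is assumed beyond what is stated. *)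

(* Defs.v *)
From HB Require Import structures.
From mathcomp Require Import all_boot all_order all_algebra.
From mathcomp Require Import all_classical all_reals all_analysis.

Set Implicit Arguments.
Unset Strict Implicit.
Unset Printing Implicit Defensive.

Import Order.TTheory GRing.Theory Num.Theory numFieldNormedType.Exports.

Local Open Scope classical_set_scope.
Local Open Scope ring_scope.

Definition unit_itv (R : realType) : set R := `[0, 1]%classic.
Arguments unit_itv R : clear implicits.

Definition unit_square (R : realType) : set (R * R) :=
  unit_itv R `*` unit_itv R.
Arguments unit_square R : clear implicits.

(* Differentiation on [0, 1]: the increments are restricted to [0, 1], so the
   derivative is two-sided at interior points and one-sided at 0 and 1, and only
   the values of g on [0, 1] matter. [deriv01 g x] is meaningful only under
   [derivable01 g x]; otherwise it is a default value. *)
Definition diff_quot (R : realType) (g : R -> R) (x t : R) : R :=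
  (g t - g x) / (t - x).

Definition derivable01 (R : realType) (g : R -> R) (x : R) : Prop :=
  cvg (diff_quot g x t @[t --> within (unit_itv R) x^']).

Definition deriv01 (R : realType) (g : R -> R) (x : R) : R :=
  lim (diff_quot g x t @[t --> within (unit_itv R) x^']).

Definition has_dx (R : realType) (f : R * R -> R) (p : R * R) : Prop :=
  derivable01 (fun t => f (t, p.2)) p.1.

Definition has_dy (R : realType) (f : R * R -> R) (p : R * R) : Prop :=
  derivable01 (fun t => f (p.1, t)) p.2.

Definition dx (R : realType) (f : R * R -> R) (p : R * R) : R :=
  deriv01 (fun t => f (t, p.2)) p.1.

Definition dy (R : realType) (f : R * R -> R) (p : R * R) : R :=
  deriv01 (fun t => f (p.1, t)) p.2.

(* The library's [lebesgue_measure] lives on the Borel sets. Lebesgue measure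
   proper is its completion, defined on the Caratheodory sigma-algebra: on the
   line this is [completed_lebesgue_measure], and on the plane [leb2] below
   completes the product measure in the same way. *)
Definition leb1_measurable (R : realType) (A : set R) : Prop :=
  ((wlength (@idfun R))^*%mu).-cara.-measurable A.

Definition borel_leb2 (R : realType) :
    {measure set (measurableTypeR R * measurableTypeR R) -> \bar R} :=
  (@lebesgue_measure R \x @lebesgue_measure R)%E.
Arguments borel_leb2 R : clear implicits.

Definition leb2 (R : realType) :
    {measure set (caratheodory_type ((borel_leb2 R)^*)%mu) -> \bar R} :=
  @completed_measure_extension _ _ _ (borel_leb2 R).
Arguments leb2 R : clear implicits.

Definition square_integrable (d : measure_display) (T : measurableType d)
    (R : realType) (mu : {measure set T -> \bar R}) (D : set T) (g : T -> R) :
    Prop :=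
  measurable_fun D g /\ mu.-integrable D (fun p => (g p ^+ 2)%:E).

(* Main.v *)
(* On an N x N grid the squares of the mixed second differences sum, after two
   summations by parts, to the sum of the products of the pure second differences,
   up to boundary terms; a cut-off and reflection removes the boundary. Applied
   inside grid rectangles, with the grid lines chosen by averaging so that the
   integrals of f_xx^2 and f_yy^2 over them are controlled, this bounds the sum of
   the squared increments f(x',y')-f(x',y)-f(x,y')+f(x,y) over a P x P' partition
   by C / (P P'). Hence the dyadic averages of the increments form an L2-bounded
   martingale, whose limit h is an L2 density:
     f(x,y) - f(x,0) - f(0,y) + f(0,0) = \iint_{[0,x] x [0,y]} h.
   Joint continuity follows. For almost every x, Lebesgue differentiation at
   rational y and a squeeze in y (for the positive and negative parts of h) give
     f_x(x,y) = f_x(x,0) + \int_0^y h(x,s) ds   for all y,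
   so f_x(x,.) is continuous and f_xy = h almost everywhere. Exchanging the
   variables, f_yx = h almost everywhere as well. *)
Require Import Defs.
From HB Require Import structures.
From mathcomp Require Import all_boot all_order all_algebra.
From mathcomp Require Import all_classical all_reals all_analysis.
From mathcomp Require Import measurable_realfun.
From mathcomp Require Import ring lra zify.

Set Implicit Arguments.
Unset Strict Implicit.
Unset Printing Implicit Defensive.

Import Order.TTheory GRing.Theory Num.Theory numFieldNormedType.Exports.

Local Open Scope classical_set_scope.
Local Open Scope ring_scope.

(** * Mixed differences on a finite grid *)

Section Discrete.
Variable R : realFieldType.
Implicit Types (u v w a b : nat -> R) (n m k i j : nat).

(** On a given line nothing says that a pure second derivative is integrable, [f] is not assumed
    jointly measurable, and joint continuity is a conclusion. These obstacles shape the proof. The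
    identity for squares is run on finite grids, where it needs no regularity. Second differences
    are scaled by [n^2], so a kink at the reflection seam would contribute a term that grows with
    [n]; matching values and slopes in [a v(s) + b v(2s)] means [a + b = 1] and [a + 2b = -1],
    whence the weights [3] and [-2], and the cut-off needs a double zero at its end for the same
    reason. Along a line, an increment of [f_x] is compared with the integral of [|f_xx|] without
    absolute continuity, using only that the derivative exists everywhere. Limits in the nodes move
    one variable at a time, because only separate continuity is available. Differentiability in each
    variable makes [f] and its pure second derivatives Borel on the square, so the analysis uses the
    Borel product measure; the completion returns at the end, where the mixed derivatives are known
    only off a null set. *)

Definition fdiff u i : R := u i.+1 - u i.
Definition fdiff2 u i : R := u i.+2 - 2 * u i.+1 + u i.
Definition mixdiff (F : nat -> nat -> R) i j : R :=
  F i.+1 j.+1 - F i.+1 j - F i j.+1 + F i j.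

Lemma sqr_le_norm (x c : R) : `|x| <= c -> x ^+ 2 <= c ^+ 2.
Proof.
by move=> xc; rewrite -(ger0_norm (sqr_ge0 x)) normrX lerXn2r// ?nnegrE// (le_trans _ xc).
Qed.

Lemma big_nat_add (V : nmodType) (F : nat -> V) n m :
  \sum_(0 <= i < n + m) F i = \sum_(0 <= i < n) F i + \sum_(0 <= i < m) F (n + i)%N.
Proof.
rewrite (big_cat_nat (n := n)) ?leq_addr//=; congr (_ + _).
have := big_addn 0 (n + m) n xpredT F; rewrite add0n addKn => ->.
by apply: eq_bigr => i _; rewrite addnC.
Qed.

Lemma big_nat_block (V : nmodType) (F : nat -> V) P r :
  \sum_(0 <= i < P * r) F i =
  \sum_(0 <= p < P) \sum_(0 <= i < r) F (p * r + i)%N.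
Proof.
elim: P => [|P IH]; first by rewrite mul0n !big_geq.
by rewrite big_nat_recr//= mulSn addnC big_nat_add IH.
Qed.

Lemma sum_by_parts a b L : a 0%N = 0 -> a L.+1 = 0 ->
  \sum_(0 <= k < L.+1) fdiff a k * fdiff b k =
  - \sum_(0 <= k < L) a k.+1 * fdiff2 b k.
Proof.
move=> a0 aL.
suff : \sum_(0 <= k < L) fdiff a k * fdiff b k
     + \sum_(0 <= k < L) a k.+1 * fdiff2 b k = a L * fdiff b L - a 0%N * fdiff b 0%N.
  rewrite a0 big_nat_recr//=.
  have -> : fdiff a L = - a L by rewrite /fdiff aL sub0r.
  lra.
rewrite -big_split/= -(telescope_sumr (fun k => a k * fdiff b k))//.
by apply: eq_bigr => k _; rewrite /fdiff /fdiff2; ring.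
Qed.

(** The discrete form of the equality of the integrals of [F_xy^2] and [F_xx F_yy] for [F] vanishing
    on the boundary: one summation by parts in each index, with zero values on all four sides
    removing the boundary terms. The shifts [k.+1] and [l.+1] centre both second differences at the
    same node. *)
Lemma mixdiff_by_parts (F : nat -> nat -> R) L L' :
    (forall j, F 0%N j = 0) -> (forall j, F L.+1 j = 0) ->
    (forall i, F i 0%N = 0) -> (forall i, F i L'.+1 = 0) ->
  \sum_(0 <= k < L.+1) \sum_(0 <= l < L'.+1) mixdiff F k l ^+ 2 =
  \sum_(0 <= k < L) \sum_(0 <= l < L')
     fdiff2 (F ^~ l.+1) k * fdiff2 (F k.+1) l.
Proof.
move=> F0 FL F0' FL'.
rewrite exchange_big/=.
transitivity (- \sum_(0 <= l < L'.+1) \sum_(0 <= k < L)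
    fdiff (F k.+1) l * fdiff2 (fun k => fdiff (F k) l) k).
  rewrite -sumrN; apply: eq_bigr => l _.
  rewrite -(sum_by_parts (a := fun k => fdiff (F k) l)).
  - by apply: eq_bigr => k _; rewrite /fdiff /mixdiff; ring.
  - by rewrite /fdiff !F0 subrr.
  - by rewrite /fdiff !FL subrr.
rewrite exchange_big/= -sumrN; apply: eq_bigr => k _.
transitivity (- \sum_(0 <= l < L'.+1) fdiff (fun l => fdiff2 (F^~ l) k) l * fdiff (F k.+1) l).
  by congr (- _); apply: eq_bigr => l _; rewrite /fdiff /fdiff2; ring.
rewrite (sum_by_parts (a := fun l => fdiff2 (F^~ l) k)) ?opprK//.
  by rewrite /fdiff2 !F0'; ring.
by rewrite /fdiff2 !FL'; ring.
Qed.

(* Hestenes reflection about the index [n]: values and first differences match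
   across [n] and second differences stay bounded by those of [v]. *)
Definition hestenes n v k : R :=
  if (n <= k)%N then v (k - n)%N else 3 * v (n - k)%N - 2 * v (n - k).*2.

Lemma sum_even_le a n : (forall i, 0 <= a i) -> (forall i, (n <= i)%N -> a i = 0) ->
  \sum_(0 <= i < n) (a i.*2 + a i.*2.+1) = \sum_(0 <= i < n) a i.
Proof.
move=> a0 an.
have -> : \sum_(0 <= i < n) (a i.*2 + a i.*2.+1) = \sum_(0 <= i < n + n) a i.
  rewrite addnn {an}; elim: n => [|n IH]; first by rewrite !big_geq.
  by rewrite doubleS !big_nat_recr//= IH addrA.
rewrite big_nat_add [X in _ + X]big1 ?addr0// => i _.
by rewrite an// leq_addr.
Qed.

Lemma hestenes_l2 n v : (forall i, (n <= i)%N -> v i = 0) ->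
  \sum_(0 <= k < n + n) hestenes n v k ^+ 2 <= 27 * \sum_(0 <= i < n) v i ^+ 2.
Proof.
move=> vn; rewrite big_nat_add.
have -> : \sum_(0 <= i < n) hestenes n v (n + i) ^+ 2 = \sum_(0 <= i < n) v i ^+ 2.
  by apply: eq_bigr => i _; rewrite /hestenes leq_addr addKn.
suff: \sum_(0 <= i < n) hestenes n v i ^+ 2 <= 26 * \sum_(0 <= i < n) v i ^+ 2 by lra.
have sh : forall a, (forall i, 0 <= a i) -> (forall i, (n <= i)%N -> a i = 0) ->
    \sum_(0 <= i < n) a i.+1 <= \sum_(0 <= i < n) a i.
  move=> a a0 an; have -> : \sum_(0 <= i < n) a i.+1 = \sum_(0 <= i < n.+1) a i - a 0%N.
    by rewrite big_nat_recl// addrC addKr.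
  by rewrite big_nat_recr//= an// addr0 lerBlDr lerDl.
have v2 i : (n <= i)%N -> v i ^+ 2 = 0 by move=> /vn ->; rewrite expr0n.
rewrite big_nat_rev/= add0n.
(* Since [(3x - 2y)^2 <= 18 x^2 + 8 y^2], and the doubled indices meet only even positions, the
   total is [27 = 1 + 18 + 8] times the sum of [v^2]. *)
apply: (@le_trans _ _ (\sum_(0 <= i < n) (18 * v i.+1 ^+ 2 + 8 * v i.+1.*2 ^+ 2))).
  apply: ler_sum_nat => i /andP[_ lin].
  rewrite /hestenes leqNgt subnSK// leq_subr/= subKn//.
  set x := v _; set y := v _; have := sqr_ge0 (3 * x + 2 * y); nra.
rewrite big_split/= -!mulr_sumr.
have H1 := sh (fun i => v i ^+ 2) (fun i => sqr_ge0 _) v2.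
have H2 : \sum_(0 <= i < n) v i.+1.*2 ^+ 2 <= \sum_(0 <= i < n) v i ^+ 2.
  apply: (@le_trans _ _ (\sum_(0 <= i < n) v i.*2 ^+ 2)).
    apply: (sh (fun i => v i.*2 ^+ 2)) => i; first exact: sqr_ge0.
    by move=> ni; rewrite v2//; lia.
  rewrite -(@sum_even_le (fun i => v i ^+ 2))//; last by move=> i; exact: sqr_ge0.
  by apply: ler_sum => i _; rewrite lerDl sqr_ge0.
by rewrite /= in H1; lra.
Qed.

Lemma hestenes_diff2 n v : (forall i, (n <= i)%N -> v i = 0) ->
  \sum_(0 <= k < n + n) fdiff2 (hestenes n v) k ^+ 2 <=
  200 * \sum_(0 <= i < n) fdiff2 v i ^+ 2.
Proof.
move=> vn; rewrite big_nat_add.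
have -> : \sum_(0 <= i < n) fdiff2 (hestenes n v) (n + i) ^+ 2
        = \sum_(0 <= i < n) fdiff2 v i ^+ 2.
  apply: eq_bigr => i _; rewrite /fdiff2 /hestenes -!addnS !leq_addr.
  by rewrite !addKn.
set a := fun i => fdiff2 v i ^+ 2.
have a0 i : 0 <= a i by exact: sqr_ge0.
have an i : (n <= i)%N -> a i = 0.
  by move=> ni; rewrite /a /fdiff2 !vn; [ring| lia..].
have S0 m : 0 <= \sum_(0 <= i < m) a i by apply: sumr_ge0 => i _.
suff: \sum_(0 <= i < n) fdiff2 (hestenes n v) i ^+ 2 <= 199 * \sum_(0 <= i < n) a i.
  by rewrite -/(a _); lra.
case: n vn an => [|n] vn an; first by rewrite !big_geq//; lra.
rewrite big_nat_rev/= add0n big_nat_recl//=.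
(* At the seam the second difference is [v 1 - 2 v 0 + (3 v 1 - 2 v 2)], that is [-2 * fdiff2 v 0]:
   the weights leave no first-order term. *)
have -> : fdiff2 (hestenes n.+1 v) (n.+1 - 1) ^+ 2 = 4 * a 0%N.
  rewrite subn1/= /fdiff2 /hestenes ltnn leqnn leqnSn subnn !subSnn.
  by rewrite /a /fdiff2 (_ : 1.*2 = 2)%N//; ring.
apply: (@le_trans _ _ (4 * a 0%N + \sum_(0 <= i < n)
   (36 * a i + 16 * (a i.*2 + 4 * a i.*2.+1 + a i.*2.+2)))).
  rewrite lerD2l; apply: ler_sum_nat => i /andP[_ lin].
  (* A second difference of step 2 is the combination [1, 2, 1] of three consecutive second
     differences of step 1. *)
  have -> : fdiff2 (hestenes n.+1 v) (n.+1 - i.+2) =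
     3 * fdiff2 v i - 2 * (fdiff2 v i.*2 + 2 * fdiff2 v i.*2.+1 + fdiff2 v i.*2.+2).
    rewrite /fdiff2 /hestenes.
    have -> : (n.+1 <= n.+1 - i.+2)%N = false by lia.
    have -> : (n.+1 <= (n.+1 - i.+2).+1)%N = false by lia.
    have -> : (n.+1 - (n.+1 - i.+2) = i.+2)%N by lia.
    have -> : (n.+1 - (n.+1 - i.+2).+1 = i.+1)%N by lia.
    have -> : (n.+1 - (n.+1 - i.+2).+2 = i)%N by lia.
    rewrite !doubleS; case: leqP => h; first ring.
    have -> : i = 0%N by lia.
    have -> : ((n.+1 - 2).+2 - n.+1 = 0)%N by lia.
    by rewrite double0; ring.
  rewrite /a; set x := fdiff2 v i; set y := fdiff2 v _; set z := fdiff2 v _; set t := fdiff2 v _.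
  have : (3 * x - 2 * (y + 2 * z + t)) ^+ 2 <=
     4 * ((3*x)^+2 + (2*y)^+2 + (4*z)^+2+(2*t)^+2).
    have := sqr_ge0 (3*x + 2*y); have := sqr_ge0 (3*x+4*z); have := sqr_ge0 (3*x+2*t).
    have := sqr_ge0 (2*y - 4*z); have := sqr_ge0 (2*y-2*t); have := sqr_ge0 (4*z-2*t).
    lra.
  lra.
have H1 : \sum_(0 <= i < n) a i <= \sum_(0 <= i < n.+1) a i.
  by rewrite [leRHS]big_nat_recr//= lerDl.
have H2 : \sum_(0 <= i < n) (a i.*2 + a i.*2.+1) <= \sum_(0 <= i < n.+1) a i.
  by rewrite -(@sum_even_le _ n.+1)// [leRHS]big_nat_recr//= lerDl addr_ge0.
have H3 : a 0%N + \sum_(0 <= i < n) a i.*2.+2 <= \sum_(0 <= i < n.+1) a i.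
  rewrite -(@sum_even_le _ n.+1)// big_nat_recl//= double0 -addrA lerD2l.
  apply: ler_wpDl => //; apply: ler_sum => i _; by rewrite doubleS lerDl.
have H4 : 0 <= \sum_(0 <= i < n) a i.*2 by apply: sumr_ge0 => i _.
have H5 : 0 <= \sum_(0 <= i < n) a i.*2.+2 by apply: sumr_ge0 => i _.
have := S0 n; have := a0 0%N.
rewrite big_split/= in H2.
rewrite big_split/= -!mulr_sumr !big_split/= -!mulr_sumr; lra.
Qed.

Lemma hestenes_eq0 n v k : (forall i, (n <= i)%N -> v i = 0) ->
  (n + n <= k)%N -> hestenes n v k = 0.
Proof.
by move=> vn nk; rewrite /hestenes (leq_trans (leq_addr n n) nk) vn//; lia.
Qed.

Lemma hestenes0 n v : (forall i, (n <= i)%N -> v i = 0) -> hestenes n v 0 = 0.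
Proof.
move=> vn; rewrite /hestenes; case: ifP => [h|_]; first by rewrite vn//; lia.
by rewrite subn0 !vn ?leqnn//; [ring|lia].
Qed.

(* [1 - 3 t^2 + 2 t^3] has vanishing derivative at both ends of [0, 1] and its
   reflection about [1/2] complements it to 1. *)
Definition cutoff n i : R :=
  if (i < n)%N then let t := i%:R / n%:R in 1 - 3 * t ^+ 2 + 2 * t ^+ 3 else 0.

Lemma cutoffE n i : (0 < n)%N -> (i <= n)%N ->
  cutoff n i = let t := i%:R / n%:R in 1 - 3 * t ^+ 2 + 2 * t ^+ 3.
Proof.
move=> n0; rewrite leq_eqVlt /cutoff => /orP[/eqP ->|->//].
by rewrite ltnn divff ?pnatr_eq0 -?lt0n//=; ring.
Qed.

Lemma cutoff_eq0 n i : (n <= i)%N -> cutoff n i = 0.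
Proof. by rewrite /cutoff ltnNge => ->. Qed.

Lemma cutoff_compl n i : (0 < n)%N -> (i <= n)%N ->
  cutoff n i + cutoff n (n - i) = 1.
Proof.
move=> n0 ni; rewrite !cutoffE ?leq_subr//= natrB//; field.
by rewrite pnatr_eq0 -lt0n.
Qed.

Let nodeP n i : (0 < n)%N -> (i <= n)%N -> 0 <= (i%:R / n%:R : R) <= 1.
Proof.
move=> n0 ni; rewrite divr_ge0//= ler_pdivrMr ?ltr0n// mul1r ler_nat//.
Qed.

Lemma cutoff_le1 n i : (0 < n)%N -> `|cutoff n i| <= 1.
Proof.
move=> n0; have [ni|ni] := leqP n i; first by rewrite cutoff_eq0// normr0.
rewrite cutoffE ?(ltnW ni)//=.
have /andP[] := nodeP n0 (ltnW ni); move: (_ / _) => t t0 t1.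
rewrite ler_norml; apply/andP; split; nra.
Qed.

Lemma cutoff_diff n i : (i < n)%N -> `|n%:R * fdiff (cutoff n) i| <= 2.
Proof.
move=> ni; have n0 : (0 < n)%N by lia.
rewrite /fdiff !cutoffE//= ?(ltnW ni)//.
set s : R := i.+1%:R / n%:R; set t : R := i%:R / n%:R.
have /andP[t0 t1] : 0 <= t <= 1 := nodeP n0 (ltnW ni).
have /andP[s0 s1] : 0 <= s <= 1 := nodeP n0 ni.
have stE : s - t = n%:R^-1 by rewrite /s /t -mulrBl -natr1 addrAC subrr add0r mul1r.
have st : 0 < s - t by rewrite stE invr_gt0 ltr0n.
have -> : n%:R = (s - t)^-1 by rewrite stE invrK.
have -> : (s - t)^-1 * (1 - 3 * s ^+ 2 + 2 * s ^+ 3 - (1 - 3 * t ^+ 2 + 2 * t ^+ 3)) =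
  - 3 * (s + t) + 2 * (s ^+2 + s * t + t ^+ 2).
  by field; rewrite gt_eqF.
have := sqr_ge0 (s + t - 1); have := sqr_ge0 (s - t).
have ss : s ^+ 2 <= 1 by rewrite expr_le1.
have tt : t ^+ 2 <= 1 by rewrite expr_le1.
rewrite ler_norml => d1 d2; apply/andP; split; first lra.
have : s * t <= 1 by rewrite mulr_ile1.
nra.
Qed.

(** The centred second difference of a cubic, divided by the squared mesh, is exactly its second
    derivative at the middle node, here [12 t - 6]. *)
Lemma cutoff_diff2 n i : (i.+1 < n)%N -> `|n%:R ^+ 2 * fdiff2 (cutoff n) i| <= 6.
Proof.
move=> ni; have n0 : (0 < n)%N by lia.
rewrite /fdiff2 !cutoffE//=; try lia.
have /andP[] := nodeP n0 (ltnW ni).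
have -> : n%:R ^+ 2 * (1 - 3 * (i.+2%:R / n%:R) ^+ 2 + 2 * (i.+2%:R / n%:R) ^+ 3 -
  2 * (1 - 3 * (i.+1%:R / n%:R) ^+ 2 + 2 * (i.+1%:R / n%:R) ^+ 3) +
  (1 - 3 * (i%:R / n%:R) ^+ 2 + 2 * (i%:R / n%:R) ^+ 3)) =
  12 * (i.+1%:R / n%:R) - 6 :> R.
  rewrite -!natr1; field; by rewrite pnatr_eq0 -lt0n.
move: (_ / _) => t t0 t1; rewrite ler_norml; apply/andP; split; lra.
Qed.

(** The double zero of the cubic at [t = 1] makes the last nonzero value of order [n^-2]; this
    controls the second difference that straddles the end of the support. *)
Lemma cutoff_pred n : (0 < n)%N -> `|n%:R ^+ 2 * cutoff n n.-1| <= 3.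
Proof.
move=> n0; rewrite cutoffE//= ?leq_pred//.
have -> : n.-1%:R = n%:R - 1 :> R by rewrite -{2}(prednK n0) -natr1 addrK.
have -> : n%:R ^+ 2 * (1 - 3 * ((n%:R - 1) / n%:R) ^+ 2 + 2 * ((n%:R - 1) / n%:R) ^+ 3)
   = 3 - 2 * n%:R^-1 :> R.
  by field; rewrite pnatr_eq0 -lt0n.
have : 0 <= (n%:R^-1 : R) <= 1.
  by rewrite invr_ge0 ler0n/= invf_le1 ?ltr0n// ler1n.
move: (_^-1) => t /andP[t0 t1]; rewrite ler_norml; apply/andP; split; lra.
Qed.

(** A discrete H^2 bound for a function on [0,1] sampled at mesh [1/n]: sup norms of the function
    and of its derivative, L2 norm of its second derivative. The two lower orders are needed because
    multiplying by the cut-off mixes all three. *)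
Record row_bound n u (rho : R) : Prop := RowBound {
  rb_val : forall i, (i <= n)%N -> `|u i| <= rho;
  rb_diff : forall i, (i < n)%N -> `|n%:R * fdiff u i| <= rho;
  rb_diff2 : \sum_(0 <= i < n.-1) (n%:R ^+ 2 * fdiff2 u i) ^+ 2 <= n%:R * rho ^+ 2 }.

Lemma row_bound_rev n u rho : row_bound n u rho ->
  row_bound n (fun i => u (n - i)%N) rho.
Proof.
case=> h0 h1 h2; split.
- by move=> i _; apply: h0; rewrite leq_subr.
- move=> i ni; have := h1 (n - i.+1)%N; rewrite /fdiff subnSK//.
  by rewrite -normrN -mulrN opprB; apply; lia.
- rewrite big_nat_rev/= add0n (le_trans _ h2)// le_eqVlt; apply/orP; left; apply/eqP.
  apply: eq_big_nat => i ni; congr ((_ * _) ^+ 2); rewrite /fdiff2.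
  have -> : (n - (n.-1 - i.+1).+2 = i)%N by lia.
  have -> : (n - (n.-1 - i.+1).+1 = i.+1)%N by lia.
  by have -> : (n - (n.-1 - i.+1) = i.+2)%N; [lia|ring].
Qed.

Lemma row_bound_cutoff n u rho : (0 < n)%N -> row_bound n u rho ->
  \sum_(0 <= i < n) (n%:R ^+ 2 * fdiff2 (fun i => cutoff n i * u i) i) ^+ 2
  <= 160 * (n%:R * rho ^+ 2).
Proof.
move=> n0 [h0 h1 h2].
have sq := sqr_le_norm.
case: n n0 h0 h1 h2 => // n _ h0 h1 /= h2.
rewrite big_nat_recr//=.
apply: (@le_trans _ _ (\sum_(0 <= i < n)
   (3 * (n.+1%:R ^+ 2 * fdiff2 u i) ^+ 2 + 156 * rho ^+ 2) + 9 * rho ^+ 2)).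
  apply: lerD.
    apply: ler_sum_nat => i /andP[_ lin].
    set N : R := n.+1%:R; set W := cutoff n.+1.
    (* Leibniz rule for second differences. The factors [1], [2], [6] bounding the cut-off give
       [156 = 3 * (4 * 4 + 36)]. *)
    have -> : N ^+ 2 * fdiff2 (fun i => W i * u i) i =
      W i.+1 * (N ^+ 2 * fdiff2 u i) +
      (N * fdiff W i.+1) * (N * fdiff u i + N * fdiff u i.+1) +
      (N ^+ 2 * fdiff2 W i) * u i by rewrite /fdiff /fdiff2; ring.
    have /sq := cutoff_le1 i.+1 (ltn0Sn n).
    have /sq := @cutoff_diff n.+1 i.+1 lin.
    have /sq := @cutoff_diff2 n.+1 i lin.
    have /sq := h0 i (leqW (ltnW lin)).
    have /sq := h1 i (leqW lin).
    have /sq := h1 i.+1 lin.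
    rewrite -/N -/W.
    set x := N ^+ 2 * fdiff2 u i; set y1 := N * fdiff u i; set y2 := N * fdiff u i.+1.
    set z := u i; set w0 := W _; set w1 := N * fdiff W _; set w2 := N ^+ 2 * _.
    move=> H1 H2 H3 H4 H5 H6.
    have P (p q s t : R) : p ^+2 <= q -> s ^+ 2 <= t -> (p * s) ^+ 2 <= q * t.
      by move=> pq st; rewrite exprMn ler_pM ?sqr_ge0.
    have Q1 := P _ _ _ _ H6 (lexx (x ^+ 2)).
    have H12 : (y1 + y2) ^+ 2 <= 4 * rho ^+ 2 by have := sqr_ge0 (y1 - y2); lra.
    have Q2 := P _ _ _ _ H5 H12.
    have Q3 := P _ _ _ _ H4 H3.
    have := sqr_ge0 (w0 * x - w1 * (y1 + y2)).
    have := sqr_ge0 (w0 * x - w2 * z).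
    have := sqr_ge0 (w1 * (y1 + y2) - w2 * z).
    lra.
  (* The last second difference also involves values of [u] beyond the row, about which [row_bound]
     says nothing; there the cut-off is 0. *)
  have -> : fdiff2 (fun i => cutoff n.+1 i * u i) n = cutoff n.+1 n * u n.
    by rewrite /fdiff2 (@cutoff_eq0 _ n.+2)// (@cutoff_eq0 _ n.+1)//; ring.
  have /sq H1 := cutoff_pred (ltn0Sn n).
  have /sq H2 := h0 n (leqnSn n).
  rewrite mulrA exprMn.
  apply: (@le_trans _ _ (3 ^+ 2 * rho ^+ 2)); last lra.
  by rewrite ler_pM ?sqr_ge0.
rewrite big_split/= -mulr_sumr sumr_const_nat subn0 -mulr_natl.
rewrite -natr1 in h2 *.
have := sqr_ge0 rho; have : 0 <= n%:R :> R by [].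
nra.
Qed.

(* A linear extension from the index interval [n, 2n] to [0, 3n], vanishing at
   both ends and bounded both in l2 and for second differences. *)
Definition bext n u k : R :=
  hestenes n (fun i => cutoff n i * u i) k +
  hestenes n (fun i => cutoff n i * u (n - i)%N) (3 * n - k)%N.

Let cutM0 n u i : (n <= i)%N -> cutoff n i * u i = 0.
Proof. by move=> ni; rewrite cutoff_eq0// mul0r. Qed.

Lemma bext0 n u : bext n u 0 = 0.
Proof.
by rewrite /bext hestenes0 ?hestenes_eq0 ?addr0//; try exact: cutM0; lia.
Qed.

Lemma bext_end n u : bext n u (3 * n)%N = 0.
Proof.
rewrite /bext subnn hestenes0 ?hestenes_eq0 ?addr0//; try exact: cutM0; try lia.
Qed.

(** On the middle block neither summand is reflected, and the two cut-offs form a partition of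
    unity. *)
Lemma bextE n u i : (0 < n)%N -> (i <= n)%N -> bext n u (n + i)%N = u i.
Proof.
move=> n0 ni; rewrite /bext /hestenes leq_addr addKn.
have -> : (n <= 3 * n - (n + i))%N by lia.
have -> : (3 * n - (n + i) - n = n - i)%N by lia.
by rewrite subKn// -mulrDl cutoff_compl// mul1r.
Qed.

Lemma bext_lin n u v w (c d e : R) k :
  bext n (fun i => c * u i + d * v i + e * w i) k =
  c * bext n u k + d * bext n v k + e * bext n w k.
Proof. rewrite /bext /hestenes /=; by case: ifP => _; case: ifP => _; ring. Qed.

(** The two-variable extension can be read rows first or columns first, so a single estimate serves
    both pure second differences. *)
Lemma bext_comm n m (F : nat -> nat -> R) k l :
  bext m (fun j => bext n (F ^~ j) k) l = bext n (fun i => bext m (F i) l) k.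
Proof. by rewrite /bext /hestenes; do 4 case: ifP => _; ring. Qed.

Lemma bext_l2 n u : (0 < n)%N ->
  \sum_(0 <= k < (3 * n).+1) bext n u k ^+ 2 <= 108 * \sum_(0 <= i < n.+1) u i ^+ 2.
Proof.
move=> n0.
have H v : \sum_(0 <= k < (3 * n).+1) hestenes n (fun i => cutoff n i * v i) k ^+ 2
    <= 27 * \sum_(0 <= i < n.+1) v i ^+ 2.
  have -> : ((3 * n).+1 = n + n + n.+1)%N by lia.
  rewrite big_nat_add [X in _ + X]big1 ?addr0.
    2: by move=> i _; rewrite hestenes_eq0 ?expr0n ?leq_addr//; exact: cutM0.
  apply: le_trans (hestenes_l2 _) _; first exact: cutM0.
  rewrite ler_pM2l// [leRHS]big_nat_recr//= ler_wpDr ?sqr_ge0//.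
  apply: ler_sum => i _; rewrite exprMn ler_piMl ?sqr_ge0//.
  by have /sqr_le_norm := cutoff_le1 i n0; rewrite expr1n.
apply: (@le_trans _ _ (\sum_(0 <= k < (3 * n).+1)
  (2 * hestenes n (fun i => cutoff n i * u i) k ^+ 2 +
   2 * hestenes n (fun i => cutoff n i * u (n - i)%N) ((3 * n).+1 - k.+1) ^+ 2))).
  apply: ler_sum => k _; rewrite /bext subSS.
  move: (hestenes _ _ _) (hestenes _ _ _) => x y; have := sqr_ge0 (x - y); lra.
have H1 := H u; have H2 := H (fun i => u (n - i)%N).
rewrite big_split/= -!mulr_sumr.
have -> : \sum_(0 <= i < (3 * n).+1) hestenes n (fun i0 : nat => cutoff n i0 * u (n - i0)%N)
   ((3 * n).+1 - i.+1) ^+ 2 = \sum_(0 <= i < (3 * n).+1) hestenes n (fun i0 : nat => cutoff n i0 * u (n - i0)%N)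
   i ^+ 2 by rewrite [RHS]big_nat_rev/= add0n.
have E : \sum_(0 <= i < n.+1) u (n - i)%N ^+ 2 = \sum_(0 <= i < n.+1) u i ^+ 2.
  by rewrite [RHS]big_nat_rev/= add0n; apply: eq_bigr => i _; rewrite subSS.
by rewrite /= E in H2; lra.
Qed.

Lemma bext_diff2 n u rho : (0 < n)%N -> row_bound n u rho ->
  \sum_(0 <= k < (3 * n).-1) (n%:R ^+ 2 * fdiff2 (bext n u) k) ^+ 2
  <= 4 * 200 * 160 * (n%:R * rho ^+ 2).
Proof.
move=> n0 hu.
have H v : row_bound n v rho ->
   \sum_(0 <= k < (3 * n).-1)
      (n%:R ^+ 2 * fdiff2 (hestenes n (fun i => cutoff n i * v i)) k) ^+ 2
    <= 200 * 160 * (n%:R * rho ^+ 2).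
  move=> hv.
  have -> : ((3 * n).-1 = n + n + n.-1)%N by lia.
  rewrite big_nat_add [X in _ + X]big1 ?addr0.
    2: move=> i _; rewrite /fdiff2 !hestenes_eq0; try exact: cutM0; try lia; ring.
  under eq_bigr do rewrite exprMn.
  rewrite -mulr_sumr.
  have h1 := row_bound_cutoff n0 hv.
  have h2 := @hestenes_diff2 n _ (@cutM0 n v).
  have h3 := ler_wpM2l (sqr_ge0 (n%:R ^+ 2)) h2.
  apply: (le_trans h3).
  rewrite mulrCA -mulrA ler_pM2l// mulr_sumr.
  by under eq_bigr do rewrite -exprMn.
apply: (@le_trans _ _ (\sum_(0 <= k < (3 * n).-1)
  (2 * (n%:R ^+ 2 * fdiff2 (hestenes n (fun i => cutoff n i * u i)) k) ^+ 2 +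
   2 * (n%:R ^+ 2 * fdiff2 (hestenes n (fun i => cutoff n i * u (n - i)%N))
     ((3 * n).-1 - k.+1)) ^+ 2))).
  apply: ler_sum_nat => k kn.
  set p := hestenes n _; set q := hestenes n _.
  have -> : fdiff2 (bext n u) k = fdiff2 p k + fdiff2 q ((3 * n).-1 - k.+1).
    rewrite /fdiff2 /bext -/p -/q.
    have -> : ((3 * n).-1 - k.+1 = (3 * n - k.+2))%N by lia.
    have -> : ((3 * n - k.+2).+1 = (3 * n - k.+1))%N by lia.
    have -> : ((3 * n - k.+1).+1 = (3 * n - k))%N by lia.
    ring.
  rewrite mulrDr; move: (_ * fdiff2 p _) (_ * fdiff2 q _) => x y.
  by have := sqr_ge0 (x - y); lra.
have H1 := H u hu; have H2 := H _ (row_bound_rev hu).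
rewrite big_split/= -!mulr_sumr.
rewrite big_nat_rev/= add0n in H2.
lra.
Qed.

(** The rows and columns need not be bounded uniformly, only on average: the squares of [rho] and
    [sigma] enter through their sums. Extending in one variable costs [4 * 200 * 160] on second
    differences, and extending in the other costs [108] in l2. *)
Theorem grid_mixed_estimate (u : nat -> nat -> R) n m (rho sigma : nat -> R) (K : R) :
  (0 < n)%N -> (0 < m)%N ->
  (forall j, (j <= m)%N -> row_bound n (u ^~ j) (rho j)) ->
  (forall i, (i <= n)%N -> row_bound m (u i) (sigma i)) ->
  \sum_(0 <= j < m.+1) rho j ^+ 2 <= K * m%:R ->
  \sum_(0 <= i < n.+1) sigma i ^+ 2 <= K * n%:R ->
  \sum_(0 <= i < n) \sum_(0 <= j < m) (n%:R * m%:R * mixdiff u i j) ^+ 2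
   <= 108 * (4 * 200 * 160) * K * (n%:R * m%:R).
Proof.
move=> n0 m0 hr hs hK hK'.
pose F k l := bext m (fun j => bext n (u ^~ j) k) l.
have bz k m' (f : nat -> R) : (forall i, f i = 0) -> bext m' f k = 0.
  by move=> f0; rewrite /bext /hestenes !f0 !mulr0; do 2 case: ifP => _; ring.
have En : ((3 * n) = (3 * n).-1.+1)%N by lia.
have Em : ((3 * m) = (3 * m).-1.+1)%N by lia.
have F0 j : F 0%N j = 0 by apply: bz => i; exact: bext0.
have FL j : F (3 * n).-1.+1 j = 0 by rewrite -En; apply: bz => i; exact: bext_end.
have F0' i : F i 0%N = 0 by rewrite /F bext0.
have FL' i : F i (3 * m).-1.+1 = 0 by rewrite -Em /F bext_end.
have FE i j : (i <= n)%N -> (j <= m)%N -> F (n + i)%N (m + j)%N = u i j.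
  by move=> ni mj; rewrite /F bextE// bextE.
(* By linearity, the second difference in one direction of the full extension is the extension in
   the other direction of one-variable second differences. Hence [bext_l2] across the rows, then
   [bext_diff2] on each row. The second use swaps the variables. *)
have half (G : nat -> nat -> R) n' m' (rho' : nat -> R) : (0 < n')%N -> (0 < m')%N ->
  (forall j, (j <= m')%N -> row_bound n' (G ^~ j) (rho' j)) ->
  \sum_(0 <= j < m'.+1) rho' j ^+ 2 <= K * m'%:R ->
  \sum_(0 <= k < (3 * n').-1) \sum_(0 <= l < (3 * m').-1)
    (n'%:R ^+ 2 * fdiff2 (fun k => bext m' (fun j => bext n' (G ^~ j) k) l.+1) k) ^+ 2
   <= 108 * (4 * 200 * 160) * K * (n'%:R * m'%:R).
  move=> n'0 m'0 hG hK0.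
  apply: (@le_trans _ _ (\sum_(0 <= k < (3 * n').-1) \sum_(0 <= l < (3 * m').+1)
    bext m' (fun j => n'%:R ^+ 2 * fdiff2 (bext n' (G ^~ j)) k) l ^+ 2)).
    apply: ler_sum => k _.
    rewrite [leRHS]big_ltn//= big_add1/=.
    have -> : (3 * m' = (3 * m').-1.+1)%N by lia.
    rewrite [leRHS]addrC big_nat_recr//= -addrA ler_wpDr ?addr_ge0 ?sqr_ge0//.
    rewrite le_eqVlt; apply/orP; left; apply/eqP.
    apply: eq_bigr => l _; congr (_ ^+ 2); rewrite /fdiff2.
    transitivity (n'%:R ^+ 2 * bext m' (fun j => bext n' (G ^~ j) k.+2) l.+1
      + (- 2 * n'%:R ^+ 2) * bext m' (fun j => bext n' (G ^~ j) k.+1) l.+1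
      + n'%:R ^+ 2 * bext m' (fun j => bext n' (G ^~ j) k) l.+1); first ring.
    by rewrite -bext_lin; congr (bext _ _ _); apply: funext => j; ring.
  apply: (@le_trans _ _ (\sum_(0 <= k < (3 * n').-1) 108 * \sum_(0 <= j < m'.+1)
     (n'%:R ^+ 2 * fdiff2 (bext n' (G ^~ j)) k) ^+ 2)).
    by apply: ler_sum => k _; exact: bext_l2.
  rewrite -mulr_sumr exchange_big/=.
  apply: (@le_trans _ _ (108 * \sum_(0 <= j < m'.+1) 4 * 200 * 160 * (n'%:R * rho' j ^+ 2))).
    by rewrite ler_pM2l//; apply: ler_sum_nat => j /andP[_]; rewrite ltnS => mj; apply: bext_diff2 => //; exact: hG.
  rewrite -!mulr_sumr -!mulrA !ler_pM2l// [leRHS]mulrCA ler_pM2l ?ltr0n//.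
have Hx := half _ _ _ _ n0 m0 hr hK.
have Hy := half (fun j i => u i j) _ _ _ m0 n0 hs hK'.
rewrite exchange_big/= in Hy.
have HF := mixdiff_by_parts F0 FL F0' FL'.
apply: (@le_trans _ _ ((n%:R * m%:R) ^+ 2 *
   \sum_(0 <= k < (3 * n).-1.+1) \sum_(0 <= l < (3 * m).-1.+1) mixdiff F k l ^+ 2)).
  have -> : ((3 * n).-1.+1 = n + (n + n))%N by lia.
  have -> : ((3 * m).-1.+1 = m + (m + m))%N by lia.
  have mid (G : nat -> R) p : (forall i, 0 <= G i) ->
      \sum_(0 <= i < p) G (p + i)%N <= \sum_(0 <= i < p + (p + p)) G i.
    move=> G0; rewrite 2!big_nat_add addrCA lerDl addr_ge0//; exact: sumr_ge0.
  have -> : \sum_(0 <= i < n) \sum_(0 <= j < m) (n%:R * m%:R * mixdiff u i j) ^+ 2 =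
     (n%:R * m%:R) ^+ 2 * \sum_(0 <= i < n) \sum_(0 <= j < m) mixdiff F (n + i) (m + j) ^+ 2.
    rewrite mulr_sumr; apply: eq_big_nat => i /andP[_ ni].
    rewrite mulr_sumr; apply: eq_big_nat => j /andP[_ mj].
    by rewrite exprMn /mixdiff -!addnS !FE// ltnW.
  rewrite ler_pM2l ?exprn_gt0 ?mulr_gt0 ?ltr0n//.
  apply: (@le_trans _ _ (\sum_(0 <= i < n) \sum_(0 <= j < m + (m + m)) mixdiff F (n + i) j ^+ 2)).
    by apply: ler_sum => i _; apply: (mid (fun j => mixdiff F (n + i) j ^+ 2)) => j; exact: sqr_ge0.
  apply: (mid (fun i => \sum_(0 <= j < m + (m + m)) mixdiff F i j ^+ 2)) => i.
  by apply: sumr_ge0 => j _; exact: sqr_ge0.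
rewrite HF mulr_sumr.
have Hy' : \sum_(0 <= k < (3 * n).-1) \sum_(0 <= l < (3 * m).-1)
    (m%:R ^+ 2 * fdiff2 (F k.+1) l) ^+ 2 <= 108 * (4 * 200 * 160) * K * (n%:R * m%:R).
  rewrite (mulrC n%:R) (le_trans _ Hy)// le_eqVlt; apply/orP; left; apply/eqP.
  apply: eq_bigr => k _; apply: eq_bigr => l _; congr ((_ * _) ^+ 2).
  have FC k' l' : F k' l' = bext n (fun i => bext m (u i) l') k' by exact: bext_comm.
  by rewrite /fdiff2 !FC.
(* The factor [(n m)^2] splits as [n^2] for one pure difference and [m^2] for the other, so
   [x y <= (x^2 + y^2) / 2] leaves exactly the two sums already bounded. *)
apply: (@le_trans _ _ (\sum_(0 <= k < (3 * n).-1) (2^-1 * \sum_(0 <= l < (3 * m).-1)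
    (n%:R ^+ 2 * fdiff2 (F ^~ l.+1) k) ^+ 2 + 2^-1 * \sum_(0 <= l < (3 * m).-1)
    (m%:R ^+ 2 * fdiff2 (F k.+1) l) ^+ 2))).
  apply: ler_sum => k _; rewrite !mulr_sumr -big_split/=; apply: ler_sum => l _.
  set x := fdiff2 _ _; set y := fdiff2 _ _.
  by have := sqr_ge0 (n%:R ^+ 2 * x - m%:R ^+ 2 * y); lra.
rewrite big_split/= -!mulr_sumr.
by move: Hx Hy'; rewrite /F; lra.
Qed.

End Discrete.

(** * Differentiation on [[0, 1]] *)

(** A division-free form in which [t = x] is harmless; linear combinations, squeezes and changes of
    function become inequalities between norms. *)
Definition is_deriv01 (R : realType) (g : R -> R) (x l : R) : Prop :=
  forall e, 0 < e -> exists2 d, 0 < d & forall t, 0 <= t <= 1 -> `|t - x| < d ->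
    `|g t - g x - l * (t - x)| <= e * `|t - x|.

Section Increment.
Variable R : realType.
Local Notation mu := (@lebesgue_measure R).

Local Open Scope ereal_scope.

Lemma nneseries_single (f : nat -> \bar R) k : (forall i, 0 <= f i) ->
  (forall i, i != k -> f i = 0) -> \sum_(i <oo) f i = f k.
Proof.
move=> f0 fk; rewrite (@nneseriesD1 _ f k xpredT)//.
by rewrite eseries0 ?adde0// => i _ /= /fk.
Qed.

Lemma integral_cst_itv (a b c : R) : (a <= b)%R ->
  \int[mu]_(x in `[a, b]) c%:E = (c * (b - a))%:E.
Proof.
move=> ab; rewrite integral_cst/=; last exact: measurable_itv.
rewrite lebesgue_measure_itv/= lte_fin; case: ltgtP ab => // ->.
by rewrite mule0 subrr mulr0.
Qed.

(** A Vitali-Caratheodory majorant. Cut [|w|] into levels of height [eps], cover each level set by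
    an open set, and sum the rounded-up levels over these sets. The last clause is lower
    semicontinuity with a strict gap, the form needed to continue an inequality past a point. *)
Lemma lsc_majorant (a b : R) (w : R -> R) (eps : R) : (a <= b)%R ->
  measurable_fun `[a, b] w -> (0 < eps)%R ->
  exists psi : R -> \bar R,
  [/\ measurable_fun setT psi, (forall x, 0 <= psi x),
      \int[mu]_(x in `[a, b]) psi x <=
        \int[mu]_(x in `[a, b]) `|w x|%:E + (eps * (b - a))%:E + eps%:E &
      forall x, x \in `[a, b] -> exists c d : R,
        [/\ (`|w x| < c)%R, (0 < d)%R &
            forall t : R, (`|t - x| < d)%R -> c%:E <= psi t]].
Proof.
move=> ab mw e0.
pose E (k : nat) : set R := `[a, b] `&` [set x | (k%:R * eps <= `|w x| < k.+1%:R * eps)%R].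
have mE k : measurable (E k).
  have mabs : measurable_fun `[a, b] (fun x => `|w x|%R) by exact: measurableT_comp.
  rewrite (_ : E k = `[a, b] `&` (fun x => `|w x|%R) @^-1` `[(k%:R * eps)%R, (k.+1%:R * eps)%R[%classic).
    exact: mabs.
  by apply/seteqP; split => x /=; rewrite !in_itv.
have Efin k : mu (E k) < +oo.
  apply: (@le_lt_trans _ _ (mu `[a, b])).
    by apply: le_measure; rewrite ?inE; [exact: mE|exact: measurable_itv|exact: subIsetl].
  by rewrite lebesgue_measure_itv/=; case: ifP => // _; rewrite -EFinD ltry.
(* The excess measure is divided by [k.+1] to offset the height [k.+1 * eps] of the level and by
   [2 ^ k.+1] to be summable: the total excess is [eps]. Rounding up costs a further
   [eps * (b - a)]. *)
have /choice[V hV] k : exists U : set R,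
    [/\ open U, E k `<=` U & mu (U `\` E k) < (2 ^+ k.+1 * k.+1%:R)^-1%:E].
  apply: lebesgue_regularity_outer; [exact: mE|exact: Efin|].
  by rewrite invr_gt0 mulr_gt0// exprn_gt0.
have mV k : measurable (V k) by apply: open_measurable; have [] := hV k.
pose psi (x : R) := \sum_(k <oo) ((k.+1%:R * eps)%:E * (\1_(V k) x)%:E).
have t0 k (x : R) (A : nat -> set R) : 0 <= (k.+1%:R * eps)%:E * (\1_(A k) x)%:E.
  by rewrite -EFinM lee_fin !mulr_ge0// ltW.
have mt k (A : nat -> set R) D : measurable (A k) ->
    measurable_fun D (fun x : R => (k.+1%:R * eps)%:E * (\1_(A k) x)%:E).
  move=> mA; apply: emeasurable_funM; first exact: measurable_cst.
  by apply/measurable_EFinP; exact: measurable_indic.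
have intE k (A : nat -> set R) : measurable (A k) ->
   \int[mu]_(x in `[a, b]) ((k.+1%:R * eps)%:E * (\1_(A k) x)%:E) =
   (k.+1%:R * eps)%:E * mu (A k `&` `[a, b]).
  move=> mA; rewrite ge0_integralZl_EFin//.
  - by rewrite integral_indic.
  - by apply/measurable_EFinP; exact: measurable_indic.
  - by rewrite mulr_ge0// ltW.
exists psi; split.
- apply: ge0_emeasurable_sum => k x *; first exact: t0.
  exact: mt.
- by move=> x; apply: nneseries_ge0 => k _ _; exact: t0.
- rewrite /psi integral_nneseries//=; last first.
    by move=> k; exact: mt.
  apply: (@le_trans _ _ (\sum_(k <oo) ((k.+1%:R * eps)%:E * mu (E k) + (eps / (2 ^ k.+1)%:R)%:E))).
    apply: lee_nneseries => [k _ _|k _].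
      by apply: integral_ge0 => x _; exact: t0.
    rewrite intE//.
    have [_ sEV ltEV] := hV k.
    have le : mu (V k `&` `[a, b]) <= mu (E k) + (2 ^+ k.+1 * k.+1%:R)^-1%:E.
      apply: (@le_trans _ _ (mu (V k))).
        apply: le_measure; rewrite ?inE; [|exact: mV|exact: subIsetl].
        by apply: measurableI; [exact: mV|exact: measurable_itv].
      rewrite -{1}(setDUK sEV) measureU//; last by rewrite setDE setICA setICr setI0.
      + by rewrite leeD2l// ltW.
      + exact: mE.
      + by apply: measurableD; [exact: mV|exact: mE].
    apply: (@le_trans _ _ ((k.+1%:R * eps)%:E * (mu (E k) + (2 ^+ k.+1 * k.+1%:R)^-1%:E))).
      by rewrite lee_pmul2l// lte_fin mulr_gt0.
    rewrite muleDr//; last by rewrite ge0_adde_def// inE// lee_fin invr_ge0 mulr_ge0// exprn_ge0.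
    rewrite leeD2l// -EFinM lee_fin le_eqVlt; apply/orP; left; apply/eqP.
    by rewrite natrX; field; rewrite expf_neq0//= pnatr_eq0.
  apply: le_trans (epsilon_trick _ _ _) _; last 1 first.
  - rewrite leeD2r//.
    have -> : \sum_(k <oo) ((k.+1%:R * eps)%:E * mu (E k)) =
       \int[mu]_(x in `[a, b]) (\sum_(k <oo) ((k.+1%:R * eps)%:E * (\1_(E k) x)%:E)).
      rewrite integral_nneseries//=; last by move=> k; exact: mt.
      apply: eq_eseriesr => k _; rewrite intE//; congr (_ * mu _).
      by rewrite /E setIAC setIid.
    apply: (@le_trans _ _ (\int[mu]_(x in `[a, b]) (`|w x|%:E + eps%:E))).
      apply: ge0_le_integral => //.
      + by move=> x _; apply: nneseries_ge0 => k _ _; exact: t0.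
      + apply: ge0_emeasurable_sum => k x *; first exact: t0.
        exact: mt.
      + apply: emeasurable_funD; last exact: measurable_cst.
        by apply/measurable_EFinP; exact: measurableT_comp.
      + move=> x xab.
        pose k := Num.truncn (`|w x| / eps)%R.
        have := @truncn_itv _ (`|w x| / eps)%R (divr_ge0 (normr_ge0 _) (ltW e0)).
        rewrite -/k ler_pdivlMr// ltr_pdivrMr// => /andP[k1 k2].
        rewrite (@nneseries_single _ k)//.
          rewrite -EFinM -EFinD lee_fin.
          have h : (k.+1%:R * eps <= `|w x| + eps)%R.
            by rewrite -natr1 mulrDl mul1r lerD2r.
          rewrite indicE; case: (_ \in _); rewrite /= ?mulr1// mulr0.
          by rewrite addr_ge0// ltW.
        move=> i ik; rewrite indicE memNset ?mule0// /E => -[_ /= /andP[i1 i2]].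
        have ki : (i%:R * eps < k.+1%:R * eps)%R by exact: le_lt_trans k2.
        have ki' : (k%:R * eps < i.+1%:R * eps)%R by exact: le_lt_trans i2.
        by move: ki ki'; rewrite !ltr_pM2r// !ltr_nat; move/eqP: ik; lia.
    rewrite ge0_integralD//=; [|by apply/measurable_EFinP; exact: measurableT_comp|by move=> x _; rewrite lee_fin ltW].
    by rewrite leeD2l// integral_cst_itv.
  - by move=> k; rewrite mule_ge0// lee_fin mulr_ge0// ltW.
  - exact: ltW.
- move=> x xab.
  pose k := Num.truncn (`|w x| / eps)%R.
  have := @truncn_itv _ (`|w x| / eps)%R (divr_ge0 (normr_ge0 _) (ltW e0)).
  rewrite -/k ler_pdivlMr// ltr_pdivrMr// => /andP[k1 k2].
  have [oV EV _] := hV k.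
  have Vx : V k x by apply: EV; split => //=; rewrite k1.
  have : nbhs x (V k) by exact: open_nbhs_nbhs.
  move=> /nbhs_ballP[d /= d0 dV].
  exists (k.+1%:R * eps)%R, d; split => // t tx.
  have Vt : V k t by apply: dV; rewrite /ball/= distrC.
  rewrite /psi (@nneseriesD1 _ _ k xpredT)//.
  rewrite [in X in X + _]indicE mem_set// mule1 leeDl//.
  by apply: nneseries_ge0 => i _ _; exact: t0.
Qed.

Lemma is_deriv01_lip (v : R -> R) x l : is_deriv01 v x l -> exists2 d : R, (0 < d)%R &
  forall t : R, (0 <= t <= 1)%R -> (`|t - x| < d)%R ->
    (`|v t - v x| <= (`|l| + 1) * `|t - x|)%R.
Proof.
move=> /(_ 1%R ltr01)[d d0 h]; exists d => // t t01 tx.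
have := h t t01 tx; rewrite mul1r => {}h.
have -> : (v t - v x = (v t - v x - l * (t - x)) + l * (t - x))%R by rewrite subrK.
by rewrite (le_trans (ler_normD _ _))// normrM; lra.
Qed.

Lemma deriv01_increment_le (v w : R -> R) (a b : R) : (0 <= a)%R -> (a <= b)%R -> (b <= 1)%R ->
  (forall x : R, 0 <= x <= 1 -> is_deriv01 v x (w x))%R -> measurable_fun `[a, b] w ->
  `|v b - v a|%:E <= \int[mu]_(x in `[a, b]) `|w x|%:E.
Proof.
move=> a0 ab b1 vw mw.
apply/lee_addgt0Pr => e e0.
pose eps := (e / 2)%R; have eps0 : (0 < eps)%R by rewrite divr_gt0.
have [psi [mpsi psi0 psile psige]] := lsc_majorant ab mw eps0.
pose Phi x := \int[mu]_(t in `[a, x]) psi t.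
have mpsiD D : measurable_fun D psi by exact: measurable_funTS.
have Phi_le x y : (x <= y)%R -> Phi x <= Phi y.
  move=> xy; apply: ge0_subset_integral => //; try exact: measurable_itv; try exact: mpsiD.
  by move=> t /=; rewrite !in_itv/= => /andP[-> /le_trans]; apply.
suff H : `|v b - v a|%:E <= Phi b.
  apply: (le_trans H); apply: (le_trans psile).
  rewrite -addeA leeD2l// -EFinD lee_fin /eps; nra.
pose S := [set x : R | (a <= x <= b)%R /\ `|v x - v a|%:E <= Phi x].
have Sa : S a.
  by split; rewrite ?lexx//= subrr normr0; apply: integral_ge0 => t _; exact: psi0.
have Sub : ubound S b by move=> x [/andP[]].
have hS : has_sup S by split; [exists a|exists b].
have cS : (a <= sup S)%R by apply: ub_le_sup => //; exists b.
have cb : (sup S <= b)%R by apply: ge_sup => //; exists a.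
set c := sup S in cS cb.
have c01 : (0 <= c <= 1)%R by lra.
have Sc : S c.
  split; first by rewrite cS.
  apply/lee_addgt0Pr => e1 e10.
  have [d d0 hd] := is_deriv01_lip (vw c c01).
  set L := (`|w c| + 1)%R in hd.
  have L0 : (0 < L)%R by rewrite ltr_wpDl.
  have m0 : (0 < Num.min d (e1 / L))%R by rewrite lt_min d0 divr_gt0.
  have [s [/andP[sa sb] sPhi] sc] := sup_adherent m0 hS.
  have sc' : (s <= c)%R by apply: ub_le_sup; [exists b|split => //; rewrite sa].
  have [sd sL] : (c - s < d /\ c - s < e1 / L)%R.
    by split; apply: lt_le_trans (_ : (_ < Num.min d (e1 / L))%R) _; rewrite ?ge_min ?lexx ?orbT//; rewrite -/c in sc; lra.
  have sE : (`|s - c| = c - s)%R by rewrite distrC ger0_norm// subr_ge0.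
  have := hd s ltac:(lra); rewrite sE => /(_ sd) hs.
  have hs' : (L * (c - s) <= e1)%R by rewrite mulrC -ler_pdivlMr// ltW.
  apply: (@le_trans _ _ (`|v s - v a|%:E + e1%:E)).
    rewrite -EFinD lee_fin.
    have -> : (v c - v a = (v s - v a) - (v s - v c))%R by lra.
    by rewrite (le_trans (ler_normB _ _))//; lra.
  by rewrite leeD2r// (le_trans sPhi)// Phi_le.
have [<-|cltb] : c = b \/ (c < b)%R.
- by have := cb; rewrite le_eqVlt => /orP[/eqP|]; [left|right].
- by case: Sc.
exfalso.
(* Just after [c], [Phi] grows at rate at least [C], while [v] moves at rate at most
   [|w c| + (C - |w c|) = C]. *)
have [C [d [wC d0 hC]]] := psige c ltac:(by rewrite in_itv/= cS).
have [d' d'0 hd'] := vw c c01 (C - `|w c|)%R ltac:(by rewrite subr_gt0).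
pose h : R := Num.min (b - c)%R (Num.min d d' / 2)%R.
have h0 : (0 < h)%R by rewrite !lt_min subr_gt0 cltb/= divr_gt0// lt_min d0.
have hbc : (h <= b - c)%R by rewrite ge_min lexx.
have hdd : (h <= Num.min d d' / 2)%R by rewrite ge_min lexx orbT.
have hd : (h < d)%R.
  apply: le_lt_trans hdd _; rewrite ltr_pdivrMr// gt_min; apply/orP; left; lra.
have hd2 : (h < d')%R.
  apply: le_lt_trans hdd _; rewrite ltr_pdivrMr// gt_min; apply/orP; right; lra.
suff St : S (c + h)%R by have := ub_le_sup (ex_intro _ b Sub) St; rewrite -/c; lra.
split; first by lra.
have hh : (`|c + h - c| = h)%R by rewrite addrAC subrr add0r gtr0_norm.
have := hd' (c + h)%R ltac:(lra); rewrite hh => /(_ hd2) vh.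
have vh' : (`|v (c + h) - v c| <= C * h)%R.
  have -> : (v (c + h) - v c = (v (c + h) - v c - w c * (c + h - c)) + w c * (c + h - c))%R.
    by rewrite subrK.
  rewrite (le_trans (ler_normD _ _))// normrM hh; nra.
have PhiE : Phi (c + h)%R = Phi c + \int[mu]_(t in `]c, (c + h)%R]) psi t.
  rewrite /Phi -ge0_integral_setU//; try exact: measurable_itv; try exact: mpsiD.
  - congr (integral _ _ _); apply/seteqP; split => t /=; rewrite !in_itv/=.
      move=> /andP[t1 t2]; have [tc|tc] := lerP t c; [left|right]; exact/andP.
    by case=> /andP[t1 t2]; apply/andP; split => //; lra.
  - apply/disj_setPS => t []/=; rewrite !in_itv/= => /andP[_ t1] /andP[]; lra.
rewrite PhiE.
apply: (@le_trans _ _ (`|v c - v a|%:E + (C * h)%:E)).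
  rewrite -EFinD lee_fin.
  have -> : (v (c + h) - v a = (v c - v a) + (v (c + h) - v c))%R by lra.
  by rewrite (le_trans (ler_normD _ _))// lerD2l.
apply: leeD; first by case: Sc.
have -> : (C * h)%:E = \int[mu]_(t in `]c, (c + h)%R]) C%:E.
  rewrite integral_cst/=; last exact: measurable_itv.
  rewrite lebesgue_measure_itv/= lte_fin ltrDl h0.
  by rewrite -EFinB -EFinM; congr (_%:E); ring.
apply: ge0_le_integral => //; try exact: measurable_itv; try exact: mpsiD.
- by move=> t _; rewrite lee_fin (le_trans _ (ltW wC)).
- move=> t /=; rewrite in_itv/= => /andP[t1 t2]; apply: hC.
  by rewrite gtr0_norm ?subr_gt0//; lra.
Qed.

End Increment.

Section Deriv01.
Variable R : realType.
Implicit Types (g : R -> R) (x l : R).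

Lemma near_unit_itvP x (P : set R) :
  (\forall t \near within (unit_itv R) x^', P t) <->
  exists2 d : R, 0 < d & forall t : R, 0 <= t <= 1 -> t != x -> `|t - x| < d -> P t.
Proof.
split.
  rewrite near_withinE near_withinE => /nbhs_ballP[d /= d0 h]; exists d => // t t01 tx td.
  by apply: h => //=; rewrite ?/ball/= 1?distrC// in_itv.
move=> [d d0 h]; rewrite near_withinE near_withinE; apply/nbhs_ballP; exists d => //= t.
move=> td tx; rewrite /unit_itv/= in_itv/= => t01.
by apply: h => //; rewrite distrC; exact: td.
Qed.

Lemma within01_proper x : 0 <= x <= 1 -> ProperFilter (within (unit_itv R) x^').
Proof.
move=> /andP[x0 x1]; split; last exact: within_filter.
move=> /near_unit_itvP[d d0]; pose h : R := Num.min (d / 2) (1 / 2).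
have h0 : 0 < h by rewrite lt_min !divr_gt0.
have hd : h < d by rewrite gt_min; apply/orP; left; lra.
have h1 : h <= 1 / 2 by rewrite ge_min lexx orbT.
have [xh|xh] := lerP x (1 / 2).
- move=> H; apply: (H (x + h)); first by apply/andP; split; lra.
    by apply/eqP; lra.
  by rewrite (_ : x + h - x = h) ?gtr0_norm//; lra.
- move=> H; apply: (H (x - h)); first by apply/andP; split; lra.
    by apply/eqP; lra.
  by rewrite (_ : x - h - x = - h) ?normrN ?gtr0_norm//; lra.
Qed.

Lemma is_deriv01P g x l :
  is_deriv01 g x l <-> diff_quot g x t @[t --> within (unit_itv R) x^'] --> l.
Proof.
split.
  move=> h; apply/cvgrPdist_le => e e0; apply/near_unit_itvP.
  have [d d0 hd] := h e e0; exists d => // t t01 tx td.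
  have tx0 : 0 < `|t - x| by rewrite normr_gt0 subr_eq0.
  have := hd t t01 td; rewrite -ler_pdivrMr// -normfV -normrM distrC.
  apply: le_trans; rewrite le_eqVlt; apply/orP; left; apply/eqP; congr (`|_|).
  by rewrite /diff_quot; field; rewrite subr_eq0.
move=> /cvgrPdist_le h e e0; have /near_unit_itvP[d d0 hd] := h e e0.
exists d => // t t01 td; have [->|tx] := eqVneq t x.
  by rewrite !subrr mulr0 subrr normr0 mulr0.
have tx0 : 0 < `|t - x| by rewrite normr_gt0 subr_eq0.
rewrite -ler_pdivrMr// -normfV -normrM.
apply: le_trans (hd t t01 tx td); rewrite distrC le_eqVlt; apply/orP; left; apply/eqP.
by congr (`|_|); rewrite /diff_quot; field; rewrite subr_eq0.
Qed.

Lemma derivable01_is_deriv g x : derivable01 g x -> is_deriv01 g x (deriv01 g x).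
Proof. by move=> h; apply/is_deriv01P. Qed.

Lemma is_deriv01_derivable g x l : 0 <= x <= 1 -> is_deriv01 g x l ->
  derivable01 g x /\ deriv01 g x = l.
Proof.
move=> x01 /is_deriv01P h; split; first by apply/cvg_ex; exists l.
have FF := within01_proper x01.
exact/cvg_lim.
Qed.

Lemma deriv01_unique g x l l' : 0 <= x <= 1 -> is_deriv01 g x l -> is_deriv01 g x l' -> l = l'.
Proof.
by move=> x01 /(is_deriv01_derivable x01)[_ <-] /(is_deriv01_derivable x01)[_ <-].
Qed.

Lemma is_deriv01_lin g h x l l' (c : R) : is_deriv01 g x l -> is_deriv01 h x l' ->
  is_deriv01 (fun t => g t + c * h t) x (l + c * l').
Proof.
move=> gx hx e e0.
have c0 : 0 < `|c| + 1 by rewrite ltr_wpDl.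
have [d d0 hd] := gx (e / 2) (divr_gt0 e0 (ltr0n R 2)).
have e'0 : 0 < e / 2 / (`|c| + 1) by rewrite !divr_gt0.
have [d' d'0 hd'] := hx _ e'0.
exists (Num.min d d'); first by rewrite lt_min d0.
move=> t t01; rewrite lt_min => /andP[td td'].
have -> : g t + c * h t - (g x + c * h x) - (l + c * l') * (t - x) =
  (g t - g x - l * (t - x)) + c * (h t - h x - l' * (t - x)) by ring.
apply: le_trans (ler_normD _ _) _; rewrite normrM.
have h1 := hd t t01 td; have h2 := hd' t t01 td'.
have : `|c| * `|h t - h x - l' * (t - x)| <= (`|c| + 1) * (e / 2 / (`|c| + 1) * `|t - x|).
  by rewrite ler_pM// lerDl.
rewrite mulrA mulrCA mulfV ?gt_eqF// mulr1; lra.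
Qed.

End Deriv01.

Section MeanValue.
Variable R : realType.
Local Notation mu := (@lebesgue_measure R).
Implicit Types (u v w : R -> R) (x l : R).

Lemma is_deriv01_is_derive g x l : 0 < x < 1 -> is_deriv01 g x l -> is_derive x (1 : R) g l.
Proof.
move=> /andP[x0 x1] gx.
have H : h^-1 *: (g (h *: (1 : R) + x) - g x) @[h --> 0^'] --> l.
  apply/cvgrPdist_le => e e0; have [d d0 hd] := gx e e0.
  near=> h.
  have h0 : h != 0 by near: h; exact: nbhs_dnbhs_neq.
  have hd' : `|h| < Num.min d (Num.min x (1 - x)).
    by near: h; apply: dnbhs0_lt; rewrite !lt_min d0 x0/= subr_gt0.
  move: hd'; rewrite !lt_min => /and3P[hd1 hd2 hd3].
  have h01 : 0 <= h + x <= 1.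
    by move: hd2 hd3; rewrite !ltr_norml => /andP[? ?] /andP[? ?]; apply/andP; split; lra.
  have := hd (h + x) h01; rewrite addrK => /(_ hd1) H.
  have hp : 0 < `|h| by rewrite normr_gt0.
  rewrite distrC.
  have -> : h^-1 *: (g (h *: (1 : R) + x) - g x) - l = (g (h + x) - g x - l * h) / h.
    by rewrite /GRing.scale/= mulr1; field.
  by rewrite normrM normfV ler_pdivrMr.
split; first by apply/cvg_ex; exists l.
by apply/cvg_lim.
Unshelve. all: by end_near. Qed.

Lemma derive1_is_deriv01 g x l : derivable g x 1 -> derive1 g x = l -> is_deriv01 g x l.
Proof.
move=> dg <- e e0; rewrite derive1E.
have : h^-1 *: (g (h *: (1 : R) + x) - g x) @[h --> 0^'] --> 'D_1 g x by exact: dg.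
move=> /cvgrPdist_le/(_ e e0); rewrite near_withinE => /nbhs_ballP[d /= d0 hd].
exists d => // t _ td.
have [->|tx] := eqVneq t x; first by rewrite !subrr mulr0 subrr normr0 mulr0.
have tx0 : t - x != 0 by rewrite subr_eq0.
have := hd (t - x); rewrite /ball/= sub0r normrN => /(_ td tx0).
rewrite distrC /GRing.scale/= mulr1 subrK => H.
have hp : 0 < `|t - x| by rewrite normr_gt0.
rewrite -ler_pdivrMr// -normfV -normrM (le_trans _ H)// le_eqVlt; apply/orP; left; apply/eqP.
by congr (`|_|); field.
Qed.

Lemma is_deriv01_cvg g x l : is_deriv01 g x l ->
  g t @[t --> within (unit_itv R) (nbhs x)] --> g x.
Proof.
move=> /is_deriv01_lip[d d0 hd]; apply/cvgrPdist_le => e e0.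
rewrite near_withinE; apply/nbhs_ballP.
have L0 : 0 < `|l| + 1 by rewrite ltr_wpDl.
exists (Num.min d (e / (`|l| + 1))); first by rewrite /= lt_min d0 divr_gt0.
move=> t; rewrite /ball/= lt_min distrC => /andP[td te].
rewrite /unit_itv/= in_itv/= => t01; rewrite distrC (le_trans (hd t t01 td))//.
by rewrite mulrC -ler_pdivlMr// ltW.
Qed.

Lemma deriv01_continuous g (g' : R -> R) : (forall x, 0 <= x <= 1 -> is_deriv01 g x (g' x)) ->
  {within unit_itv R, continuous g}.
Proof.
move=> gg; apply/subspace_continuousP => x; rewrite /unit_itv/= in_itv/= => x01.
exact: is_deriv01_cvg (gg x x01).
Qed.

Lemma deriv01_mean_value u u' a b : 0 <= a -> a < b -> b <= 1 ->
  (forall x, 0 <= x <= 1 -> is_deriv01 u x (u' x)) ->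
  exists c, [/\ a < c, c < b & u b - u a = u' c * (b - a)].
Proof.
move=> a0 ab b1 uu'.
have [||c] := @MVT R u u' a b ab.
- move=> x; rewrite in_itv/= => /andP[ax xb].
  by apply: is_deriv01_is_derive; [apply/andP; split; lra|apply: uu'; apply/andP; split; lra].
- apply: (@continuous_subspaceW _ _ _ (unit_itv R)); last exact: deriv01_continuous uu'.
  by move=> x; rewrite /unit_itv/= !in_itv/= => /andP[ax xb]; apply/andP; split; lra.
- by rewrite in_itv/= => /andP[ac cb] E; exists c.
Qed.

Local Open Scope ereal_scope.

Lemma deriv01_increment_sq (v w : R -> R) (a b : R) : (0 <= a)%R -> (a <= b)%R -> (b <= 1)%R ->
  (forall x : R, 0 <= x <= 1 -> is_deriv01 v x (w x))%R -> measurable_fun `[a, b] w ->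
  ((v b - v a) ^+ 2)%:E <= (b - a)%:E * \int[mu]_(x in `[a, b]) (w x ^+ 2)%:E.
Proof.
move=> a0 ab b1 vw mw.
have [<-|ba] := eqVneq a b.
  by rewrite !subrr expr0n mul0e.
have {ba}ab' : (a < b)%R by rewrite lt_neqAle ba.
have I0 : 0 <= \int[mu]_(x in `[a, b]) (w x ^+ 2)%:E.
  by apply: integral_ge0 => x _; rewrite lee_fin sqr_ge0.
have [Ioo|] := eqVneq (\int[mu]_(x in `[a, b]) (w x ^+ 2)%:E) +oo.
  by rewrite Ioo gt0_muley ?leey// lte_fin subr_gt0.
rewrite -ltey => Ifin.
set I := \int[mu]_(x in `[a, b]) _ in I0 Ifin *.
have fI : I \is a fin_num by rewrite ge0_fin_numE.
have E := deriv01_increment_le a0 ab b1 vw mw.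
set d := `|v b - v a|%R in E.
(* The optimal multiplier in [2 l |w| <= l^2 + w^2]; integrating this inequality gives
   Cauchy-Schwarz. *)
have [l lE] : {l : R | l = (d / (b - a))%R} by exists (d / (b - a))%R.
have d0 : (0 <= d)%R by exact: normr_ge0.
have l0 : (0 <= l)%R by rewrite lE divr_ge0// subr_ge0.
have m1 : measurable_fun `[a, b] (fun x => `|w x|%:E).
  by apply/measurable_EFinP; exact: measurableT_comp.
have m2 : measurable_fun `[a, b] (fun x => (w x ^+ 2)%:E).
  by apply/measurable_EFinP; exact: measurable_funX.
have H : (2 * l * d)%:E <= (l ^+ 2 * (b - a))%:E + I.
  rewrite EFinM.
  apply: (@le_trans _ _ ((2 * l)%:E * \int[mu]_(x in `[a, b]) `|w x|%:E)).
    by rewrite lee_pmul// lee_fin mulr_ge0.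
  rewrite -ge0_integralZl_EFin//; last by rewrite mulr_ge0.
  rewrite -integral_cst_itv// -ge0_integralD//; try exact: measurable_itv; last 2 first.
    by move=> x _; rewrite lee_fin sqr_ge0.
    by move=> x _; rewrite lee_fin sqr_ge0.
  apply: ge0_le_integral => //; try exact: measurable_itv.
  - by move=> x _; rewrite -EFinM lee_fin !mulr_ge0.
  - by apply: emeasurable_funM => //; exact: measurable_cst.
  - by apply: emeasurable_funD => //; exact: measurable_cst.
  - move=> x _; rewrite -EFinM -EFinD lee_fin -[(w x ^+ 2)%R]real_normK ?num_real//.
    by have := sqr_ge0 (l - `|w x|)%R; lra.
rewrite -[I]fineK// in H *.
move: H; rewrite -EFinD -EFinM !lee_fin => H.
rewrite -[((v b - v a) ^+ 2)%R]real_normK ?num_real// -/d.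
have dE : (d = l * (b - a))%R by rewrite lE divfK// subr_eq0 gt_eqF.
have ba0 : (0 < b - a)%R by rewrite subr_gt0.
have H' : (l ^+ 2 * (b - a) <= fine I)%R by move: H; rewrite dE; lra.
have -> : (d ^+ 2 = (b - a) * (l ^+ 2 * (b - a)))%R by rewrite dE; ring.
by rewrite ler_pM2l.
Qed.

(** [G] is the primitive of [w^2] from 0. It makes the Cauchy-Schwarz bound a statement about real
    numbers that telescopes along a grid. *)
Lemma increment_sq_majorant (v w : R -> R) (q : R) :
  (forall x : R, 0 <= x <= 1 -> is_deriv01 v x (w x))%R -> measurable_fun (unit_itv R) w ->
  \int[mu]_(x in unit_itv R) (w x ^+ 2)%:E <= q%:E ->
  exists G : R -> R, (forall x : R, 0 <= x <= 1 -> 0 <= G x <= q)%R /\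
    forall a b, (0 <= a)%R -> (a <= b)%R -> (b <= 1)%R ->
       ((v b - v a) ^+ 2 <= (b - a) * (G b - G a))%R.
Proof.
move=> vw mw Iq.
have m2 : measurable_fun (unit_itv R) (fun x => (w x ^+ 2)%:E).
  by apply/measurable_EFinP; exact: measurable_funX.
have mS (D : set R) : measurable D -> D `<=` unit_itv R -> measurable_fun D (fun x => (w x ^+ 2)%:E).
  by move=> mD DS; apply: measurable_funS m2; [exact: measurable_itv|].
have w0 x : 0 <= (w x ^+ 2)%:E by rewrite lee_fin sqr_ge0.
have le (D : set R) : measurable D -> D `<=` unit_itv R ->
    \int[mu]_(x in D) (w x ^+ 2)%:E <= q%:E.
  move=> mD DS; apply: le_trans Iq; apply: ge0_subset_integral => //; exact: measurable_itv.
have fin (D : set R) : measurable D -> D `<=` unit_itv R ->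
    \int[mu]_(x in D) (w x ^+ 2)%:E \is a fin_num.
  move=> mD DS; rewrite ge0_fin_numE; first exact: le_lt_trans (le D mD DS) (ltry _).
  by apply: integral_ge0.
have sub (a b : R) (c d : bool) : (0 <= a)%R -> (b <= 1)%R ->
    [set` Interval (BSide c a) (BSide d b)] `<=` unit_itv R.
  move=> a0 b1 x; rewrite /unit_itv/= !itv_boundlr/= => /andP[ax xb]; apply/andP; split.
    by move: ax; rewrite bnd_simp; case: (c) => /=; rewrite ?bnd_simp; lra.
  by move: xb; rewrite bnd_simp; case: (d) => /=; rewrite ?bnd_simp; lra.
exists (fun x => fine (\int[mu]_(t in `[0%R, x]) (w t ^+ 2)%:E)); split.
  move=> x /andP[x0 x1]; rewrite fine_ge0; last exact: integral_ge0.
  rewrite -lee_fin fineK; first by apply: le; [exact: measurable_itv|exact: sub].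
  by apply: fin; [exact: measurable_itv|exact: sub].
move=> a b a0 ab b1.
have mw' : measurable_fun `[a, b] w.
  by apply: measurable_funS mw; [exact: measurable_itv|exact: sub].
have := deriv01_increment_sq a0 ab b1 vw mw'.
set Ib := \int[mu]_(x in `[a, b]) _.
have -> : Ib = (fine (\int[mu]_(t in `[0%R, b]) (w t ^+ 2)%:E) -
                fine (\int[mu]_(t in `[0%R, a]) (w t ^+ 2)%:E))%:E.
  rewrite EFinB !fineK; last 2 first.
    by apply: fin; [exact: measurable_itv|apply: sub => //; lra].
    by apply: fin; [exact: measurable_itv|exact: sub].
  apply/eqP; rewrite eq_sym sube_eq; last 2 first.
  - by apply: fin; [exact: measurable_itv|apply: sub].
  - by rewrite ge0_adde_def// inE; apply: integral_ge0.
  rewrite {}/Ib -(integral_itv_obnd_cbnd (r := a)); last first.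
    by apply: mS; [exact: measurable_itv|exact: sub].
  rewrite addeC -ge0_integral_setU//; try exact: measurable_itv.
  - apply/eqP; congr (integral _ _ _); apply/seteqP; split => t /=; rewrite !in_itv/=.
      by move=> /andP[t1 t2]; have [tc|tc] := lerP t a; [left|right]; exact/andP.
    by case=> /andP[t1 t2]; apply/andP; split => //; lra.
  - apply: measurable_funS m2; first exact: measurable_itv.
    by move=> t; rewrite /unit_itv/= !in_itv/= => -[] /andP[t1 t2]; apply/andP; split; lra.
  - apply/disj_setPS => t []/=; rewrite !in_itv/= => /andP[_ t1] /andP[]; lra.
by rewrite -EFinM lee_fin.
Qed.

End MeanValue.

(** * Bound on the mixed increments *)

Section GridRow.
Variable R : realType.
Variables (u u1 G : R -> R) (B q s : R) (n N : nat).
Hypothesis uu1 : forall x : R, 0 <= x <= 1 -> is_deriv01 u x (u1 x).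
Hypothesis Gq : forall x : R, 0 <= x <= 1 -> 0 <= G x <= q.
Hypothesis uG : forall a b : R, 0 <= a -> a <= b -> b <= 1 ->
  (u1 b - u1 a) ^+ 2 <= (b - a) * (G b - G a).
Hypotheses (u0B : `|u 0| <= B) (u1B : `|u 1| <= B).

Let q0 : 0 <= q.
Proof. by have /andP[h1 h2] := Gq (x := 0) ltac:(by rewrite lexx ler01); exact: le_trans h2. Qed.

Let G_le (a b : R) : 0 <= a -> a <= b -> b <= 1 -> G a <= G b.
Proof.
move=> a0 ab b1; have [->//|neab] := eqVneq a b.
have ba : 0 < b - a by rewrite subr_gt0 lt_neqAle neab.
have := le_trans (sqr_ge0 _) (uG a0 ab b1).
by rewrite pmulr_rge0// subr_ge0.
Qed.

Let u1_osc_le (a b : R) : 0 <= a -> a <= b -> b <= 1 -> `|u1 b - u1 a| <= Num.sqrt q.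
Proof.
move=> a0 ab b1; rewrite -sqrtr_sqr ler_sqrt//.
apply: le_trans (uG a0 ab b1) _.
have /andP[h1 h2] := Gq (x := a) ltac:(apply/andP; split; lra).
have /andP[h3 h4] := Gq (x := b) ltac:(apply/andP; split; lra).
have h5 := G_le a0 ab b1.
apply: (@le_trans _ _ (1 * (G b - G a))); last lra.
by rewrite ler_wpM2r ?subr_ge0//; lra.
Qed.

(** The mean value theorem on the whole of [0,1] gives one point where the derivative is at most
    [2 * B]; the oscillation bound carries this everywhere. *)
Let u1_le (x : R) : 0 <= x <= 1 -> `|u1 x| <= 2 * B + Num.sqrt q.
Proof.
move=> /andP[x0 x1]; have [c [c0 c1 E]] := deriv01_mean_value (lexx 0) ltr01 (lexx 1) uu1.
rewrite subr0 mulr1 in E.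
have h1 : `|u1 c| <= 2 * B.
  by rewrite -E (le_trans (ler_normB _ _))// (_ : 2 * B = B + B) ?lerD//; ring.
have -> : u1 x = u1 c + (u1 x - u1 c) by rewrite subrKC.
apply: le_trans (ler_normD _ _) _; rewrite lerD//.
have [xc|cx] := lerP x c; last by apply: u1_osc_le => //; exact: ltW.
by rewrite distrC; apply: u1_osc_le => //; exact: ltW.
Qed.

(** The mesh [1/N] and the number [n] of steps are kept apart because a shifted grid has one step
    fewer than [N]. The comparison [n <= N <= 2n] makes the two scalings equivalent. *)
Lemma grid_row_bound : 0 <= s -> (0 < n)%N -> (n <= N)%N -> (N <= 2 * n)%N ->
  s + n%:R / N%:R <= 1 ->
  row_bound n (fun i => u (s + i%:R / N%:R)) (3 * B + 3 * Num.sqrt q).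
Proof.
move=> s0 n0 nN N2 sn.
have N0 : (0 < N)%N by exact: leq_trans nN.
have NR : 0 < N%:R :> R by rewrite ltr0n.
have B0 : 0 <= B by exact: le_trans u0B.
have sq0 : 0 <= Num.sqrt q by exact: sqrtr_ge0.
pose X (i : nat) : R := s + i%:R / N%:R.
have X0 i : 0 <= X i by rewrite addr_ge0// divr_ge0.
have X1 i : (i <= n)%N -> X i <= 1.
  by move=> ni; apply: le_trans sn; rewrite lerD2l ler_pM2r ?invr_gt0// ler_nat.
have XS i : X i.+1 - X i = N%:R^-1 by rewrite /X -natr1; field; rewrite gt_eqF.
have XSlt i : X i < X i.+1 by rewrite -subr_gt0 XS invr_gt0.
split.
- move=> i ni; rewrite -/(X i).
  have [X00|Xn0] := eqVneq (X i) 0; first by rewrite X00 (le_trans u0B)//; lra.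
  have Xp : 0 < X i by rewrite lt_neqAle eq_sym Xn0 X0.
  have [c [c0 c1 E]] := deriv01_mean_value (lexx 0) Xp (X1 i ni) uu1.
  have h := u1_le (x := c) ltac:(apply/andP; split; [exact: ltW|apply: le_trans (ltW c1) (X1 i ni)]).
  have -> : u (X i) = u 0 + u1 c * (X i - 0) by rewrite -E subrKC.
  rewrite subr0 (le_trans (ler_normD _ _))// normrM (ger0_norm (X0 i)).
  have : `|u1 c| * X i <= `|u1 c| by rewrite ler_piMr// X1.
  have := u0B; lra.
- move=> i ni; rewrite /fdiff -/(X i) -/(X i.+1).
  have [c [c0 c1 E]] := deriv01_mean_value (X0 i) (XSlt i) (X1 i.+1 ni) uu1.
  have h := u1_le (x := c) ltac:(apply/andP; split; [apply: le_trans (X0 i) (ltW c0)|apply: le_trans (ltW c1) (X1 i.+1 ni)]).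
  rewrite E XS mulrCA normrM.
  have -> : `|n%:R / N%:R| = n%:R / N%:R :> R by rewrite ger0_norm// divr_ge0.
  have : `|u1 c| * (n%:R / N%:R) <= `|u1 c|.
    by rewrite ler_piMr// ler_pdivrMr// mul1r ler_nat.
  lra.
(* A second difference of [u] is [1/N] times an increment of [u1] between two mean value points,
   hence over a length at most [2/N]. The intervals overlap twofold, so [G] telescopes to at most
   [2 * q], and [8 * q] fits into [(3 B + 3 sqrt q)^2]. *)
- apply: (@le_trans _ _ (\sum_(0 <= i < n.-1) (2 * N%:R * (G (X i.+2) - G (X i))))).
    apply: ler_sum_nat => i /andP[_ ni].
    have i2n : (i.+2 <= n)%N by lia.
    have i1n : (i.+1 <= n)%N by lia.
    rewrite /fdiff2 -/(X i) -/(X i.+1) -/(X i.+2).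
    have [c [c0 c1 E]] := deriv01_mean_value (X0 i) (XSlt i) (X1 i.+1 i1n) uu1.
    have [d [d0 d1 F]] := deriv01_mean_value (X0 i.+1) (XSlt i.+1) (X1 i.+2 i2n) uu1.
    have -> : u (X i.+2) - 2 * u (X i.+1) + u (X i) = (u1 d - u1 c) / N%:R.
      by move: E F; rewrite !XS; lra.
    have X2 : X i.+2 - X i = 2 / N%:R by rewrite /X -!natr1; field; rewrite gt_eqF.
    have cd : c < d by exact: lt_trans d0.
    have c00 : 0 <= c by exact: le_trans (X0 i) (ltW c0).
    have d11 : d <= 1 by exact: le_trans (ltW d1) (X1 _ i2n).
    have H := uG c00 (ltW cd) d11.
    have g1 := G_le (X0 i) (ltW c0) (le_trans (ltW cd) d11).
    have g2 := G_le (le_trans c00 (ltW cd)) (ltW d1) (X1 _ i2n).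
    have g3 := G_le c00 (ltW cd) d11.
    have K : (u1 d - u1 c) ^+ 2 <= 2 / N%:R * (G (X i.+2) - G (X i)).
      apply: le_trans H _; apply: ler_pM; rewrite ?subr_ge0//; [exact: ltW| |].
        by rewrite -X2; lra.
      lra.
    have nN2 : n%:R ^+ 2 <= N%:R ^+ 2 :> R by rewrite lerXn2r ?nnegrE// ler_nat.
    apply: (@le_trans _ _ (N%:R ^+ 2 * (u1 d - u1 c) ^+ 2)).
      have -> : (n%:R ^+ 2 * ((u1 d - u1 c) / N%:R)) ^+ 2 =
         (n%:R ^+ 2 / N%:R) ^+ 2 * (u1 d - u1 c) ^+ 2 by ring.
      rewrite ler_wpM2r ?sqr_ge0// lerXn2r ?nnegrE ?divr_ge0//.
      by rewrite ler_pdivrMr// -expr2.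
    apply: le_trans (ler_wpM2l (sqr_ge0 _) K) _.
    rewrite le_eqVlt; apply/orP; left; apply/eqP; field; by rewrite gt_eqF.
  rewrite -mulr_sumr.
  have G01 i : (i <= n)%N -> 0 <= G (X i) <= q by move=> ni; apply: Gq; rewrite X0 X1.
  have T m : (m.+1 <= n)%N -> \sum_(0 <= i < m) (G (X i.+2) - G (X i)) =
      G (X m.+1) + G (X m) - G (X 1%N) - G (X 0%N).
    move=> _; elim: m => [|m IH]; first by rewrite big_geq//; ring.
    by rewrite big_nat_recr//= IH; ring.
  rewrite T ?prednK//.
  have /andP[a1 a2] := G01 n (leqnn n); have /andP[a3 a4] := G01 n.-1 (leq_pred n).
  have /andP[a5 a6] := G01 0%N (leq0n n); have /andP[a7 a8] := G01 1%N n0.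
  apply: (@le_trans _ _ (2 * N%:R * (2 * q))).
    by rewrite ler_pM2l ?mulr_gt0//; lra.
  have N2R : N%:R <= 2 * n%:R :> R by rewrite -natrM ler_nat.
  apply: (@le_trans _ _ (2 * (2 * n%:R) * (2 * q))).
    by rewrite ler_wpM2r ?mulr_ge0// ler_pM2l.
  have -> : 2 * (2 * n%:R) * (2 * q) = n%:R * (8 * q) by ring.
  rewrite ler_wpM2l//.
  rewrite -{1}(sqr_sqrtr q0).
  nra.
Qed.

End GridRow.

(** * Good grid lines by averaging *)

Section Shift.
Variable R : realType.
Local Notation mu := (@lebesgue_measure R).
Local Open Scope ereal_scope.

Lemma measurable_shift (c : R) (D : set R) : measurable_fun D (fun x : R => x + c)%R.
Proof. by apply: measurable_funD => //; exact: measurable_cst. Qed.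

Lemma ge0_integral_shift (f : R -> \bar R) (a b c : R) : measurable_fun setT f ->
  (forall x, 0 <= f x) ->
  \int[mu]_(x in `[a, b[) f (x + c)%R = \int[mu]_(x in `[(a + c)%R, (b + c)%R[) f x.
Proof.
move=> mf f0.
pose phi : measurableTypeR R -> measurableTypeR R := fun x => (x + c)%R.
have mphi : measurable_fun [set: measurableTypeR R] phi by exact: measurable_shift.
have H : forall A, measurable A -> mu A = pushforward mu phi A.
  apply: lebesgue_measure_unique => X [[p q] _ <-].
  transitivity (mu `](p - c)%R, (q - c)%R]); last first.
    rewrite /= /pushforward; congr (mu _).
    by apply/seteqP; split => x /=; rewrite /phi !in_itv/= => /andP[x1 x2]; apply/andP; split; lra.
  rewrite !lebesgue_measure_itv/= !lte_fin ltrD2r.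
  by case: ifP => // _; rewrite -!EFinB; congr (_%:E); ring.
transitivity (\int[pushforward mu phi]_(x in `[(a + c)%R, (b + c)%R[) f x).
  rewrite ge0_integral_pushforward//; last exact: measurable_funTS.
  congr (integral _ _ _); apply/seteqP; split => x /=; rewrite /phi !in_itv/= => /andP[x1 x2]; apply/andP; split; lra.
by apply: eq_measure_integral => A mA _; rewrite /= (H _ mA).
Qed.

(** The [N] translates of [0,1/N[ tile [0,1[, so the sum, averaged over the shift, is [N] times the
    integral of [q]. The extra 1 makes the contradiction strict when every shift is assumed bad. *)
Lemma good_shift (q : R -> \bar R) (K : R) (N : nat) : measurable_fun setT q ->
  (forall x, 0 <= q x) -> \int[mu]_(x in unit_itv R) q x <= K%:E -> (0 < N)%N ->
  exists s : R, (0 <= s <= N%:R^-1)%R /\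
    \sum_(0 <= i < N) q (s + i%:R / N%:R)%R <= (N%:R * (K + 1))%:E.
Proof.
move=> mq q0 qK N0; apply: contrapT => /forallNP H.
have NR : (0 < N%:R :> R)%R by rewrite ltr0n.
have mqs i : measurable_fun setT (fun s : R => q (s + i%:R / N%:R)%R).
  by apply: measurableT_comp => //; exact: measurable_shift.
have I_le n : (n <= N)%N ->
  \sum_(0 <= i < n) \int[mu]_(s in `[0%R, (N%:R^-1)%R[) q (s + i%:R / N%:R)%R
   = \int[mu]_(x in `[0%R, (n%:R / N%:R)%R[) q x.
  elim: n => [_|n IH nN].
    by rewrite big_geq// mul0r set_itvE integral_set0.
  rewrite big_nat_recr//= (IH (ltnW nN)).
  have := @ge0_integral_shift q 0%R (N%:R^-1)%R (n%:R / N%:R)%R mq q0.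
  rewrite add0r => ->.
  have -> : (N%:R^-1 + n%:R / N%:R = n.+1%:R / N%:R :> R)%R.
    by rewrite -natr1; field; rewrite gt_eqF.
  have n1 : (0 <= n%:R / N%:R :> R)%R by rewrite divr_ge0.
  have n2 : (n%:R / N%:R <= n.+1%:R / N%:R :> R)%R by rewrite ler_pM2r ?invr_gt0// ler_nat.
  rewrite -ge0_integral_setU//; try exact: measurable_itv.
  - congr (integral _ _ _); apply/seteqP; split => t /=; rewrite !in_itv/=.
      by case=> /andP[t1 t2]; apply/andP; split => //; lra.
    by move=> /andP[t1 t2]; have [tc|tc] := ltrP t (n%:R / N%:R); [left|right]; exact/andP.
  - exact: measurable_funTS.
  - by apply/disj_setPS => t []/=; rewrite !in_itv/= => /andP[_ t1] /andP[]; lra.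
have : (K + 1)%:E <= K%:E; last by rewrite lee_fin gerDl ler10.
have K0 : (0 <= K)%R by rewrite -lee_fin; apply: le_trans qK; exact: integral_ge0.
apply: le_trans qK.
apply: (@le_trans _ _ (\int[mu]_(x in `[0%R, (N%:R / N%:R)%R[) q x)).
  rewrite -I_le//.
  have <- := @ge0_integral_sum _ _ R mu `[0%R, (N%:R^-1)%R[%classic (measurable_itv _) nat
    (fun i s => q (s + i%:R / N%:R)%R) (fun i => measurable_funTS (mqs i)) (fun i x _ => q0 _).
  have -> : (K + 1)%:E = \int[mu]_(s in `[0%R, (N%:R^-1)%R[) (N%:R * (K + 1))%:E.
    rewrite integral_cst/=; last exact: measurable_itv.
    rewrite lebesgue_measure_itv/= lte_fin invr_gt0 NR -EFinB -EFinM.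
    by congr (_%:E); field; rewrite gt_eqF.
  have K1 : 0 <= (N%:R * (K + 1))%:E.
    by rewrite lee_fin mulr_ge0// addr_ge0.
  apply: ge0_le_integral => //; try exact: measurable_itv.
  - by apply: measurable_funTS; apply: emeasurable_sum; exact: mqs.
  - move=> s /=; rewrite in_itv/= => /andP[s0 s1]; have := H s.
    by move=> /not_andP[|/negP]; [rewrite s0 (ltW s1)|rewrite -ltNge => /ltW].
apply: ge0_subset_integral => //; try exact: measurable_itv.
  exact: measurable_funTS.
by move=> t; rewrite /unit_itv/= !in_itv/= divff ?gt_eqF// => /andP[-> /ltW ->].
Qed.

End Shift.

(** * From fine grid cells to coarse blocks *)

Section Blocks.
Variable R : realFieldType.
Implicit Types (u : nat -> nat -> R).

Definition rect u i i' j j' : R := u i' j' - u i' j - u i j' + u i j.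

Lemma sqr_sum_le (x : nat -> R) p q :
  (\sum_(p <= i < q) x i) ^+ 2 <= (q - p)%:R * \sum_(p <= i < q) x i ^+ 2.
Proof.
have [qp|/ltnW pq] := leqP q p; first by rewrite !big_geq// expr0n mulr0.
rewrite -(subnKC pq); move: (q - p)%N => k {pq}; rewrite addKn.
elim: k => [|k IH]; first by rewrite addn0 !big_geq// expr0n mulr0.
rewrite addnS !big_nat_recr ?leq_addr//= -natr1.
set S := \sum_(_ <= _ < _) _ in IH *; set T := \sum_(_ <= _ < _) _ in IH *; set y := x _.
have T0 : 0 <= T by apply: sumr_ge0 => i _; exact: sqr_ge0.
have [k0|k0] := eqVneq k 0%N.
  have S0 : S = 0 by rewrite /S k0 addn0 big_geq.
  by rewrite S0 k0; lra.
have kR : 0 < k%:R :> R by rewrite ltr0n lt0n.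
have aux (S' T' y' c : R) : 0 < c -> S' ^+ 2 <= c * T' ->
    (S' + y') ^+ 2 <= (c + 1) * (T' + y' ^+ 2).
  move=> c0 h; have : c * (2 * S' * y') <= c * (T' + c * y' ^+ 2).
    by have := sqr_ge0 (S' - c * y'); lra.
  by rewrite ler_pM2l//; lra.
exact: aux.
Qed.

Lemma rect_sum u i i' j j' : (i <= i')%N -> (j <= j')%N ->
  rect u i i' j j' = \sum_(i <= k < i') \sum_(j <= l < j') mixdiff u k l.
Proof.
move=> ii' jj'.
transitivity (\sum_(i <= k < i') ((u k.+1 j' - u k.+1 j) - (u k j' - u k j))).
  by rewrite (telescope_sumr (fun k => u k j' - u k j))// /rect; ring.
apply: eq_bigr => k _.
rewrite -(telescope_sumr (fun l => u k.+1 l))// -(telescope_sumr (fun l => u k l))//.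
by rewrite -sumrB; apply: eq_bigr => l _; rewrite /mixdiff; ring.
Qed.

Lemma sum_blocks_le (F : nat -> R) (al : nat -> nat) P n :
  (forall a, (a < P)%N -> (al a <= al a.+1)%N) -> (al P <= n)%N -> (forall i, 0 <= F i) ->
  \sum_(0 <= a < P) \sum_(al a <= i < al a.+1) F i <= \sum_(0 <= i < n) F i.
Proof.
move=> alS aln F0.
have [al0 ->] : (al 0 <= al P)%N /\
    \sum_(0 <= a < P) \sum_(al a <= i < al a.+1) F i = \sum_(al 0 <= i < al P) F i.
  elim: P alS {aln} => [|P IH] alS; first by rewrite !big_geq.
  have [h1 h2] := IH (fun a aP => alS a (ltnW aP)).
  have h3 := alS P (ltnSn P).
  by rewrite big_nat_recr//= h2 -big_cat_nat//; split => //; exact: leq_trans h3.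
rewrite (big_cat_nat (leq0n (al 0)) (leq_trans al0 aln))/=.
rewrite (big_cat_nat al0 aln)/=.
rewrite addrCA lerDl addr_ge0//; exact: sumr_ge0.
Qed.

Lemma block_variation u (al be : nat -> nat) P P' n m r r' :
  (forall a, (a < P)%N -> (al a <= al a.+1 <= al a + r)%N) -> (al P <= n)%N ->
  (forall b, (b < P')%N -> (be b <= be b.+1 <= be b + r')%N) -> (be P' <= m)%N ->
  \sum_(0 <= a < P) \sum_(0 <= b < P')
    rect u (al a) (al a.+1) (be b) (be b.+1) ^+ 2 <=
  r%:R * r'%:R * \sum_(0 <= i < n) \sum_(0 <= j < m) mixdiff u i j ^+ 2.
Proof.
move=> hal aln hbe bem.
have nrm k k' s (x : nat -> R) : (k <= k' <= k + s)%N ->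
    (\sum_(k <= i < k') x i) ^+ 2 <= s%:R * \sum_(k <= i < k') x i ^+ 2.
  move=> /andP[k1 k2]; apply: le_trans (sqr_sum_le _ _ _) _.
  rewrite ler_wpM2r ?ler_nat; [by []|by apply: sumr_ge0 => i _; exact: sqr_ge0|lia].
apply: (@le_trans _ _ (\sum_(0 <= a < P) \sum_(0 <= b < P')
   r%:R * r'%:R * \sum_(al a <= i < al a.+1) \sum_(be b <= j < be b.+1) mixdiff u i j ^+ 2)).
  apply: ler_sum_nat => a /andP[_ aP]; apply: ler_sum_nat => b /andP[_ bP].
  have /andP[a1 a2] := hal a aP; have /andP[b1 b2] := hbe b bP.
  rewrite rect_sum//; apply: le_trans (nrm _ _ _ _ (hal a aP)) _.
  rewrite -mulrA ler_wpM2l// mulr_sumr; apply: ler_sum => i _.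
  exact: nrm (hbe b bP).
under eq_bigr do rewrite -mulr_sumr.
rewrite -mulr_sumr ler_wpM2l ?mulr_ge0//.
apply: (@le_trans _ _ (\sum_(0 <= a < P) \sum_(al a <= i < al a.+1)
    \sum_(0 <= j < m) mixdiff u i j ^+ 2)).
  apply: ler_sum => a _; rewrite exchange_big/=; apply: ler_sum => i _.
  apply: sum_blocks_le => // [b bP|j]; last exact: sqr_ge0.
  by have /andP[] := hbe b bP.
apply: (@sum_blocks_le (fun i => \sum_(0 <= j < m) mixdiff u i j ^+ 2)) => // [a aP|i].
  by have /andP[] := hal a aP.
by apply: sumr_ge0 => j _; exact: sqr_ge0.
Qed.

(** The bound does not depend on the refinements [r] and [r'], so these can later tend to infinity.
    The last index of the grid is [P * r - 1], which is why coarse nodes are clamped by [minn];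
    [P * r <= 2 * n] and [P' * r' <= 2 * m] account for the factor 4. *)
Lemma grid_block_variation u P P' r r' (rho sigma : nat -> R) (K : R) :
  (0 < P)%N -> (0 < P')%N -> (1 < r)%N -> (1 < r')%N ->
  let n := (P * r).-1 in let m := (P' * r').-1 in
  (forall j, (j <= m)%N -> row_bound n (u ^~ j) (rho j)) ->
  (forall i, (i <= n)%N -> row_bound m (u i) (sigma i)) ->
  \sum_(0 <= j < m.+1) rho j ^+ 2 <= K * m%:R ->
  \sum_(0 <= i < n.+1) sigma i ^+ 2 <= K * n%:R ->
  \sum_(0 <= a < P) \sum_(0 <= b < P')
    rect u (minn (a * r) n) (minn (a.+1 * r) n) (minn (b * r') m) (minn (b.+1 * r') m) ^+ 2 <=
  4 * (108 * (4 * 200 * 160)) * K / (P%:R * P'%:R).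
Proof.
move=> P0 P'0 r1 r'1 n m hr hs hK hK'.
have Pr : (1 < P * r)%N by rewrite (leq_trans r1)// leq_pmull.
have Pr' : (1 < P' * r')%N by rewrite (leq_trans r'1)// leq_pmull.
have n0 : (0 < n)%N by rewrite /n; lia.
have m0 : (0 < m)%N by rewrite /m; lia.
have n2 : (P * r <= 2 * n)%N by rewrite /n; clear hr hs hK hK'; lia.
have m2 : (P' * r' <= 2 * m)%N by rewrite /m; clear hr hs hK hK'; lia.
have nR : 0 < n%:R :> R by rewrite ltr0n.
have mR : 0 < m%:R :> R by rewrite ltr0n.
have E := grid_mixed_estimate n0 m0 hr hs hK hK'.
apply: le_trans (@block_variation u (fun a => minn (a * r) n) (fun b => minn (b * r') m)
   P P' n m r r' _ _ _ _) _.
- move=> a aP; nia.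
- exact: geq_minr.
- move=> b bP; nia.
- exact: geq_minr.
set C : R := 108 * (4 * 200 * 160) in E *.
set S := \sum_(0 <= i < n) _.
have ES : (n%:R * m%:R) * S <= C * K.
  have -> : S = (n%:R * m%:R) ^- 2 * \sum_(0 <= i < n) \sum_(0 <= j < m) (n%:R * m%:R * mixdiff u i j) ^+ 2.
    rewrite mulr_sumr; apply: eq_bigr => i _; rewrite mulr_sumr; apply: eq_bigr => j _.
    by field; rewrite !gt_eqF.
  rewrite -(ler_pM2r (mulr_gt0 nR mR)) (le_trans _ E)// le_eqVlt; apply/orP; left; apply/eqP.
  move: (\sum_(0 <= i < n) _) => T; field; by rewrite !gt_eqF.
have S0 : 0 <= S by apply: sumr_ge0 => i _; apply: sumr_ge0 => j _; exact: sqr_ge0.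
have PR : 0 < P%:R :> R by rewrite ltr0n.
have P'R : 0 < P'%:R :> R by rewrite ltr0n.
rewrite ler_pdivlMr ?mulr_gt0//.
have h1 : P%:R * r%:R <= 2 * n%:R :> R by rewrite -!natrM ler_nat.
have h2 : P'%:R * r'%:R <= 2 * m%:R :> R by rewrite -!natrM ler_nat.
apply: (@le_trans _ _ (4 * (n%:R * m%:R * S))); last by rewrite -(mulrA 4 C K) ler_pM2l.
have -> : r%:R * r'%:R * S * (P%:R * P'%:R) = (P%:R * r%:R) * (P'%:R * r'%:R) * S by ring.
have -> : 4 * (n%:R * m%:R * S) = (2 * n%:R) * (2 * m%:R) * S by ring.
by rewrite ler_wpM2r// ler_pM// mulr_ge0.
Qed.

End Blocks.

(** * Borel measurability from differentiability in each variable *)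

Section Clip.
Variable R : realType.
Implicit Types (g : R * R -> R) (x y : R).

Definition clip x : R := Num.max 0 (Num.min x 1).

Lemma clip01 x : 0 <= clip x <= 1.
Proof. by rewrite /clip le_max lexx/= ge_max ler01 ge_min lexx orbT. Qed.

Lemma clip_id x : 0 <= x <= 1 -> clip x = x.
Proof. by move=> /andP[x0 x1]; rewrite /clip min_l// max_r. Qed.

Lemma measurable_clip : measurable_fun [set: R] clip.
Proof.
apply: measurable_maxr; first exact: measurable_cst.
by apply: measurable_minr; [exact: measurable_id|exact: measurable_cst].
Qed.

(** Composing with the retraction onto the square keeps the values there and makes measurability a
    statement about the whole plane, where sections and Fubini need no domain. *)
Definition clip2 g (p : R * R) : R := g (clip p.1, clip p.2).

Lemma unit_squareP x y : unit_square R (x, y) <-> 0 <= x <= 1 /\ 0 <= y <= 1.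
Proof. by rewrite /unit_square/= /unit_itv/= !in_itv. Qed.

Lemma clip2_square p : unit_square R (clip p.1, clip p.2).
Proof. by apply/unit_squareP; split; exact: clip01. Qed.

Lemma clip2_id g p : unit_square R p -> clip2 g p = g p.
Proof. by case: p => x y /unit_squareP[x01 y01]; rewrite /clip2/= !clip_id. Qed.

Lemma measurable_clip1 (d : measure_display) (T : measurableType d) (h : T -> R) :
  measurable_fun [set: T] h -> measurable_fun [set: T] (clip \o h).
Proof. by move=> mh; apply: measurableT_comp => //; exact: measurable_clip. Qed.

(** A function continuous in one variable and measurable in the other is jointly measurable: freeze
    the first variable at the left node of its cell and refine. *)
Lemma clip2_measurable g :
  (forall p, unit_square R p -> has_dx g p) ->
  (forall x, 0 <= x <= 1 -> measurable_fun [set: R] (fun y => g (x, clip y))) ->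
  measurable_fun [set: R * R] (clip2 g).
Proof.
move=> gx gy.
pose I (n k : nat) : set R := `[k%:R / n.+1%:R, k.+1%:R / n.+1%:R[%classic.
(* One cell more than [n.+1]: the last one holds the endpoint 1, the cells being half-open on the
   right. *)
pose h n (p : R * R) := \sum_(0 <= k < n.+2)
   \1_(I n k) (clip p.1) * g (clip (k%:R / n.+1%:R), clip p.2).
have mh n : measurable_fun setT (h n).
  apply: measurable_sum => k; apply: measurable_funM.
    apply: (measurableT_comp (f := \1_(I n k) : R -> R)).
      by apply: measurable_indic; exact: measurable_itv.
    exact: measurable_clip1 measurable_fst.
  exact: (measurableT_comp (gy _ (clip01 _)) measurable_snd).
apply: (@measurable_fun_cvg _ _ R setT h) => // -[x y] _.
have /derivable01_is_deriv/is_deriv01_lip[d d0 hd] := gx _ (clip2_square (x, y)).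
move: hd; rewrite /clip2/=; set X := clip x; set Y := clip y => hd.
have /andP[X0 X1] : 0 <= X <= 1 by exact: clip01.
apply/cvgrPdist_le => e e0.
set l := deriv01 _ _ in hd.
have L0 : 0 < `|l| + 1 by rewrite ltr_wpDl.
near=> n.
have nd : n.+1%:R^-1 < Num.min d (e / (`|l| + 1)).
  by near: n; apply: near_infty_natSinv_lt (PosNum _); rewrite lt_min d0 divr_gt0.
have nR : 0 < n.+1%:R :> R by [].
pose k := Num.truncn (X * n.+1%:R).
have /andP[k1 k2] := @truncn_itv _ (X * n.+1%:R) (mulr_ge0 X0 (ler0n _ _)).
rewrite -/k in k1 k2.
have kn : (k < n.+2)%N.
  by rewrite ltnS -(ler_nat R) (le_trans k1)// ler_piMl.
have -> : h n (x, y) = g (k%:R / n.+1%:R, Y).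
  rewrite /h/= -/X -/Y (bigD1_seq k) ?iota_uniq ?mem_index_iota//=.
  rewrite big1 ?addr0.
    rewrite indicE mem_set ?mul1r; last by rewrite /I/= in_itv/= ler_pdivrMr// ltr_pdivlMr// k1.
    congr (g (_, _)); rewrite clip_id//; apply/andP; split; first exact: divr_ge0.
    by rewrite ler_pdivrMr// mul1r ler_nat.
  move=> i ik; rewrite indicE memNset ?mul0r// /I/= in_itv/= ler_pdivrMr// ltr_pdivlMr//.
  move=> /andP[i1 i2].
  have h1 : (i <= k)%N by rewrite -ltnS -(ltr_nat R); exact: le_lt_trans i1 k2.
  have h2 : (k <= i)%N by rewrite -ltnS -(ltr_nat R); exact: le_lt_trans k1 i2.
  by move: ik; rewrite eqn_leq h1 h2.
have t01 : 0 <= (k%:R / n.+1%:R : R) <= 1.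
  by rewrite divr_ge0//= ler_pdivrMr// mul1r ler_nat.
have td : `|k%:R / n.+1%:R - X| <= n.+1%:R^-1.
  have h1 : k%:R / n.+1%:R <= X by rewrite ler_pdivrMr.
  have h2 : X <= k%:R / n.+1%:R + n.+1%:R^-1.
    by rewrite -[X in _ + X]mul1r -mulrDl ler_pdivlMr// natr1 ltW.
  by rewrite distrC ger0_norm ?subr_ge0// lerBlDl.
move: nd; rewrite lt_min => /andP[n1 n2].
have H := hd _ t01 (le_lt_trans td n1).
rewrite /clip2/= -/X -/Y distrC (le_trans H)//
 mulrC -ler_pdivlMr// (le_trans td)// ltW.
Unshelve. all: by end_near. Qed.

Lemma clip2_dx_measurable g :
  (forall p, unit_square R p -> has_dx g p) ->
  measurable_fun [set: R * R] (clip2 g) -> measurable_fun [set: R * R] (clip2 (dx g)).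
Proof.
move=> gx mg.
(* The sign of the increment: forward on the left half and backward on the right half, so that a
   step of at most [1/2] stays in [0,1] and the one-sided derivatives at the ends are covered. *)
pose s (x : R) : R := 1 - 2 * \1_(`[1 / 2, +oo[%classic : set R) x.
pose t n (x : R) : R := x + (2 * n.+1%:R)^-1 * s x.
have sE x : s x = if 1 / 2 <= x then -1 else 1.
  rewrite /s indicE; case: ifPn => h.
    by rewrite mem_set/= ?in_itv/= ?h//; ring.
  by rewrite memNset/= ?in_itv/= ?andbT; [ring|exact/negP].
have ms : measurable_fun [set: R] s.
  apply: measurable_funB; first exact: measurable_cst.
  apply: measurable_funM; first exact: measurable_cst.
  by apply: measurable_indic; exact: measurable_itv.
have mt n : measurable_fun [set: R] (t n).
  apply: measurable_funD; first exact: measurable_id.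
  by apply: measurable_funM => //; exact: measurable_cst.
have t_near n x : `|t n x - x| = (2 * n.+1%:R)^-1.
  rewrite /t addrAC subrr add0r normrM sE.
  have -> : `|if 1 / 2 <= x then -1 else 1| = 1 :> R by case: ifP => _; rewrite ?normrN normr1.
  by rewrite mulr1 ger0_norm// invr_ge0 mulr_ge0.
have t01 n x : 0 <= x <= 1 -> 0 <= t n x <= 1.
  move=> /andP[x0 x1]; rewrite /t sE.
  have : 0 <= ((2 * n.+1%:R)^-1 : R) <= 1 / 2.
    rewrite invr_ge0 mulr_ge0//= div1r lef_pV2 ?posrE ?mulr_gt0//.
    by rewrite ler_peMr// ler1n.
  move: (2 * _)^-1 => z /andP[h0 h1]; case: ifP => [xh|/negbT].
    by apply/andP; split; lra.
  by rewrite -ltNge => xh; apply/andP; split; lra.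
pose h n (p : R * R) := (clip2 g (t n (clip p.1), p.2) - clip2 g p) * (t n (clip p.1) - clip p.1)^-1.
have mc1 : measurable_fun [set: R * R] (fun p : R * R => clip p.1).
  exact: measurable_clip1 measurable_fst.
have mtc n : measurable_fun [set: R * R] (fun p : R * R => t n (clip p.1)).
  exact: measurableT_comp (mt n) mc1.
have mh n : measurable_fun setT (h n).
  have E : h n = (fun p => (clip2 g (t n (clip p.1), p.2) - clip2 g p) *
     (2 * n.+1%:R * s (clip p.1))).
    apply/funext => p; rewrite /h; congr (_ * _); rewrite /t addrAC subrr add0r.
    rewrite invfM invrK; congr (_ * _); rewrite sE; case: ifP => _; by rewrite ?invrN invr1.
  rewrite E; apply: measurable_funM.
    apply: measurable_funB => //.
    apply: (measurableT_comp mg).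
    exact: measurable_fun_pair (mtc n) measurable_snd.
  apply: measurable_funM; first exact: measurable_cst.
  exact: measurableT_comp ms mc1.
apply: (@measurable_fun_cvg _ _ R setT h) => // -[x y] _.
have /derivable01_is_deriv/= hd := gx _ (clip2_square (x, y)).
rewrite /clip2/= /dx/=; move: hd; rewrite /=; set X := clip x; set Y := clip y => hd.
have X01 : 0 <= X <= 1 by exact: clip01.
apply/cvgrPdist_le => e e0; have [d d0 {}hd] := hd e e0.
near=> n.
have nd : n.+1%:R^-1 < d by near: n; apply: near_infty_natSinv_lt (PosNum d0).
have tn : `|t n X - X| < d.
  rewrite t_near (le_lt_trans _ nd)// lef_pV2 ?posrE ?mulr_gt0//.
  by rewrite ler_peMl// ler1n.
have := hd _ (t01 n _ X01) tn.
have p0 : 0 < `|t n X - X| by rewrite t_near invr_gt0 mulr_gt0.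
have p1 : t n X - X != 0 by rewrite -normr_gt0.
rewrite /h /clip2/= -/X -/Y (clip_id (t01 n _ X01)).
rewrite -ler_pdivrMr// -normfV -normrM distrC => H.
rewrite (le_trans _ H)// le_eqVlt; apply/orP; left; apply/eqP.
by congr (`|_|); field.
Unshelve. all: by end_near. Qed.

End Clip.

(** * The product measure, its sections and its completion *)

Section PlaneMeasure.
Variable R : realType.
Local Notation mu := (@lebesgue_measure R).
Local Notation mu2 := (borel_leb2 R).
Local Notation T2 := (measurableTypeR R * measurableTypeR R)%type.
Local Open Scope ereal_scope.
Implicit Types (G : T2 -> \bar R) (A B : set R).

Lemma measurable_section_integral1 G B : measurable B -> measurable_fun setT G ->
  (forall p, 0 <= G p) ->
  measurable_fun [set: R] (fun x => \int[mu]_(y in B) G (x, y)).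
Proof.
move=> mB mG G0.
have mGB : measurable_fun setT (G \_ ([set: R] `*` B)).
  apply/(measurable_restrictT _ (measurableX measurableT mB)).
  exact: measurable_funTS.
have GB0 p : 0 <= (G \_ ([set: R] `*` B)) p by rewrite patchE; case: ifP.
rewrite (_ : (fun x => _) = fubini_F mu (G \_ ([set: R] `*` B))).
  exact: measurable_fun_fubini_tonelli_F.
apply/funext => x; rewrite /fubini_F [LHS]integral_mkcond.
apply: eq_integral => y _; rewrite !patchE.
have [yB|yB] := boolP (y \in B).
  by rewrite mem_set//; split => //=; exact: set_mem.
by rewrite memNset// => -[_ /= /mem_set]; rewrite (negbTE yB).
Qed.

Lemma fubini_rect1 G A B : measurable A -> measurable B -> measurable_fun setT G ->
  (forall p, 0 <= G p) ->
  \int[mu2]_(p in A `*` B) G p = \int[mu]_(x in A) \int[mu]_(y in B) G (x, y).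
Proof.
move=> mA mB mG G0.
have mGB : measurable_fun setT (G \_ (A `*` B)).
  apply/(measurable_restrictT _ (measurableX mA mB)).
  exact: measurable_funTS.
have GB0 p : 0 <= (G \_ (A `*` B)) p by rewrite patchE; case: ifP.
rewrite [LHS]integral_mkcond [RHS]integral_mkcond.
transitivity (\int[mu]_x fubini_F mu (G \_ (A `*` B)) x); first exact: fubini_tonelli1.
apply: eq_integral => x _; rewrite patchE /fubini_F; case: ifPn => xA.
  rewrite [RHS]integral_mkcond.
  apply: eq_integral => y _; rewrite !patchE; have [yB|yB] := boolP (y \in B).
    by rewrite mem_set//; split => /=; exact: set_mem.
  by rewrite memNset// => -[_ /= /mem_set]; rewrite (negbTE yB).
rewrite integral0_eq// => y _; rewrite patchE memNset// => -[/= /mem_set].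
by rewrite (negbTE xA).
Qed.

Lemma fubini_rect2 G A B : measurable A -> measurable B -> measurable_fun setT G ->
  (forall p, 0 <= G p) ->
  \int[mu2]_(p in A `*` B) G p = \int[mu]_(y in B) \int[mu]_(x in A) G (x, y).
Proof.
move=> mA mB mG G0.
have mGB : measurable_fun setT (G \_ (A `*` B)).
  apply/(measurable_restrictT _ (measurableX mA mB)).
  exact: measurable_funTS.
have GB0 p : 0 <= (G \_ (A `*` B)) p by rewrite patchE; case: ifP.
rewrite [LHS]integral_mkcond [RHS]integral_mkcond.
transitivity (\int[mu]_y fubini_G mu (G \_ (A `*` B)) y); first exact: fubini_tonelli2.
apply: eq_integral => y _; rewrite patchE /fubini_G; case: ifPn => yB.
  rewrite [RHS]integral_mkcond.
  apply: eq_integral => x _; rewrite !patchE; have [xA|xA] := boolP (x \in A).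
    by rewrite mem_set//; split => /=; exact: set_mem.
  by rewrite memNset// => -[/= /mem_set]; rewrite (negbTE xA).
rewrite integral0_eq// => x _; rewrite patchE memNset// => -[_ /= /mem_set].
by rewrite (negbTE yB).
Qed.

Lemma measurable_section_integral2 G A : measurable A -> measurable_fun setT G ->
  (forall p, 0 <= G p) ->
  measurable_fun [set: R] (fun y => \int[mu]_(x in A) G (x, y)).
Proof.
move=> mA mG G0.
apply: (measurable_section_integral1 (G := fun p => G (p.2, p.1))) => //.
exact: (measurableT_comp mG (measurable_fun_pair measurable_snd measurable_fst)).
Qed.

Lemma measurable_unit_itv : measurable (unit_itv R).
Proof. exact: measurable_itv. Qed.

Lemma measurable_unit_square : (measurable : set (set T2)) (unit_square R).
Proof. by apply: measurableX; exact: measurable_unit_itv. Qed.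

Local Notation T2c := (caratheodory_type (mu2^*)%mu).

Lemma leb2_measurable (A : set T2) : measurable A -> measurable (A : set T2c).
Proof. by move=> mA; apply: sub_caratheodory; apply: sub_sigma_algebra. Qed.

Lemma leb2E (A : set T2) : measurable A -> leb2 R A = mu2 A.
Proof. by move=> mA; exact: (@measurable_mu_extE _ _ _ mu2 A mA). Qed.

Lemma leb2_measurable_fun d (Y : measurableType d) (D : set T2) (G : T2 -> Y) : measurable D ->
  measurable_fun D G -> measurable_fun (D : set T2c) (G : T2c -> Y).
Proof. by move=> mD mG _ X mX; apply: leb2_measurable; exact: mG. Qed.

(** A change of variables along the identity from the completed space to the Borel space, under
    which the completed measure pushes forward to the product measure. *)
Lemma leb2_integral G (D : set T2) : measurable D -> measurable_fun setT G ->
  (forall p, 0 <= G p) -> \int[leb2 R]_(p in D) G p = \int[mu2]_(p in D) G p.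
Proof.
move=> mD mG G0.
pose phi : T2c -> T2 := id.
have mphi : measurable_fun [set: T2c] phi.
  by apply: (leb2_measurable_fun (G := id)) => //; exact: measurable_id.
transitivity (\int[pushforward (leb2 R) phi]_(p in D) G p).
  by rewrite ge0_integral_pushforward//; exact: measurable_funTS.
apply: eq_measure_integral => A mA _.
exact: leb2E.
Qed.

Lemma leb2_negligible (N : set T2) : mu2.-negligible N -> (leb2 R).-negligible N.
Proof.
move=> [A [mA A0 NA]]; exists A; split => //; first exact: leb2_measurable.
by rewrite -A0; exact: leb2E.
Qed.

Lemma leb2_complete : measure_is_complete (leb2 R).
Proof. exact: measure_is_complete_caratheodory. Qed.

End PlaneMeasure.

(** * Rows of good heights, and passage to exact partitions *)

Section RowFamily.
Variable R : realType.
Local Notation mu := (@lebesgue_measure R).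
Local Notation mu2 := (borel_leb2 R).
Implicit Types (f g : R * R -> R).

Lemma deriv01_bounded (g g' : R -> R) : (forall x : R, 0 <= x <= 1 -> is_deriv01 g x (g' x)) ->
  exists2 B : R, 0 <= B & forall x : R, 0 <= x <= 1 -> `|g x| <= B.
Proof.
move=> gg'; have cg := deriv01_continuous gg'.
have cn : {within `[0 : R, 1], continuous (fun x => `|g x|)}.
  by move=> x; apply: continuous_comp; [exact: cg|exact: norm_continuous].
have [c _ hc] := EVT_max ler01 cn.
by exists `|g c| => // x x01; apply: hc; rewrite in_itv.
Qed.

Lemma clip2_section_measurable g y : measurable_fun [set: R * R] (clip2 g) -> 0 <= y <= 1 ->
  measurable_fun (unit_itv R) (fun x => g (x, y)).
Proof.
move=> mg y01; apply: (eq_measurable_fun (fun x => clip2 g (x, y))).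
  by move=> x /set_mem; rewrite /unit_itv/= in_itv/= => x01; rewrite clip2_id//; exact/unit_squareP.
apply: measurable_funTS; apply: (measurableT_comp mg).
exact: measurable_fun_pair (@measurable_id _ _ _) (@measurable_cst _ _ _ _ _ y).
Qed.

(** The shift [t] and the bounds [rho] are fixed before the positions [s], [n], [N] of the samples
    along the rows. Hence heights and abscissae can be chosen independently, without circularity. *)
Lemma row_family f (K B : R) :
  (forall p, unit_square R p -> has_dx f p) ->
  (forall p, unit_square R p -> has_dx (dx f) p) ->
  measurable_fun [set: R * R] (clip2 (dx (dx f))) ->
  (\int[mu2]_(p in unit_square R) (clip2 (dx (dx f)) p ^+ 2)%:E <= K%:E)%E ->
  0 <= K -> 0 <= B ->
  (forall y, 0 <= y <= 1 -> `|f (0, y)| <= B /\ `|f (1, y)| <= B) ->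
  forall M, (1 < M)%N -> exists t : R, 0 <= t <= M%:R^-1 /\ exists rho : nat -> R,
    \sum_(0 <= j < M) rho j ^+ 2 <= 36 * (B ^+ 2 + K + 1) * M.-1%:R /\
    forall (s : R) n N, 0 <= s -> (0 < n)%N -> (n <= N)%N -> (N <= 2 * n)%N ->
      s + n%:R / N%:R <= 1 -> forall j, (j < M)%N ->
      row_bound n (fun i => f (s + i%:R / N%:R, t + j%:R / M%:R)) (rho j).
Proof.
move=> fx fxx mfxx IK K0 B0 fB M M1.
have M2 : (M <= 2 * M.-1)%N by clear -M1; lia.
have M0 : (0 < M)%N by exact: ltnW.
have MR : 0 < M%:R :> R by rewrite ltr0n.
pose F (p : R * R) := (clip2 (dx (dx f)) p ^+ 2)%:E.
have mF : measurable_fun setT F by apply/measurable_EFinP; exact: measurable_funX.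
have F0 p : (0 <= F p)%E by rewrite lee_fin sqr_ge0.
pose q (y : R) := (\int[mu]_(x in unit_itv R) F (x, y))%E.
have q0 y : (0 <= q y)%E by exact: integral_ge0.
have mq : measurable_fun setT q.
  by apply: measurable_section_integral2 => //; exact: measurable_unit_itv.
have Iq : (\int[mu]_(y in unit_itv R) q y <= K%:E)%E.
  by rewrite -fubini_rect2//; exact: measurable_unit_itv.
have [t [t01 tq]] := good_shift mq q0 Iq M0.
exists t; split => //.
have /andP[t0 t1] := t01.
have y01 j : (j < M)%N -> 0 <= t + j%:R / M%:R <= 1.
  move=> jM; rewrite addr_ge0 ?divr_ge0//=.
  apply: (@le_trans _ _ (M%:R^-1 + j%:R / M%:R)); first by rewrite lerD2r.
  by rewrite -[X in X + _]mul1r -mulrDl ler_pdivrMr// mul1r nat1r ler_nat.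
have qfin j : (j < M)%N -> q (t + j%:R / M%:R) \is a fin_num.
  move=> jM; rewrite ge0_fin_numE//; apply: le_lt_trans (ltry (M%:R * (K + 1))).
  apply: le_trans tq; rewrite big_mkord (bigD1 (Ordinal jM))//= leeDl//.
  exact: sume_ge0.
pose c j := fine (q (t + j%:R / M%:R)).
have c0 j : 0 <= c j by exact: fine_ge0.
have cq j : (j < M)%N -> q (t + j%:R / M%:R) = (c j)%:E by move=> jM; rewrite /c fineK// qfin.
have csum : \sum_(0 <= j < M) c j <= M%:R * (K + 1).
  rewrite -lee_fin -sumEFin; apply: le_trans tq.
  by rewrite le_eqVlt; apply/orP; left; apply/eqP; apply: eq_big_nat => j /andP[_ jM]; rewrite cq.
(* The square is at most [18 * B ^+ 2 + 18 * c j]; passing from [M] rows to [M.-1] steps doubles 18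
   to 36. *)
exists (fun j => 3 * B + 3 * Num.sqrt (c j)); split.
  apply: (@le_trans _ _ (\sum_(0 <= j < M) (18 * B ^+ 2 + 18 * c j))).
    apply: ler_sum => j _; have := sqr_ge0 (3 * B - 3 * Num.sqrt (c j)).
    by have := sqr_sqrtr (c0 j); lra.
  rewrite big_split/= sumr_const_nat subn0 -mulr_sumr -[X in X + _]mulr_natr.
  have hM : M%:R <= 2 * M.-1%:R :> R by rewrite -natrM ler_nat.
  have BB : 0 <= B ^+ 2 by exact: sqr_ge0.
  apply: (@le_trans _ _ (18 * (B ^+ 2 + K + 1) * M%:R)); first lra.
  have := ler_wpM2l (_ : 0 <= 18 * (B ^+ 2 + K + 1)) hM; rewrite mulr_ge0//; last lra.
  by move=> /(_ isT); lra.
move=> s n N s0 n0 nN N2 sn j jM.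
have h01 := y01 j jM.
have mw : measurable_fun (unit_itv R) (fun x => dx (dx f) (x, t + j%:R / M%:R)).
  exact: clip2_section_measurable.
have sq x : 0 <= x <= 1 -> unit_square R (x, t + j%:R / M%:R).
  by move=> x01; exact/unit_squareP.
have [||G [Gc uG]] := @increment_sq_majorant R (fun x => dx f (x, t + j%:R / M%:R)) _ (c j) _ mw.
- by move=> x x01; exact: (derivable01_is_deriv (fxx _ (sq x x01))).
- have <- := cq j jM; rewrite le_eqVlt; apply/orP; left; apply/eqP.
  apply: eq_integral => x /set_mem; rewrite /unit_itv/= in_itv/= => x01.
  by rewrite /F clip2_id//; exact: sq.
have [fB0 fB1] := fB _ h01.
apply: (@grid_row_bound R (fun x => f (x, t + j%:R / M%:R)) (fun x => dx f (x, t + j%:R / M%:R)) G) => //.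
by move=> x x01; exact: (derivable01_is_deriv (fx _ (sq x x01))).
Qed.

End RowFamily.

Section Variation.
Variable R : realType.
Local Notation mu2 := (borel_leb2 R).
Implicit Types (f g : R * R -> R).

Definition transpose f (p : R * R) : R := f (p.2, p.1).

Definition rect_incr f (x x' y y' : R) : R := f (x', y') - f (x', y) - f (x, y') + f (x, y).

Lemma unit_square_swap (p : R * R) : unit_square R p -> unit_square R (p.2, p.1).
Proof. by case: p => x y [? ?]; split. Qed.

Lemma clip2_transpose_measurable g : measurable_fun [set: R * R] (clip2 g) ->
  measurable_fun [set: R * R] (clip2 (transpose g)).
Proof.
by move=> mg; exact: (measurableT_comp mg (measurable_fun_pair measurable_snd measurable_fst)).
Qed.

Lemma integral_square_transpose (G : R * R -> \bar R) : measurable_fun [set: R * R] G ->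
  (forall p, (0 <= G p)%E) ->
  (\int[mu2]_(p in unit_square R) G (p.2, p.1) = \int[mu2]_(p in unit_square R) G p)%E.
Proof.
move=> mG G0; rewrite (@fubini_rect2 R G)//; try exact: measurable_unit_itv.
rewrite (@fubini_rect1 R (fun p => G (p.2, p.1)))//; try exact: measurable_unit_itv.
exact: (measurableT_comp mG (measurable_fun_pair measurable_snd measurable_fst)).
Qed.

Lemma square_integrable_bound g : square_integrable (leb2 R) (unit_square R) g ->
  measurable_fun [set: R * R] (clip2 g) ->
  exists2 K : R, 0 <= K &
    (\int[mu2]_(p in unit_square R) (clip2 g p ^+ 2)%:E <= K%:E)%E.
Proof.
move=> [_ /integrableP[_ gfin]] mg.
have mG : measurable_fun [set: R * R] (fun p => (clip2 g p ^+ 2)%:E).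
  by apply/measurable_EFinP; exact: measurable_funX.
have G0 p : (0 <= (clip2 g p ^+ 2)%:E)%E by rewrite lee_fin sqr_ge0.
have E : (\int[mu2]_(p in unit_square R) (clip2 g p ^+ 2)%:E =
   \int[leb2 R]_(p in unit_square R) `|(g p ^+ 2)%:E|)%E.
  rewrite -leb2_integral//; last exact: measurable_unit_square.
  by apply: eq_integral => p /set_mem sp; rewrite clip2_id// gee0_abs// lee_fin sqr_ge0.
have I0 : (0 <= \int[mu2]_(p in unit_square R) (clip2 g p ^+ 2)%:E)%E by exact: integral_ge0.
exists (fine (\int[mu2]_(p in unit_square R) (clip2 g p ^+ 2)%:E)%E); first exact: fine_ge0.
by rewrite fineK// ge0_fin_numE// E.
Qed.

Lemma clip2_separately_derivable_measurable f :
  (forall p, unit_square R p -> has_dx f p) -> (forall p, unit_square R p -> has_dy f p) ->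
  measurable_fun [set: R * R] (clip2 f).
Proof.
move=> fx fy; apply: clip2_measurable => // x x01.
(* Measurability of one section is read off the two-variable lemma, applied to a function constant
   in its second argument. *)
have h : measurable_fun [set: R * R] (clip2 (fun p : R * R => f (x, p.1))).
  apply: clip2_measurable => [[y z] /unit_squareP[y01 _]|y _].
    by apply: (fy (x, y)); exact/unit_squareP.
  exact: (@measurable_cst _ _ _ _ _ (f (x, y))).
have mp : measurable_fun [set: R] (fun y : R => (y, 0 : R)).
  exact: measurable_fun_pair (@measurable_id _ _ _) (@measurable_cst _ _ _ _ _ (0 : R)).
exact: (measurableT_comp h mp).
Qed.

Lemma boundary_bound f :
  (forall p, unit_square R p -> has_dy f p) ->
  exists2 B : R, 0 <= B & forall y : R, 0 <= y <= 1 -> `|f (0, y)| <= B /\ `|f (1, y)| <= B.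
Proof.
move=> fy.
have H x : 0 <= x <= 1 -> exists2 B : R, 0 <= B & forall y : R, 0 <= y <= 1 -> `|f (x, y)| <= B.
  move=> x01; apply: (deriv01_bounded (g' := fun y => dy f (x, y))) => y y01.
  by apply: (derivable01_is_deriv (fy (x, y) _)); exact/unit_squareP.
have [B0 B00 hB0] := H 0 ltac:(by rewrite lexx ler01).
have [B1 B10 hB1] := H 1 ltac:(by rewrite lexx ler01).
exists (B0 + B1); first exact: addr_ge0.
move=> y y01; split.
  by rewrite (le_trans (hB0 y y01))// lerDl.
by rewrite (le_trans (hB1 y y01))// lerDr.
Qed.

(** The point of the shifted fine grid that stands for [a/P]. The shift moves it up and the clamp at
    the last index moves it down, each by at most one fine mesh. *)
Definition node (s : R) P r a : R := s + (minn (a * r) (P * r).-1)%:R / (P * r)%:R.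

Lemma node_near s P r a : (0 < P)%N -> (0 < r)%N -> 0 <= s <= (P * r)%:R^-1 -> (a <= P)%N ->
  0 <= node s P r a <= 1 /\ `|node s P r a - a%:R / P%:R| <= r%:R^-1.
Proof.
move=> P0 r0 /andP[s0 s1] aP.
have Pr : (0 < P * r)%N by rewrite muln_gt0 P0.
have PrR : 0 < (P * r)%:R :> R by rewrite ltr0n.
have PR : 0 < P%:R :> R by rewrite ltr0n.
have rR : 0 < r%:R :> R by rewrite ltr0n.
have leN : (P * r)%:R^-1 <= r%:R^-1 :> R by rewrite lef_pV2 ?posrE// ler_nat leq_pmull.
have aE : a%:R / P%:R = (a * r)%:R / (P * r)%:R :> R.
  by rewrite !natrM; field; rewrite !gt_eqF.
have m1 : (minn (a * r) (P * r).-1)%:R <= (a * r)%:R :> R by rewrite ler_nat geq_minl.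
have m2 : (a * r)%:R <= (minn (a * r) (P * r).-1)%:R + 1 :> R.
  rewrite natr1 ler_nat; have := leq_mul aP (leqnn r); move: (a * r)%N (P * r)%N Pr; clear; lia.
have m3 : (minn (a * r) (P * r).-1)%:R + 1 <= (P * r)%:R :> R.
  by rewrite natr1 ler_nat; move: (a * r)%N (P * r)%N Pr; clear; lia.
rewrite /node aE; set m : R := (minn _ _)%:R in m1 m2 m3 *.
move: m1 m2 m3; set A : R := (a * r)%:R; set N : R := (P * r)%:R in s1 PrR leN *.
move=> m1 m2 m3.
have m0 : 0 <= m by exact: ler0n.
have d0 : 0 <= m / N by rewrite divr_ge0// ltW.
have d1 : m / N + N^-1 <= 1.
  by rewrite -[X in _ + X]mul1r -mulrDl ler_pdivrMr// mul1r.
have d2 : m / N <= A / N by rewrite ler_pM2r// invr_gt0.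
have d3 : A / N <= m / N + N^-1.
  by rewrite -[X in _ + X]mul1r -mulrDl ler_pM2r// invr_gt0.
clearbody m A N; split; first by apply/andP; split; lra.
by rewrite ler_norml; apply/andP; split; lra.
Qed.

Lemma is_deriv01_seq_cvg (g : R -> R) (x l : R) (X : nat -> R) : is_deriv01 g x l ->
  (forall k, 0 <= X k <= 1) -> (forall k, `|X k - x| <= k.+1%:R^-1) ->
  g (X k) @[k --> \oo] --> g x.
Proof.
move=> /is_deriv01_lip[d d0 hd] X01 Xx; apply/cvgrPdist_le => e e0.
have L0 : 0 < `|l| + 1 by rewrite ltr_wpDl.
near=> n.
have : n.+1%:R^-1 < Num.min d (e / (`|l| + 1)).
  by near: n; apply: near_infty_natSinv_lt (PosNum _); rewrite lt_min d0 divr_gt0.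
rewrite lt_min => /andP[n1 n2]; rewrite distrC.
rewrite (le_trans (hd _ (X01 n) (le_lt_trans (Xx n) n1)))//.
by rewrite mulrC -ler_pdivlMr// (le_trans (Xx n))// ltW.
Unshelve. all: by end_near. Qed.

(** Only the first coordinates move: continuity in one variable at a time is all that is known of
    [f] here. *)
Lemma rect_sum_limit f P P' (X : nat -> nat -> R) (x Y : nat -> R) (C : R) :
  (forall a b, (a <= P)%N -> (b <= P')%N -> f (X k a, Y b) @[k --> \oo] --> f (x a, Y b)) ->
  (forall k, \sum_(0 <= a < P) \sum_(0 <= b < P')
      rect_incr f (X k a) (X k a.+1) (Y b) (Y b.+1) ^+ 2 <= C) ->
  \sum_(0 <= a < P) \sum_(0 <= b < P')
      rect_incr f (x a) (x a.+1) (Y b) (Y b.+1) ^+ 2 <= C.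
Proof.
move=> Xx hC.
have : (\sum_(0 <= a < P) \sum_(0 <= b < P')
      rect_incr f (X k a) (X k a.+1) (Y b) (Y b.+1) ^+ 2) @[k --> \oo] -->
   \sum_(0 <= a < P) \sum_(0 <= b < P')
      rect_incr f (x a) (x a.+1) (Y b) (Y b.+1) ^+ 2.
  under eq_fun do rewrite big_mkord; rewrite big_mkord.
  apply: cvg_big => [|a _]; first exact: add_continuous.
  under eq_fun do rewrite big_mkord; rewrite big_mkord.
  apply: cvg_big => [|b _]; first exact: add_continuous.
  have h : rect_incr f (X k a) (X k a.+1) (Y b) (Y b.+1) @[k --> \oo] -->
      rect_incr f (x a) (x a.+1) (Y b) (Y b.+1).
    have aP := ltn_ord a; have bP := ltn_ord b.
    by apply: cvgD; [apply: cvgB; [apply: cvgB|]|]; apply: Xx => //; exact: ltnW.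
  rewrite expr2; under eq_fun do rewrite expr2.
  exact: cvgM.
move=> /cvgr_to_le; apply; exact: nearW.
Qed.

Theorem variation_bound f :
  (forall p, unit_square R p -> has_dx f p) ->
  (forall p, unit_square R p -> has_dx (dx f) p) ->
  (forall p, unit_square R p -> has_dy f p) ->
  (forall p, unit_square R p -> has_dy (dy f) p) ->
  square_integrable (leb2 R) (unit_square R) (dx (dx f)) ->
  square_integrable (leb2 R) (unit_square R) (dy (dy f)) ->
  exists2 C : R, 0 <= C & forall P P', (0 < P)%N -> (0 < P')%N ->
    \sum_(0 <= a < P) \sum_(0 <= b < P')
      rect_incr f (a%:R / P%:R) (a.+1%:R / P%:R) (b%:R / P'%:R) (b.+1%:R / P'%:R) ^+ 2
    <= C / (P%:R * P'%:R).
Proof.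
move=> fx fxx fy fyy sx sy.
pose f' := transpose f.
have mf := clip2_separately_derivable_measurable fx fy.
have fx' p : unit_square R p -> has_dx f' p by move=> /unit_square_swap/fy.
have fy' p : unit_square R p -> has_dy f' p by move=> /unit_square_swap/fx.
have fxx' p : unit_square R p -> has_dx (dx f') p by move=> /unit_square_swap/fyy.
have mxx := clip2_dx_measurable fxx (clip2_dx_measurable fx mf).
have mxx' := clip2_dx_measurable fxx' (clip2_dx_measurable fx' (clip2_transpose_measurable mf)).
have myy : measurable_fun [set: R * R] (clip2 (dy (dy f))).
  exact: (clip2_transpose_measurable mxx').
have [K1 K10 IK1] := square_integrable_bound sx mxx.
have [K2 K20 IK2] := square_integrable_bound sy myy.
have IK2' : (\int[mu2]_(p in unit_square R) (clip2 (dx (dx f')) p ^+ 2)%:E <= K2%:E)%E.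
  apply: le_trans IK2.
  rewrite -(@integral_square_transpose (fun p => (clip2 (dy (dy f)) p ^+ 2)%:E))//.
    by apply/measurable_EFinP; exact: measurable_funX.
  by move=> p; rewrite lee_fin sqr_ge0.
have [B1 B10 fB1] := boundary_bound fy.
have [B2 B20 fB2] := boundary_bound fy'.
pose K := 36 * (B1 ^+ 2 + K1 + 1) + 36 * (B2 ^+ 2 + K2 + 1).
have k1 : 0 <= 36 * (B1 ^+ 2 + K1 + 1) by have := sqr_ge0 B1; lra.
have k2 : 0 <= 36 * (B2 ^+ 2 + K2 + 1) by have := sqr_ge0 B2; lra.
have K0 : 0 <= K by exact: addr_ge0.
have rowf := row_family fx fxx mxx IK1 K10 B10 fB1.
have rowf' := row_family fx' fxx' mxx' IK2' K20 B20 fB2.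
(* [S] shifts the columns and depends on [P * r] only, [T] shifts the rows and depends on [P' * r']
   only. One refinement can therefore tend to infinity while the other set of nodes stays fixed. *)
have /choice[S hS] N : exists s : R, (1 < N)%N -> 0 <= s <= N%:R^-1 /\ exists rho : nat -> R,
    \sum_(0 <= j < N) rho j ^+ 2 <= 36 * (B2 ^+ 2 + K2 + 1) * N.-1%:R /\
    forall (t : R) n M, 0 <= t -> (0 < n)%N -> (n <= M)%N -> (M <= 2 * n)%N ->
      t + n%:R / M%:R <= 1 -> forall j, (j < N)%N ->
      row_bound n (fun i => f' (t + i%:R / M%:R, s + j%:R / N%:R)) (rho j).
  by have [/rowf'[s hs]|_] := ltnP 1 N; [exists s|exists 0].
have /choice[T hT] M : exists t : R, (1 < M)%N -> 0 <= t <= M%:R^-1 /\ exists rho : nat -> R,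
    \sum_(0 <= j < M) rho j ^+ 2 <= 36 * (B1 ^+ 2 + K1 + 1) * M.-1%:R /\
    forall (s : R) n N, 0 <= s -> (0 < n)%N -> (n <= N)%N -> (N <= 2 * n)%N ->
      s + n%:R / N%:R <= 1 -> forall j, (j < M)%N ->
      row_bound n (fun i => f (s + i%:R / N%:R, t + j%:R / M%:R)) (rho j).
  by have [/rowf[s hs]|_] := ltnP 1 M; [exists s|exists 0].
pose C := 4 * (108 * (4 * 200 * 160)) * K.
have C0 : 0 <= C.
  exact: mulr_ge0 (mulr_ge0 (ler0n R 4) (mulr_ge0 (ler0n R 108)
    (mulr_ge0 (mulr_ge0 (ler0n R 4) (ler0n R 200)) (ler0n R 160)))) K0.
exists C => // P P' P0 P'0.
have PR : (0 < P%:R :> R) by rewrite ltr0n.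
have P'R : (0 < P'%:R :> R) by rewrite ltr0n.
have fin r r' : (1 < r)%N -> (1 < r')%N ->
   \sum_(0 <= a < P) \sum_(0 <= b < P')
      rect_incr f (node (S (P * r)%N) P r a) (node (S (P * r)%N) P r a.+1)
        (node (T (P' * r')%N) P' r' b) (node (T (P' * r')%N) P' r' b.+1) ^+ 2
    <= C / (P%:R * P'%:R).
  move=> r1 r'1.
  set N := (P * r)%N; set M := (P' * r')%N.
  have N1 : (1 < N)%N by rewrite /N (leq_trans r1)// leq_pmull.
  have M1 : (1 < M)%N by rewrite /M (leq_trans r'1)// leq_pmull.
  have [/andP[s0 s1] [sigma [sK hs]]] := hS N N1.
  have [/andP[t0 t1] [rho [tK ht]]] := hT M M1.
  have sN : S N + N.-1%:R / N%:R <= 1.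
    have NR : 0 < N%:R :> R by rewrite ltr0n ltnW.
    have E : N%:R = N.-1%:R + 1 :> R by rewrite natr1 prednK// ltnW.
    apply: (@le_trans _ _ (N%:R^-1 + N.-1%:R / N%:R)); first by rewrite lerD2r.
    by rewrite -[X in X + _]mul1r -mulrDl ler_pdivrMr// mul1r E addrC.
  have tM : T M + M.-1%:R / M%:R <= 1.
    have MR : 0 < M%:R :> R by rewrite ltr0n ltnW.
    have E : M%:R = M.-1%:R + 1 :> R by rewrite natr1 prednK// ltnW.
    apply: (@le_trans _ _ (M%:R^-1 + M.-1%:R / M%:R)); first by rewrite lerD2r.
    by rewrite -[X in X + _]mul1r -mulrDl ler_pdivrMr// mul1r E addrC.
  have n0 : (0 < N.-1)%N by rewrite -ltnS prednK// ltnW.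
  have m0 : (0 < M.-1)%N by rewrite -ltnS prednK// ltnW.
  have n2 : (N <= 2 * N.-1)%N by rewrite mul2n -addnn -{1}(prednK (ltnW N1)) -addn1 leq_add2l.
  have m2 : (M <= 2 * M.-1)%N by rewrite mul2n -addnn -{1}(prednK (ltnW M1)) -addn1 leq_add2l.
  apply: (@grid_block_variation R (fun i j => f (S N + i%:R / N%:R, T M + j%:R / M%:R))
     P P' r r' rho sigma K) => //.
  - move=> j jm; apply: ht => //; first exact: leq_pred.
    by rewrite -(prednK (ltnW M1)) ltnS.
  - move=> i im; apply: hs => //; first exact: leq_pred.
    by rewrite -(prednK (ltnW N1)) ltnS.
  - rewrite prednK ?(ltnW M1)// (le_trans tK)// ler_wpM2r//.
    by rewrite lerDl.
  - rewrite prednK ?(ltnW N1)// (le_trans sK)// ler_wpM2r//.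
    by rewrite lerDr.
have Pr1 Q k : (0 < Q)%N -> (1 < Q * k.+2)%N by move=> Q0; rewrite (leq_trans (ltn0Sn _ : (1 < k.+2)%N))// leq_pmull.
have lek k : k.+2%:R^-1 <= k.+1%:R^-1 :> R by rewrite lef_pV2 ?posrE// ler_nat.
have q01 Q a : (0 < Q)%N -> (a <= Q)%N -> 0 <= (a%:R / Q%:R : R) <= 1.
  move=> Q0 aQ; rewrite divr_ge0//= ler_pdivrMr ?ltr0n// mul1r ler_nat//.
have nodeS Q k a (Q0 : (0 < Q)%N) := @node_near (S (Q * k.+2)%N) Q k.+2 a Q0 (ltn0Sn _)
  (proj1 (hS _ (Pr1 Q k Q0))).
have nodeT Q k a (Q0 : (0 < Q)%N) := @node_near (T (Q * k.+2)%N) Q k.+2 a Q0 (ltn0Sn _)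
  (proj1 (hT _ (Pr1 Q k Q0))).
(* First limit: abscissae become exact with the heights still shifted. The second limit is the same
   argument for the transposed function. The refinement is [k.+2] because the grid bound requires
   more than one cell per block. *)
have lim1 k' : \sum_(0 <= a < P) \sum_(0 <= b < P')
      rect_incr f (a%:R / P%:R) (a.+1%:R / P%:R)
        (node (T (P' * k'.+2)%N) P' k'.+2 b) (node (T (P' * k'.+2)%N) P' k'.+2 b.+1) ^+ 2
    <= C / (P%:R * P'%:R).
  apply: (@rect_sum_limit f P P' (fun k a => node (S (P * k.+2)%N) P k.+2 a)
    (fun a => a%:R / P%:R) (fun b => node (T (P' * k'.+2)%N) P' k'.+2 b)) => [a b aP bP|k].
    set y := node _ _ _ b.
    have y01 : 0 <= y <= 1 by case: (nodeT P' k' b P'0 bP).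
    apply: (@is_deriv01_seq_cvg (fun x => f (x, y)) _ (dx f (a%:R / P%:R, y))) => [|k|k].
    - by apply: (derivable01_is_deriv (fx (a%:R / P%:R, y) _)); apply/unit_squareP; split => //; exact: q01.
    - by case: (nodeS P k a P0 aP).
    - by case: (nodeS P k a P0 aP) => _ h; exact: le_trans h (lek k).
  exact: fin.
have tr g x x' y y' : rect_incr g x x' y y' = rect_incr (transpose g) y y' x x'.
  by rewrite /rect_incr /transpose/=; ring.
rewrite exchange_big/=.
under eq_bigr do under eq_bigr do rewrite tr.
apply: (@rect_sum_limit (transpose f) P' P
  (fun k b => node (T (P' * k.+2)%N) P' k.+2 b) (fun b => b%:R / P'%:R) (fun a => a%:R / P%:R))
  => [b a bP aP|k].
  apply: (@is_deriv01_seq_cvg (fun y => f (a%:R / P%:R, y)) _ (dy f (a%:R / P%:R, b%:R / P'%:R))) => [|k|k].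
  - by apply: (derivable01_is_deriv (fy (a%:R / P%:R, b%:R / P'%:R) _)); apply/unit_squareP; split; exact: q01.
  - by case: (nodeT P' k b P'0 bP).
  - by case: (nodeT P' k b P'0 bP) => _ h; exact: le_trans h (lek k).
apply: le_trans (lim1 k); rewrite exchange_big/=.
by under eq_bigr do under eq_bigr do rewrite -tr.
Qed.

End Variation.

(** * Density of the mixed increments *)

Section FastL1.
Context (d : measure_display) (T : measurableType d) (R : realType).
Variables (mu : {measure set T -> \bar R}) (D : set T) (g : nat -> T -> R).
Hypotheses (mD : measurable D) (mg : forall k, measurable_fun D (g k)).
Hypothesis g0 : mu.-integrable D (EFin \o g 0%N).
Hypothesis gS : forall k,
  (\int[mu]_(x in D) `|g k.+1 x - g k x|%:E <= (2 / (2 ^ k.+1)%:R)%:E)%E.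
Local Open Scope ereal_scope.

Let G x := \sum_(k <oo) `|g k.+1 x - g k x|%:E.

Let G0 x : 0 <= G x.
Proof. by apply: nneseries_ge0 => k _ _; rewrite lee_fin. Qed.

Let mdiff k : measurable_fun D (fun x => `|g k.+1 x - g k x|%:E).
Proof.
by apply/measurable_EFinP; apply: measurableT_comp => //; exact: measurable_funB.
Qed.

Let mG : measurable_fun D G.
Proof. by apply: ge0_emeasurable_sum => // k x _ _; rewrite lee_fin. Qed.

Let iG : mu.-integrable D G.
Proof.
apply/integrableP; split => //.
under eq_integral do rewrite gee0_abs//.
rewrite /G integral_nneseries//.
apply: (@le_lt_trans _ _ (0 + 2%R%:E)); last by rewrite add0e ltry.
have := @epsilon_trick R (fun=> 0) 2%R xpredT (fun=> lexx 0) ltac:(by []).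
rewrite [X in _ <= X + _]eseries0// => h; apply: le_trans h; apply: lee_nneseries => [k _ _|k _].
  by apply: integral_ge0 => x _; rewrite lee_fin.
by rewrite add0e.
Qed.

Let sum_le x n : G x \is a fin_num ->
  (\sum_(0 <= k < n) `|g k.+1 x - g k x| <= fine (G x))%R.
Proof.
move=> fG; rewrite -lee_fin fineK// -sumEFin.
by apply: nneseries_lim_ge => k _ _; rewrite lee_fin.
Qed.

Let g_cvg x : G x \is a fin_num -> cvgn (fun k => g k x).
Proof.
move=> fG.
have h : cvgn (series (fun k => g k.+1 x - g k x)%R).
  apply: normed_cvg; apply: nondecreasing_is_cvgn.
    by apply: (@nondecreasing_series _ (fun k => `|g k.+1 x - g k x|%R)) => k _ _.
  by exists (fine (G x)) => _ [n _ <-]; rewrite /series/=; exact: sum_le.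
have -> : (fun k => g k x) = (fun k => g 0%N x + series (fun k => g k.+1 x - g k x)%R k)%R.
  by apply/funext => k; rewrite /series/= telescope_sumr// addrC subrK.
by apply: is_cvgD => //; exact: is_cvg_cst.
Qed.

(** Summability of the L1 increments plays the part of martingale convergence: the sum [G] of their
    absolute values is integrable, hence finite almost everywhere, and [|g 0| + G] dominates the
    sequence. *)
Lemma fast_L1_cvg : exists h : T -> R, [/\ measurable_fun D h,
  {ae mu, forall x, D x -> g ^~ x @ \oo --> h x},
  mu.-integrable D (EFin \o h) &
  forall E, measurable E -> E `<=` D ->
    \int[mu]_(x in E) (g k x)%:E @[k --> \oo] --> \int[mu]_(x in E) (h x)%:E].
Proof.
(* An upper limit is measurable without removing the null set where the sequence diverges. *)
pose h x := fine (limn_esup (fun k => (g k x)%:E)).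
have mh : measurable_fun D h.
  apply: (measurableT_comp (f := fine)); first exact: (fine_measurable measurableT).
  by apply: measurable_fun_limn_esup => k; exact/measurable_EFinP.
have aeG := integrable_ae mD iG.
have gh x : G x \is a fin_num -> g ^~ x @ \oo --> h x.
  move=> /g_cvg/cvg_ex[l gl].
  have gl' : (fun k => (g k x)%:E) @ \oo --> l%:E by apply: cvg_EFin => //; exact: nearW.
  by rewrite /h (cvg_limn_einf_sup gl').2.
have aegh : {ae mu, forall x, D x -> g ^~ x @ \oo --> h x}.
  by apply: filterS aeG => x Gx Dx; exact: gh (Gx Dx).
have dom : forall E, measurable E -> E `<=` D ->
    mu.-integrable E (EFin \o h) /\
    \int[mu]_(x in E) (g k x)%:E @[k --> \oo] --> \int[mu]_(x in E) (h x)%:E.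
  move=> E mE ED.
  have [|||||ih _ c] := @dominated_convergence _ T R mu E mE (fun k => EFin \o g k) (EFin \o h)
     (fun x => `|(g 0%N x)%:E| + G x).
  - by move=> k; apply/measurable_EFinP; exact: measurable_funS mD ED (mg k).
  - by apply/measurable_EFinP; exact: measurable_funS mD ED mh.
  - apply: filterS aegh => x gx /ED Dx; apply: cvg_EFin; first exact: nearW.
    exact: gx Dx.
  - apply: (integrableS mD mE ED); apply: integrableD => //.
    exact: (integrable_abse g0).
  - apply: filterS aeG => x Gx n /ED Dx.
    rewrite -[G x]fineK ?Gx//= -EFinD lee_fin.
    have -> : (g n x = g 0%N x + \sum_(0 <= k < n) (g k.+1 x - g k x))%R.
      by rewrite telescope_sumr// addrC subrK.
    apply: le_trans (ler_normD _ _) _; rewrite lerD2l.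
    by apply: le_trans (ler_norm_sum _ _ _) _; exact: sum_le (Gx Dx).
  - by split.
exists h; split => //.
- by case: (dom D mD (@subset_refl _ D)).
- by move=> E mE ED; case: (dom E mE ED).
Qed.

End FastL1.

Lemma fatou_bound (d : measure_display) (T : measurableType d) (R : realType)
  (mu : {measure set T -> \bar R}) (D : set T) (g : nat -> T -> R) (h : T -> R) (C : \bar R) :
  measurable D -> (forall k, measurable_fun D (g k)) -> measurable_fun D h ->
  (forall k x, 0 <= g k x) -> (forall x, 0 <= h x) ->
  {ae mu, forall x, D x -> g ^~ x @ \oo --> h x} ->
  (forall k, (\int[mu]_(x in D) (g k x)%:E <= C)%E) ->
  (\int[mu]_(x in D) (h x)%:E <= C)%E.
Proof.
move=> mD mg mh g0 h0 gh gC.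
have mgE k : measurable_fun D (fun x => (g k x)%:E) by apply/measurable_EFinP.
have mL : measurable_fun D (fun x => limn_einf (fun k => (g k x)%:E)).
  rewrite /limn_einf; apply: measurableT_comp => //.
  by apply: measurable_fun_limn_esup => k; apply: measurableT_comp => //.
have einf_le (u : nat -> \bar R) b : (forall k, u k <= b)%E -> (limn_einf u <= b)%E.
  move=> ub; rewrite limn_einf_lim; apply: lime_le; first exact: is_cvg_einfs.
  apply: nearW => k; apply: le_trans (ub k); apply: ereal_inf_lbound; by exists k => /=.
have L0 x : (0 <= limn_einf (fun k => (g k x)%:E))%E.
  rewrite limn_einf_lim; apply: lime_ge; first exact: is_cvg_einfs.
  apply: nearW => k; apply: le_ereal_inf_tmp => _ [m _ <-]; by rewrite lee_fin.
have -> : (\int[mu]_(x in D) (h x)%:E =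
    \int[mu]_(x in D) limn_einf (fun k => (g k x)%:E))%E.
  apply: ge0_ae_eq_integral => //.
  - by apply/measurable_EFinP.
  - by move=> x _; rewrite lee_fin.
  - apply: filterS gh => x gx Dx.
    have c : (fun k => (g k x)%:E) @ \oo --> (h x)%:E.
      by apply: cvg_EFin (gx Dx); exact: nearW.
    by rewrite (cvg_limn_einf_sup c).1.
apply: le_trans (fatou mu mD mgE _) _; first by move=> k x _; rewrite lee_fin.
exact: einf_le.
Qed.

(** * Step functions on square grids *)

Section StepFunctions.
Variable R : realType.
Local Notation mu := (@lebesgue_measure R).
Local Notation mu2 := (borel_leb2 R).
Implicit Types (c : nat -> nat -> R) (N a b : nat) (p : R * R).

Definition cell_index N (x : R) : nat := Num.truncn (x * N%:R).

Definition in_unit0 p : bool := (0 <= p.1 < 1) && (0 <= p.2 < 1).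

Definition step N c p : R :=
  if in_unit0 p then c (cell_index N p.1) (cell_index N p.2) else 0.

Definition cell N a : set R := `[a%:R / N%:R, a.+1%:R / N%:R[%classic.

Lemma cellP N a (x : R) : (0 < N)%N -> 0 <= x -> cell N a x <-> cell_index N x = a.
Proof.
move=> N0 x0; have NR : 0 < N%:R :> R by rewrite ltr0n.
rewrite /cell/= in_itv/= ler_pdivrMr// ltr_pdivlMr//; split.
  by move=> h; exact: truncn_def.
by move=> <-; apply: truncn_itv; rewrite mulr_ge0.
Qed.

Lemma cell_index_lt N (x : R) i : (0 < N)%N -> 0 <= x ->
  (cell_index N x < i)%N = (x < i%:R / N%:R).
Proof.
by move=> N0 x0; rewrite /cell_index truncn_lt_nat ?mulr_ge0// ltr_pdivlMr ?ltr0n.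
Qed.

Lemma cell_index_ltN N (x : R) : (0 < N)%N -> 0 <= x < 1 -> (cell_index N x < N)%N.
Proof. by move=> N0 /andP[x0 x1]; rewrite cell_index_lt// divff// pnatr_eq0 -lt0n. Qed.

Lemma cell_index_refine N r (x : R) : (0 < N)%N -> (0 < r)%N -> 0 <= x ->
  cell_index N x = (cell_index (N * r) x %/ r)%N.
Proof.
move=> N0 r0 x0; have rR : 0 < r%:R :> R by rewrite ltr0n.
apply: truncn_def.
have /andP[] := truncn_itv (mulr_ge0 x0 (ler0n R (N * r))).
rewrite -/(cell_index _ _); move: (cell_index _ _) => k; rewrite natrM mulrA => k1 k2.
apply/andP; split.
  rewrite -(ler_pM2r rR) (le_trans _ k1)// -natrM ler_nat; exact: leq_trunc_div.
rewrite -(ltr_pM2r rR) (lt_le_trans k2)// -natrM ler_nat.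
by rewrite ltn_ceil.
Qed.

Lemma step_refine N r c : (0 < N)%N -> (0 < r)%N ->
  step N c = step (N * r) (fun a b => c (a %/ r)%N (b %/ r)%N).
Proof.
move=> N0 r0; apply/funext => p; rewrite /step; case: ifPn => // /andP[/andP[x0 _] /andP[y0 _]].
by rewrite !(cell_index_refine N0 r0).
Qed.

Lemma stepE N c p : (0 < N)%N ->
  step N c p = \sum_(0 <= a < N) \sum_(0 <= b < N) c a b * \1_(cell N a `*` cell N b) p.
Proof.
move=> N0; case: p => x y.
have I a b : (a < N)%N -> (b < N)%N -> \1_(cell N a `*` cell N b) (x, y) =
    (in_unit0 (x, y) && ((a == cell_index N x) && (b == cell_index N y)))%:R :> R.
  move=> aN bN; rewrite indicE; congr (_%:R); congr nat_of_bool; apply/idP/idP.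
    rewrite inE => -[/= hx hy].
    have NR : 0 < N%:R :> R by rewrite ltr0n.
    have bnd z k : (k < N)%N -> cell N k z -> 0 <= z < 1.
      rewrite /cell/= in_itv/= => kN /andP[h1 h2]; apply/andP; split.
        by rewrite (le_trans _ h1)// divr_ge0.
      by rewrite (lt_le_trans h2)// ler_pdivrMr// mul1r ler_nat.
    have x01 := bnd _ _ aN hx; have y01 := bnd _ _ bN hy.
    have /andP[x0 _] := x01; have /andP[y0 _] := y01.
    move: hx hy; rewrite !cellP// => <- <-.
    by rewrite !eqxx /in_unit0/= x01 y01.
  move=> /andP[/andP[/= /andP[x0 _] /andP[y0 _]] /andP[/eqP -> /eqP ->]].
  by rewrite inE; split => /=; apply/cellP.
transitivity (\sum_(0 <= a < N) \sum_(0 <= b < N) (c a b *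
   (in_unit0 (x, y) && ((a == cell_index N x) && (b == cell_index N y)))%:R)); last first.
  by apply: eq_big_nat => a /andP[_ aN]; apply: eq_big_nat => b /andP[_ bN]; rewrite I.
rewrite /step; case: ifPn => [/andP[x01 y01]|_]; last first.
  by rewrite big1// => a _; rewrite big1// => b _; rewrite mulr0.
have xN := cell_index_ltN N0 x01; have yN := cell_index_ltN N0 y01.
rewrite (bigD1_seq (cell_index N x)) ?iota_uniq ?mem_index_iota//=.
rewrite (bigD1_seq (cell_index N y)) ?iota_uniq ?mem_index_iota//=.
rewrite !eqxx mulr1 big1 ?addr0; last by move=> b /negbTE ->; rewrite andbF mulr0.
rewrite big1 ?addr0// => a /negbTE ax; rewrite big1// => b _.
by rewrite ax/= mulr0.
Qed.

Lemma measurable_cell N a : measurable (cell N a).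
Proof. exact: measurable_itv. Qed.

Lemma measurable_cell2 N a b :
  (measurable : set (set (measurableTypeR R * measurableTypeR R))) (cell N a `*` cell N b).
Proof. by apply: measurableX; exact: measurable_cell. Qed.

Lemma step_measurable N c : (0 < N)%N -> measurable_fun [set: R * R] (step N c).
Proof.
move=> N0; rewrite (_ : step N c = fun p =>
  \sum_(0 <= a < N) \sum_(0 <= b < N) c a b * \1_(cell N a `*` cell N b) p); last first.
  by apply/funext => p; exact: stepE.
apply: measurable_sum => a; apply: measurable_sum => b.
apply: measurable_funM; first exact: measurable_cst.
by apply: measurable_indic; exact: measurable_cell2.
Qed.

Lemma mu2_cell N a b : (0 < N)%N -> mu2 (cell N a `*` cell N b) = ((N%:R ^+ 2)^-1)%:E.
Proof.
move=> N0; have NR : 0 < N%:R :> R by rewrite ltr0n.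
have mc k : mu (cell N k) = (N%:R^-1)%:E.
  rewrite /cell lebesgue_measure_itv/= lte_fin ltr_pM2r ?invr_gt0// ltr_nat ltnSn.
  by rewrite -EFinB; congr (_%:E); rewrite -natr1; field; rewrite gt_eqF.
transitivity (mu (cell N a) * mu (cell N b))%E.
  by apply: product_measure1E; exact: measurable_cell.
by rewrite !mc -EFinM; congr (_%:E); field; rewrite gt_eqF.
Qed.

Lemma step_integral_ge0 N c : (0 < N)%N -> (forall a b, 0 <= c a b) ->
  (\int[mu2]_(p in unit_square R) (step N c p)%:E =
   ((\sum_(0 <= a < N) \sum_(0 <= b < N) c a b) / N%:R ^+ 2)%:E)%E.
Proof.
move=> N0 c0; have NR : 0 < N%:R :> R by rewrite ltr0n.
have m1 a b : measurable_fun (unit_square R) (fun p => (\1_(cell N a `*` cell N b) p)%:E : \bar R).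
  by apply/measurable_EFinP; apply: measurable_indic; exact: measurable_cell2.
have mc a b : measurable_fun (unit_square R) (fun p => (c a b)%:E * (\1_(cell N a `*` cell N b) p)%:E)%E.
  by apply: emeasurable_funM => //; exact: measurable_cst.
have pos a b p : (0 <= (c a b)%:E * (\1_(cell N a `*` cell N b) p)%:E)%E.
  by rewrite -EFinM lee_fin mulr_ge0.
transitivity (\int[mu2]_(p in unit_square R) (\sum_(0 <= a < N) \sum_(0 <= b < N)
    ((c a b)%:E * (\1_(cell N a `*` cell N b) p)%:E)))%E.
  apply: eq_integral => p _; rewrite stepE// -sumEFin; apply: eq_bigr => a _.
  by rewrite -sumEFin.
rewrite ge0_integral_sum//; last 3 first.
- exact: measurable_unit_square.
- by move=> a; apply: emeasurable_sum => b; exact: mc.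
- by move=> a p _; exact: sume_ge0.
rewrite mulr_suml -sumEFin; apply: eq_big_nat => a /andP[_ aN].
rewrite (ge0_integral_sum mu2 (@measurable_unit_square R) (mc a) (fun b p _ => pos a b p)).
rewrite mulr_suml -sumEFin; apply: eq_big_nat => b /andP[_ bN].
rewrite ge0_integralZl_EFin//; [|exact: measurable_unit_square|exact: m1].
rewrite integral_indic//; [|exact: measurable_unit_square|exact: measurable_cell2].
rewrite setIidl.
  have -> := mu2_cell a b N0.
  by rewrite -EFinM.
have bnd k z : (k < N)%N -> cell N k z -> 0 <= z <= 1.
  rewrite /cell/= in_itv/= => kN /andP[h1 h2]; apply/andP; split.
    by rewrite (le_trans _ h1)// divr_ge0.
  by rewrite (le_trans (ltW h2))// ler_pdivrMr// mul1r ler_nat.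
by move=> -[x y] [/= hx hy]; apply/unit_squareP; split; [exact: bnd hx|exact: bnd hy].
Qed.

(** Half-open like the cells, so that a corner at grid nodes is exactly a union of cells. *)
Definition corner (x y : R) : set (R * R) := `[0, x[%classic `*` `[0, y[%classic.

Lemma step_rect_integral N c i j : (0 < N)%N -> (i <= N)%N -> (j <= N)%N ->
  (\int[mu2]_(p in corner (i%:R / N%:R)%R (j%:R / N%:R)%R) (step N c p)%:E =
   ((\sum_(0 <= a < i) \sum_(0 <= b < j) c a b) / N%:R ^+ 2)%:E)%E.
Proof.
move=> N0 iN jN; have NR : 0 < N%:R :> R by rewrite ltr0n.
set E := corner _ _.
pose mask (e : nat -> nat -> R) a b : R := if (a < i)%N && (b < j)%N then e a b else 0.
have sumE e : \sum_(0 <= a < N) \sum_(0 <= b < N) mask e a b =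
    \sum_(0 <= a < i) \sum_(0 <= b < j) e a b.
  have cut (F : nat -> R) n : (n <= N)%N ->
      \sum_(0 <= a < N) (if (a < n)%N then F a else 0) = \sum_(0 <= a < n) F a.
    move=> nN; rewrite (big_cat_nat (leq0n n) nN)/= [X in _ + X]big1_seq ?addr0.
      by apply: eq_big_nat => a /andP[_ ->].
    by move=> a; rewrite mem_index_iota => /andP[_ /andP[na _]]; rewrite ltnNge na.
  rewrite -(cut _ _ iN); apply: eq_bigr => a _; rewrite /mask.
  case: ifPn => ai; first by rewrite -(cut _ _ jN); apply: eq_bigr => b _.
  by rewrite big1// => b _.
have ge0 e : (forall a b, 0 <= e a b) -> (\int[mu2]_(p in E) (step N e p)%:E =
   ((\sum_(0 <= a < i) \sum_(0 <= b < j) e a b) / N%:R ^+ 2)%:E)%E.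
  move=> e0; rewrite -sumE -step_integral_ge0//; last first.
    by move=> a b; rewrite /mask; case: ifP.
  rewrite [LHS]integral_mkcond [RHS]integral_mkcond; apply: eq_integral => -[x y] _.
  rewrite !patchE.
  have bnd k (z : R) : (k <= N)%N -> z < k%:R / N%:R -> z < 1.
    by move=> kN /lt_le_trans; apply; rewrite ler_pdivrMr// mul1r ler_nat.
  have [xyE|xyE] := boolP ((x, y) \in E).
    move: (xyE); rewrite inE /E /corner/= !in_itv/= => -[/andP[x0 x1] /andP[y0 y1]].
    have u0 : in_unit0 (x, y) by rewrite /in_unit0/= x0 y0/= (bnd i)// (bnd j).
    have hx := ltW (bnd i x iN x1); have hy := ltW (bnd j y jN y1).
    rewrite ifT; last by rewrite inE; apply/unit_squareP; rewrite x0 y0.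
    by rewrite /step u0/= /mask !cell_index_lt// x1 y1.
  case: ifP => // _; rewrite /step; case: ifPn => // /andP[/= /andP[x0 x1] /andP[y0 y1]].
  rewrite /mask; case: ifPn => //; rewrite !cell_index_lt// => /andP[xi yj].
  by move: xyE; rewrite notin_setE; case; rewrite /E /corner/= !in_itv/= x0 y0.
(* Positive and negative parts of a step function are step functions with the corresponding
   coefficients, which reduces the signed case to the nonnegative one. *)
rewrite integralE.
have -> : (\int[mu2]_(p in E) (fun p => (step N c p)%:E)^\+ p =
  \int[mu2]_(p in E) (step N (fun a b => Num.max (c a b) 0) p)%:E)%E.
  apply: eq_integral => p _; rewrite funeposE -EFin_max; congr (_%:E).
  by rewrite /step; case: ifP => // _; rewrite maxxx.
have -> : (\int[mu2]_(p in E) (fun p => (step N c p)%:E)^\- p =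
  \int[mu2]_(p in E) (step N (fun a b => Num.max (- c a b) 0) p)%:E)%E.
  apply: eq_integral => p _; rewrite funenegE -EFinN -EFin_max; congr (_%:E).
  by rewrite /step; case: ifP => // _; rewrite oppr0 maxxx.
rewrite !ge0; [|by move=> a b; rewrite le_max lexx orbT..].
rewrite -EFinB -mulrBl -sumrB; congr ((_ / _)%:E).
apply: eq_bigr => a _; rewrite -sumrB; apply: eq_bigr => b _.
by rewrite /Num.max; case: ltrP => h1; case: ltrP => h2; lra.
Qed.

End StepFunctions.

Section BlockVariance.
Variable R : realFieldType.

Lemma big_nat_block2 (F : nat -> nat -> R) N r :
  \sum_(0 <= a < N * r) \sum_(0 <= b < N * r) F a b =
  \sum_(0 <= A < N) \sum_(0 <= B < N) \sum_(0 <= i < r) \sum_(0 <= j < r)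
    F (A * r + i)%N (B * r + j)%N.
Proof.
rewrite big_nat_block; apply: eq_bigr => A _.
by under eq_bigr do rewrite big_nat_block; rewrite exchange_big.
Qed.

(** Pythagoras for martingale increments: on each block [C] is the mean of [c], hence orthogonal to
    the deviation. *)
Lemma block_variance (c C : nat -> nat -> R) N r : (0 < r)%N ->
  (forall A B, \sum_(0 <= i < r) \sum_(0 <= j < r) c (A * r + i)%N (B * r + j)%N
     = r%:R ^+ 2 * C A B) ->
  \sum_(0 <= a < N * r) \sum_(0 <= b < N * r) (c a b - C (a %/ r)%N (b %/ r)%N) ^+ 2 =
  \sum_(0 <= a < N * r) \sum_(0 <= b < N * r) c a b ^+ 2 -
  r%:R ^+ 2 * \sum_(0 <= A < N) \sum_(0 <= B < N) C A B ^+ 2.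
Proof.
move=> r0 hc; rewrite !big_nat_block2 mulr_sumr -sumrB; apply: eq_bigr => A _.
rewrite mulr_sumr -sumrB; apply: eq_bigr => B _.
transitivity (\sum_(0 <= i < r) \sum_(0 <= j < r)
   (c (A * r + i)%N (B * r + j)%N ^+ 2 + (- 2 * C A B) * c (A * r + i)%N (B * r + j)%N
     + C A B ^+ 2)).
  apply: eq_big_nat => i /andP[_ ir]; apply: eq_big_nat => j /andP[_ jr].
  by rewrite !divnMDl// !divn_small// !addn0; ring.
under eq_bigr do rewrite !big_split/= -mulr_sumr sumr_const_nat subn0.
rewrite big_split/= big_split/= -mulr_sumr hc sumr_const_nat subn0.
have -> : C A B ^+ 2 *+ r *+ r = r%:R ^+ 2 * C A B ^+ 2 by rewrite -mulrnA -(mulr_natl (C A B ^+ 2)) natrM expr2.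
ring.
Qed.

End BlockVariance.

(** * The density as a limit of cell averages *)

Section Density.
Variable R : realType.
Local Notation mu2 := (borel_leb2 R).
Variables (f : R * R -> R) (C : R).
Hypothesis C0 : 0 <= C.
Hypothesis fx : forall p, unit_square R p -> has_dx f p.
Hypothesis fy : forall p, unit_square R p -> has_dy f p.
Hypothesis fC : forall P P', (0 < P)%N -> (0 < P')%N ->
    \sum_(0 <= a < P) \sum_(0 <= b < P')
      rect_incr f (a%:R / P%:R) (a.+1%:R / P%:R) (b%:R / P'%:R) (b.+1%:R / P'%:R) ^+ 2
    <= C / (P%:R * P'%:R).

(** The increment over a cell divided by its area: the mean that the sought density must have
    there. *)
Let coef N a b : R :=
  N%:R ^+ 2 * rect_incr f (a%:R / N%:R) (a.+1%:R / N%:R) (b%:R / N%:R) (b.+1%:R / N%:R).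

Lemma coef_block_sum N i i' j j' : (0 < N)%N -> (i <= i')%N -> (j <= j')%N ->
  \sum_(i <= a < i') \sum_(j <= b < j') coef N a b =
  N%:R ^+ 2 * rect_incr f (i%:R / N%:R) (i'%:R / N%:R) (j%:R / N%:R) (j'%:R / N%:R).
Proof.
move=> N0 ii' jj'.
have := @rect_sum R (fun a b => f (a%:R / N%:R, b%:R / N%:R)) i i' j j' ii' jj'.
rewrite {1}/rect /rect_incr => ->; rewrite mulr_sumr; apply: eq_bigr => a _.
by rewrite mulr_sumr.
Qed.

(** The martingale property; it holds because increments over rectangles are additive. *)
Lemma coef_refine N r A B : (0 < N)%N -> (0 < r)%N ->
  \sum_(0 <= i < r) \sum_(0 <= j < r) coef (N * r) (A * r + i) (B * r + j) =
  r%:R ^+ 2 * coef N A B.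
Proof.
move=> N0 r0.
have NR : 0 < N%:R :> R by rewrite ltr0n.
have rR : 0 < r%:R :> R by rewrite ltr0n.
have sh (F : nat -> R) k : \sum_(0 <= i < r) F (k + i)%N = \sum_(k <= i < k + r) F i.
  have := big_addn 0 (k + r) k xpredT F; rewrite add0n addKn => ->.
  by apply: eq_bigr => i _; rewrite addnC.
under eq_bigr do rewrite (sh (fun b => coef _ _ b)).
rewrite (sh (fun a => \sum_(_ <= b < _) coef _ a b)) coef_block_sum ?leq_addr ?muln_gt0 ?N0//.
have E k : (k * r)%:R / (N * r)%:R = k%:R / N%:R :> R.
  by rewrite !natrM; field; rewrite !gt_eqF.
have E' k : (k * r + r)%:R / (N * r)%:R = k.+1%:R / N%:R :> R by rewrite -mulSnr E.
by rewrite !E !E' /coef natrM; ring.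
Qed.

(** The squared L2 norm of the step function with coefficients [coef N]. *)
Let V N : R := (\sum_(0 <= a < N) \sum_(0 <= b < N) coef N a b ^+ 2) / N%:R ^+ 2.

Lemma V_le N : (0 < N)%N -> V N <= C.
Proof.
move=> N0; have NR : 0 < N%:R :> R by rewrite ltr0n.
have := fC N0 N0; set S := \sum_(0 <= a < N) _ => hS.
have -> : V N = N%:R ^+ 2 * S.
  rewrite /V /S mulr_sumr mulr_suml; apply: eq_bigr => a _.
  rewrite mulr_sumr mulr_suml; apply: eq_bigr => b _; rewrite /coef; field.
  by rewrite gt_eqF.
rewrite -ler_pdivlMl ?exprn_gt0// (le_trans hS)// le_eqVlt; apply/orP; left; apply/eqP.
by field; rewrite gt_eqF.
Qed.

Lemma V_refine N r : (0 < N)%N -> (0 < r)%N ->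
  (\sum_(0 <= a < N * r) \sum_(0 <= b < N * r)
     (coef (N * r) a b - coef N (a %/ r) (b %/ r)) ^+ 2) / (N * r)%:R ^+ 2 =
  V (N * r) - V N.
Proof.
move=> N0 r0; have NR : 0 < N%:R :> R by rewrite ltr0n.
have rR : 0 < r%:R :> R by rewrite ltr0n.
rewrite (block_variance _ r0 (fun A B => coef_refine A B N0 r0)) /V natrM.
by move: (\sum_(_ <= _ < _) _) (\sum_(_ <= _ < _) _) => s t; field; rewrite !gt_eqF.
Qed.

Lemma V_mono m n : (m <= n)%N -> V (2 ^ m) <= V (2 ^ n).
Proof.
move=> mn; rewrite -subr_ge0 -(subnKC mn) expnD -V_refine ?expn_gt0//.
by rewrite divr_ge0 ?sqr_ge0//; apply: sumr_ge0 => a _; apply: sumr_ge0 => b _; exact: sqr_ge0.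
Qed.

(** [V] is nondecreasing along powers of 2 and bounded, so levels can be chosen at which its
    increments are at most [4^-k]; by orthogonality these are squared L2 distances. *)
Lemma fast_levels : exists n : nat -> nat, [/\ forall k, (k <= n k)%N,
  forall k, (n k <= n k.+1)%N &
  forall k, V (2 ^ n k.+1) - V (2 ^ n k) <= ((2 ^ k)%:R ^+ 2)^-1].
Proof.
pose S : set R := [set V (2 ^ m) | m in [set: nat]].
have supS : has_sup S.
  split; first by exists (V (2 ^ 0)), 0%N.
  by exists C => _ [m _ <-]; apply: V_le; rewrite expn_gt0.
have Sub m : V (2 ^ m) <= sup S by apply: ub_le_sup; [case: supS|exists m].
have /choice[v hv] k : exists m, sup S - ((2 ^ k)%:R ^+ 2)^-1 < V (2 ^ m).
  have e0 : 0 < ((2 ^ k)%:R ^+ 2)^-1 :> R by rewrite invr_gt0 exprn_gt0// ltr0n expn_gt0.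
  by have [_ [m _ <-] hm] := sup_adherent e0 supS; exists m.
(* Cumulative sums force monotonicity and [k <= n k] while keeping [v k <= n k]. *)
pose n k := (\sum_(0 <= i < k.+1) (v i).+1)%N.
have nS k : n k.+1 = (n k + (v k.+1).+1)%N by rewrite /n big_nat_recr.
have vn k : (v k <= n k)%N by rewrite /n big_nat_recr//=; lia.
exists n; split.
- by elim=> // k IH; rewrite nS; lia.
- by move=> k; rewrite nS leq_addr.
- move=> k; have h1 := Sub (n k.+1); have h2 := hv k; have h3 := V_mono (vn k); lra.
Qed.

Lemma corner_sub (x y : R) : x <= 1 -> y <= 1 -> corner x y `<=` unit_square R.
Proof.
move=> x1 y1 [s t]; rewrite /corner/= !in_itv/= => -[/andP[s0 sx] /andP[t0 ty]].
by apply/unit_squareP; rewrite s0 t0 (le_trans (ltW sx))// (le_trans (ltW ty)).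
Qed.

Lemma measurable_corner (x y : R) :
  (measurable : set (set (measurableTypeR R * measurableTypeR R))) (corner x y).
Proof. by apply: measurableX; exact: measurable_itv. Qed.

(** Half-open corners exhaust their limit exactly, so monotone convergence of sets applies to both
    parts of [h]. Constant sequences are allowed, which lets one side move while the other rests. *)
Lemma corner_integral_cvg (h : R * R -> R) (x y : R) (X Y : nat -> R) :
  mu2.-integrable (unit_square R) (EFin \o h) -> x <= 1 -> y <= 1 ->
  {homo X : m n / (m <= n)%N >-> m <= n} -> {homo Y : m n / (m <= n)%N >-> m <= n} ->
  (forall k, X k <= x) -> (forall k, Y k <= y) ->
  (forall t, t < x -> exists k, t < X k) -> (forall t, t < y -> exists k, t < Y k) ->
  (\int[mu2]_(p in corner (X k) (Y k)) (h p)%:E @[k --> \oo] -->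
   \int[mu2]_(p in corner x y) (h p)%:E)%E.
Proof.
move=> ih x1 y1 homoX homoY Xx Yy hX hY.
have mh : measurable_fun (unit_square R) (EFin \o h) by have /integrableP[] := ih.
pose F k := corner (X k) (Y k).
have UF : \bigcup_k F k = corner x y.
  apply/seteqP; split => -[s t].
    move=> [k _]; rewrite /F /corner/= !in_itv/= => -[/andP[-> sX] /andP[-> tY]].
    by rewrite (lt_le_trans sX)// (lt_le_trans tY).
  rewrite /corner/= !in_itv/= => -[/andP[s0 sx] /andP[t0 ty]].
  have [k1 hk1] := hX s sx; have [k2 hk2] := hY t ty.
  exists (maxn k1 k2) => //; rewrite /F /corner/= !in_itv/= s0 t0/=.
  by rewrite (lt_le_trans hk1) ?(lt_le_trans hk2)//; [apply: homoY|apply: homoX]; rewrite ?leq_maxl ?leq_maxr.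
have FS k : F k `<=` unit_square R.
  by apply: subset_trans (corner_sub x1 y1); rewrite -UF; exact: bigcup_sup.
have homoF : nondecreasing_seq F.
  move=> m n mn; apply/subsetPset => -[s t]; rewrite /F /corner/= !in_itv/= => -[/andP[-> sX] /andP[-> tY]].
  by rewrite (lt_le_trans sX) ?homoX// (lt_le_trans tY) ?homoY.
have mF k : (measurable : set (set (measurableTypeR R * measurableTypeR R))) (F k).
  exact: measurable_corner.
have cv (g : R * R -> \bar R) : measurable_fun (unit_square R) g -> (forall p, 0 <= g p)%E ->
   (\int[mu2]_(p in F k) g p @[k --> \oo] --> \int[mu2]_(p in corner x y) g p)%E.
  move=> mg g0; rewrite -UF; apply: ge0_nondecreasing_set_cvg_integral => //.
  by move=> k; apply: measurable_funS mg; [exact: measurable_unit_square|exact: FS].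
have fin (g : R * R -> \bar R) : mu2.-integrable (unit_square R) g -> (forall p, 0 <= g p)%E ->
   (\int[mu2]_(p in corner x y) g p)%E \is a fin_num.
  move=> ig g0; apply: integrable_fin_num; first exact: measurable_corner.
  apply: integrableS ig; [exact: measurable_unit_square|exact: measurable_corner|exact: corner_sub].
have Ep : forall D, (\int[mu2]_(p in D) (h p)%:E = \int[mu2]_(p in D) ((EFin \o h)^\+ p)
   - \int[mu2]_(p in D) ((EFin \o h)^\- p))%E by move=> D; rewrite integralE.
rewrite Ep; under eq_fun do rewrite Ep.
apply: cvgeB.
- apply: fin_num_adde_defl; rewrite fin_numN; apply: fin.
    by apply: integrable_funeneg => //; exact: measurable_unit_square.
  by move=> p; exact: funeneg_ge0.
- by apply: cv; [exact: measurable_funepos|move=> p; exact: funepos_ge0].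
- by apply: cv; [exact: measurable_funeneg|move=> p; exact: funeneg_ge0].
Qed.

Definition dyadic_floor (x : R) (k : nat) : R := (cell_index (2 ^ k) x)%:R / (2 ^ k)%:R.

Lemma dyadic_floorP (x : R) : 0 <= x <= 1 ->
  [/\ forall k, dyadic_floor x k <= x, forall k, x - dyadic_floor x k < k.+1%:R^-1,
      forall k, (cell_index (2 ^ k) x <= 2 ^ k)%N &
      {homo dyadic_floor x : m n / (m <= n)%N >-> m <= n}].
Proof.
move=> /andP[x0 x1].
have p0 k : (0 < 2 ^ k)%N by rewrite expn_gt0.
have pR k : 0 < (2 ^ k)%:R :> R by rewrite ltr0n.
have tr k := truncn_itv (mulr_ge0 x0 (ltW (pR k))).
have le k : dyadic_floor x k <= x by rewrite ler_pdivrMr//; have /andP[] := tr k.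
split => // [k|k|].
- apply: (@lt_le_trans _ _ (2 ^ k)%:R^-1).
    have /andP[_ h] := tr k.
    by rewrite ltrBlDl /dyadic_floor -[X in _ + X]mul1r -mulrDl natr1 ltr_pdivlMr.
  by rewrite lef_pV2 ?posrE// ler_nat; exact: ltn_expl.
- by rewrite -(ler_nat R); have /andP[h _] := tr k; rewrite (le_trans h)// ler_piMl// ltW.
- apply: homo_leq => // [a b c|k]; first exact: le_trans.
  rewrite /dyadic_floor (cell_index_refine (N := 2 ^ k) (r := 2))// expnS mulnC.
  rewrite ler_pdivrMr// mulrAC ler_pdivlMr ?ltr0n ?muln_gt0 ?p0//.
  rewrite -!natrM ler_nat mulnA leq_mul2r; apply/orP; right; exact: leq_trunc_div.
Qed.

Theorem mixed_density : exists h : R * R -> R,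
  [/\ measurable_fun [set: R * R] h,
      (\int[mu2]_(p in unit_square R) (h p ^+ 2)%:E <= C%:E)%E,
      mu2.-integrable (unit_square R) (EFin \o h) &
      forall x y : R, 0 <= x <= 1 -> 0 <= y <= 1 ->
        (rect_incr f 0 x 0 y)%:E = (\int[mu2]_(p in corner x y) (h p)%:E)%E].
Proof.
have [n [kn nS hV]] := fast_levels.
pose g k := step (2 ^ n k) (coef (2 ^ n k)).
have p0 k : (0 < 2 ^ k)%N by rewrite expn_gt0.
have mg k : measurable_fun [set: R * R] (g k) by exact: step_measurable.
have mgD k : measurable_fun (unit_square R) (g k) by exact: measurable_funTS.
have g0 : mu2.-integrable (unit_square R) (EFin \o g 0%N).
  apply/integrableP; split; first by apply/measurable_EFinP; exact: mgD.
  have -> : (\int[mu2]_(p in unit_square R) `|(EFin \o g 0%N) p| = \int[mu2]_(p in unit_square R)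
      (step (2 ^ n 0%N) (fun a b => `|coef (2 ^ n 0%N) a b|%R) p)%:E)%E.
    by apply: eq_integral => p _; rewrite /= /g /step; case: ifP => // _; rewrite normr0.
  by rewrite step_integral_ge0// ltry.
have gS k : (\int[mu2]_(p in unit_square R) `|g k.+1 p - g k p|%:E <= (2 / (2 ^ k.+1)%:R)%:E)%E.
  set N := (2 ^ n k)%N; pose r := (2 ^ (n k.+1 - n k))%N.
  have ME : (2 ^ n k.+1 = N * r)%N by rewrite /N /r -expnD subnKC.
  have N0 : (0 < N)%N by exact: p0.
  have r0 : (0 < r)%N by exact: p0.
  have MR : 0 < (N * r)%:R :> R by rewrite ltr0n muln_gt0 N0.
  pose d a b := coef (N * r) a b - coef N (a %/ r) (b %/ r).
  have -> : (\int[mu2]_(p in unit_square R) `|g k.+1 p - g k p|%:E =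
      \int[mu2]_(p in unit_square R) (step (N * r) (fun a b => `|d a b|%R) p)%:E)%E.
    apply: eq_integral => p _; rewrite /g ME -/N (step_refine _ N0 r0) /step; case: ifP => // _.
    by rewrite subrr normr0.
  rewrite step_integral_ge0 ?muln_gt0 ?N0// lee_fin.
  set E : R := (2 ^ k)%:R.
  have E0 : 0 < E by rewrite ltr0n.
  have -> : 2 / (2 ^ k.+1)%:R = E^-1 :> R by rewrite expnS natrM -/E; field; rewrite gt_eqF.
  have hd := hV k; rewrite ME -V_refine// -/E in hd.
  (* [|d| <= E d^2 / 2 + 1 / (2 E)] with [E = 2^k] balances an L2 distance squared of at most
     [E^-2], and yields an L1 distance of at most [E^-1]. *)
  apply: (@le_trans _ _ ((\sum_(0 <= a < N * r) \sum_(0 <= b < N * r)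
     (E / 2 * d a b ^+ 2 + E^-1 / 2)) / (N * r)%:R ^+ 2)).
    rewrite ler_pM2r ?invr_gt0 ?exprn_gt0//.
    apply: ler_sum => a _; apply: ler_sum => b _.
    rewrite -[d a b ^+ 2]real_normK ?num_real//.
    have := sqr_ge0 (E * `|d a b| - 1); rewrite -(ler_pM2l (_ : 0 < 2 * E)) ?mulr_gt0//.
    have -> : 2 * E * (E / 2 * `|d a b| ^+ 2 + E^-1 / 2) = E ^+ 2 * `|d a b| ^+ 2 + 1.
      by field; rewrite gt_eqF.
    by move: (`|d a b|) => z; lra.
  have -> : (\sum_(0 <= a < N * r) \sum_(0 <= b < N * r) (E / 2 * d a b ^+ 2 + E^-1 / 2)) / (N * r)%:R ^+ 2
    = E / 2 * ((\sum_(0 <= a < N * r) \sum_(0 <= b < N * r) d a b ^+ 2) / (N * r)%:R ^+ 2) + E^-1 / 2.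
    under eq_bigr do rewrite big_split/= -mulr_sumr sumr_const_nat subn0.
    rewrite big_split/= -mulr_sumr sumr_const_nat subn0 -mulrnA -[X in _ + X]mulr_natr (natrM _ (N * r)).
    by move: (\sum_(_ <= _ < _) _) ((N * r)%:R : R) MR => S M MR; field; rewrite !gt_eqF.
  have h2 : E / 2 * ((\sum_(0 <= a < N * r) \sum_(0 <= b < N * r) d a b ^+ 2) / (N * r)%:R ^+ 2)
     <= E / 2 * (E ^+ 2)^-1 by rewrite ler_pM2l ?divr_gt0.
  have h3 : E / 2 * (E ^+ 2)^-1 = E^-1 / 2 by field; rewrite gt_eqF.
  by rewrite h3 in h2; lra.
have [h0 [mh0 aeh0 ih0 ch0]] := fast_L1_cvg (@measurable_unit_square R) mgD g0 gS.
(* The limit is measurable on the square only; the retraction extends it to a Borel function on the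
   plane. *)
pose h : R * R -> R := clip2 h0.
have hE p : unit_square R p -> h p = h0 p by move=> sp; rewrite /h clip2_id.
have mh : measurable_fun [set: R * R] h.
  apply: (measurable_comp (F := unit_square R) (f := h0) (g := fun p : R * R => (clip p.1, clip p.2))).
  - exact: measurable_unit_square.
  - by move=> _ [p _ <-]; exact: clip2_square.
  - exact: mh0.
  - by apply: measurable_fun_pair; apply: measurable_clip1; [exact: measurable_fst|exact: measurable_snd].
have eqh E : E `<=` unit_square R ->
    (\int[mu2]_(p in E) (h p)%:E = \int[mu2]_(p in E) (h0 p)%:E)%E.
  by move=> ES; apply: eq_integral => p; rewrite inE => /ES/hE ->.
have dyad j i i' : (i <= 2 ^ j)%N -> (i' <= 2 ^ j)%N ->
    (rect_incr f 0 (i%:R / (2 ^ j)%:R)%R 0 (i'%:R / (2 ^ j)%:R)%R)%:E =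
    (\int[mu2]_(p in corner (i%:R / (2 ^ j)%:R)%R (i'%:R / (2 ^ j)%:R)%R) (h p)%:E)%E.
  move=> ij i'j; have pR : 0 < (2 ^ j)%:R :> R by rewrite ltr0n.
  have le1 a : (a <= 2 ^ j)%N -> a%:R / (2 ^ j)%:R <= 1 :> R.
    by move=> aj; rewrite ler_pdivrMr// mul1r ler_nat.
  set x := i%:R / _; set y := i'%:R / _.
  have sub : corner x y `<=` unit_square R by apply: corner_sub; exact: le1.
  rewrite eqh//; have := ch0 _ (measurable_corner x y) sub.
  apply: cvg_unique; first exact: ereal_hausdorff.
  (* At dyadic nodes of level [j] the integrals of the approximations are constant as soon as
     [n k >= j]. *)
  apply: cvg_near_cst; exists j => // k /= jk.
  have jn : (j <= n k)%N by exact: leq_trans jk (kn k).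
  pose q := (2 ^ (n k - j))%N; have q0 : (0 < q)%N by exact: p0.
  have qR : 0 < q%:R :> R by rewrite ltr0n.
  have ME : (2 ^ n k = 2 ^ j * q)%N by rewrite /q -expnD subnKC.
  have cE a : a%:R / (2 ^ j)%:R = (a * q)%:R / (2 ^ n k)%:R :> R.
    by rewrite ME !natrM; field; rewrite !gt_eqF.
  rewrite /x /y !cE /g step_rect_integral ?p0 ?ME ?leq_mul2r ?ij ?i'j ?orbT//.
  rewrite coef_block_sum ?muln_gt0 ?p0// !mul0r.
  by congr (_%:E); rewrite mulrAC divff ?mul1r// expf_neq0// gt_eqF// ltr0n muln_gt0 p0.
have ih : mu2.-integrable (unit_square R) (EFin \o h).
  apply: eq_integrable ih0; first exact: measurable_unit_square.
  by move=> p; rewrite inE => /hE /= ->.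
exists h; split => //.
  have -> : (\int[mu2]_(p in unit_square R) (h p ^+ 2)%:E =
      \int[mu2]_(p in unit_square R) (h0 p ^+ 2)%:E)%E.
    by apply: eq_integral => p; rewrite inE => /hE ->.
  apply: (@fatou_bound _ _ _ mu2 _ (fun k p => g k p ^+ 2)).
  - exact: measurable_unit_square.
  - by move=> k; apply: measurable_funX; exact: mgD.
  - by apply: measurable_funX; exact: mh0.
  - by move=> k p; exact: sqr_ge0.
  - by move=> p; exact: sqr_ge0.
  - apply: filterS aeh0 => p gh Dp; have := gh Dp => c; rewrite expr2.
    by under eq_fun do rewrite expr2; exact: cvgM.
  - move=> k.
    have -> : (\int[mu2]_(p in unit_square R) (g k p ^+ 2)%:E = \int[mu2]_(p in unit_square R)
      (step (2 ^ n k) (fun a b => coef (2 ^ n k) a b ^+ 2) p)%:E)%E.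
      by apply: eq_integral => p _; rewrite /= /g /step; case: ifP => // _; rewrite expr2 mul0r.
    rewrite step_integral_ge0// ?lee_fin; first exact: V_le.
    by move=> a b; exact: sqr_ge0.
have E0 z : 0 <= z <= 1 -> forall k, 0 <= dyadic_floor z k <= 1.
  move=> z01 k; have [dz _ _ _] := dyadic_floorP z01.
  by rewrite divr_ge0//= (le_trans (dz k))//; case/andP: z01.
have app z : 0 <= z <= 1 -> forall t, t < z -> exists k, t < dyadic_floor z k.
  move=> z01 t tz; have [_ dz _ _] := dyadic_floorP z01.
  have e0 : 0 < z - t by rewrite subr_gt0.
  have [k _ hk] := near_infty_natSinv_lt (PosNum e0).
  exists k; have := hk k (leqnn k) => /= h1; have := dz k; move: (k.+1%:R^-1) h1 => e; lra.
have dist z : 0 <= z <= 1 -> forall k, `|dyadic_floor z k - z| <= k.+1%:R^-1.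
  move=> z01 k; have [dz dz' _ _] := dyadic_floorP z01.
  by rewrite distrC ger0_norm ?subr_ge0// ltW.
have dx01 x y : 0 <= x <= 1 -> 0 <= y <= 1 ->
  (fun k => f (dyadic_floor x k, y)) @ \oo --> f (x, y).
  move=> x01 y01; apply: (@is_deriv01_seq_cvg R (fun t => f (t, y)) x _ (dyadic_floor x)).
  - by apply: derivable01_is_deriv; apply: (fx (p := (x, y))); exact/unit_squareP.
  - exact: E0.
  - exact: dist.
have dy01 x y : 0 <= x <= 1 -> 0 <= y <= 1 ->
  (fun k => f (x, dyadic_floor y k)) @ \oo --> f (x, y).
  move=> x01 y01; apply: (@is_deriv01_seq_cvg R (fun t => f (x, t)) y _ (dyadic_floor y)).
  - by apply: derivable01_is_deriv; apply: (fy (p := (x, y))); exact/unit_squareP.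
  - exact: E0.
  - exact: dist.
have z01 : 0 <= (0 : R) <= 1 by rewrite lexx ler01.
(* From dyadic nodes to arbitrary ones, one coordinate at a time: the left side converges by
   separate continuity of [f], the right side by exhaustion. *)
have half x j i' : 0 <= x <= 1 -> (i' <= 2 ^ j)%N ->
  (rect_incr f 0 x 0 (i'%:R / (2 ^ j)%:R)%R)%:E =
    (\int[mu2]_(p in corner x (i'%:R / (2 ^ j)%:R)%R) (h p)%:E)%E.
  move=> x01 i'j; set y := i'%:R / _.
  have pR : 0 < (2 ^ j)%:R :> R by rewrite ltr0n.
  have y1 : y <= 1 by rewrite ler_pdivrMr// mul1r ler_nat.
  have y01 : 0 <= y <= 1 by rewrite divr_ge0.
  have [dz _ di homod] := dyadic_floorP x01.
  have cI := corner_integral_cvg ih (andP x01).2 y1 homod (fun m n _ => lexx y) dz (fun=> lexx y)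
     (app _ x01) (fun t ty => ex_intro _ 0%N ty).
  apply: cvg_unique cI; first exact: ereal_hausdorff.
  have -> : (fun k => \int[mu2]_(p in corner (dyadic_floor x k) y) (h p)%:E)%E =
     (fun k => (rect_incr f 0 (dyadic_floor x k) 0 y)%:E).
    apply/funext => k; rewrite /dyadic_floor.
    have yk : y = (i' * 2 ^ k)%:R / (2 ^ (j + k))%:R.
      by rewrite expnD !natrM /y; field; rewrite !gt_eqF// ltr0n.
    have xk : (cell_index (2 ^ k) x)%:R / (2 ^ k)%:R =
       (cell_index (2 ^ k) x * 2 ^ j)%:R / (2 ^ (j + k))%:R :> R.
      by rewrite expnD !natrM; field; rewrite !gt_eqF// ltr0n.
    rewrite xk yk dyad//; rewrite expnD; last by rewrite leq_mul2r i'j orbT.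
    by rewrite mulnC leq_mul2l di orbT.
  apply: cvg_EFin; first exact: nearW.
  by rewrite /rect_incr; apply: cvgD; [apply: cvgB; [apply: cvgB; [exact: dx01|exact: dx01]|exact: cvg_cst]|exact: cvg_cst].
move=> x y x01 y01.
have [dz _ di homod] := dyadic_floorP y01.
have cI := corner_integral_cvg ih (andP x01).2 (andP y01).2 (fun m n _ => lexx x) homod (fun=> lexx x) dz
     (fun t tx => ex_intro _ 0%N tx) (app _ y01).
apply: cvg_unique cI; first exact: ereal_hausdorff.
have -> : (fun k => \int[mu2]_(p in corner x (dyadic_floor y k)) (h p)%:E)%E =
     (fun k => (rect_incr f 0 x 0 (dyadic_floor y k))%:E).
  by apply/funext => k; rewrite -half.
apply: cvg_EFin; first exact: nearW.
rewrite /rect_incr; apply: cvgD; last exact: cvg_cst.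
by apply: cvgB; [apply: cvgB; [exact: dy01|exact: cvg_cst]|exact: dy01].
Qed.

End Density.

(** * Primitives in the plane *)

Section Primitive.
Variable R : realType.
Local Notation mu := (@lebesgue_measure R).

Definition primitive (g : R -> R) (x : R) : R := \int[mu]_(t in `]-oo, x]) g t.

Section Integrable.
Variable g : R -> R.
Hypothesis g0 : forall t, 0 <= g t.
Hypothesis ig : mu.-integrable [set: R] (EFin \o g).

Lemma primitiveB x y : x <= y -> primitive g y - primitive g x = \int[mu]_(t in `]x, y]) g t.
Proof.
move=> xy; apply: Rintegral_itvB => //; first exact: integrableS ig.
Qed.

Lemma primitive_le x y : x <= y -> primitive g x <= primitive g y.
Proof. by move=> xy; rewrite -subr_ge0 primitiveB// Rintegral_ge0. Qed.

Lemma primitive_uniform e : 0 < e ->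
  exists2 d, 0 < d & forall x y, `|y - x| < d -> `|primitive g y - primitive g x| < e.
Proof.
move=> e0; have [d [d0 hd]] := integral_normr_continuous ig e0.
exists d => //.
have le x y : x <= y -> `|y - x| < d -> `|primitive g y - primitive g x| < e.
  move=> xy yx; rewrite primitiveB//.
  rewrite (le_lt_trans (le_normr_Rintegral _ _))//; first exact: integrableS ig.
  apply: hd; first exact: measurable_itv.
  suff : (mu `]x, y]%classic < d%:E)%E by [].
  rewrite lebesgue_measure_itv/= lte_fin; case: ifP => _; last by rewrite lte_fin.
  by rewrite -EFinB lte_fin; apply: le_lt_trans yx; exact: ler_norm.
move=> x y yx; have [xy|/ltW yx'] := leP x y; first exact: le.
by rewrite distrC le// distrC.
Qed.

Lemma primitive_ae_derivable :
  {ae mu, forall x, derivable (primitive g) x 1 /\ derive1 (primitive g) x = g x}.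
Proof.
apply: FTC1Ny; first by move=> y; exact: integrableS ig.
by apply: open_integrable_locally => //; exact: openT.
Qed.

End Integrable.

Lemma derivable_quotient_cvg (F : R -> R) x (u : nat -> R) : derivable F x 1 ->
  u @ \oo --> 0 -> (forall k, u k != 0) ->
  (fun k => (F (x + u k) - F x) / u k) @ \oo --> derive1 F x.
Proof.
move=> dF u0 un0; rewrite derive1E.
have c : h^-1 *: (F (h *: (1 : R) + x) - F x) @[h --> 0^'] --> 'D_1 F x by exact: dF.
move/cvgrPdist_le : c => c; apply/cvgrPdist_le => e e0.
have := c e e0; rewrite near_withinE => /nbhs_ballP[d /= d0 hd].
move/cvgrPdist_lt : u0 => /(_ d d0); apply: filterS => k; rewrite sub0r normrN => uk.
have := hd (u k); rewrite /ball/= sub0r normrN => /(_ uk (un0 k)).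
by rewrite -[(u k)%:A]/(u k * 1) mulr1 (addrC (u k)) -[_^-1 *: _]/(_^-1 * _) mulrC.
Qed.

(* Monotonicity fills the gaps between consecutive 1/(k+1), whose ratio tends to 1. *)
Lemma monotone_quotient_right (F : R -> R) (y l : R) : {homo F : s t / s <= t} ->
  (fun k => (F (y + k.+1%:R^-1) - F y) / k.+1%:R^-1) @ \oo --> l ->
  forall e, 0 < e -> exists2 d, 0 < d & forall t, y <= t -> t - y < d ->
    `|F t - F y - l * (t - y)| <= e * (t - y).
Proof.
move=> homoF /cvgrPdist_le cl e e0.
have quot (u : R) : 0 < u -> `|l - (F (y + u) - F y) / u| <= e / 4 ->
    `|F (y + u) - F y - l * u| <= e / 4 * u.
  move=> u0; rewrite distrC -(ler_pM2r u0) -[X in `|_| * X](ger0_norm (ltW u0)) -normrM mulrBl divfK//.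
  by rewrite gt_eqF.
have e4 : 0 < e / 4 by rewrite divr_gt0.
have [N1 _ hN1] := cl _ e4.
have L0 : 0 < e / 2 / (`|l| + 1) by rewrite !divr_gt0// ltr_wpDl.
have [N2 _ hN2] := near_infty_natSinv_lt (PosNum L0).
pose N := maxn N1 N2; exists N.+1%:R^-1; first by rewrite invr_gt0.
move=> t; rewrite le_eqVlt => /predU1P[<-|yt tN].
  by rewrite !subrr !mulr0 subrr normr0.
have [s sE] : {s | s = t - y} by exists (t - y).
have tE : t = y + s by rewrite sE addrC subrK.
have s0 : 0 < s by rewrite sE subr_gt0.
rewrite -sE in tN *; rewrite tE.
have si0 : 0 <= s^-1 by rewrite invr_ge0 ltW.
have := truncn_itv si0; set m := Num.truncn _ => /andP[m1 m2].
have Nm : (N.+1 <= m)%N.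
  rewrite -ltnS -(ltr_nat R) (lt_le_trans _ (ltW m2))//.
  by rewrite -[X in X < _]invrK ltf_pV2// ?posrE// invr_gt0.
case: m m1 m2 Nm => // k m1 m2 Nk; rewrite ltnS in Nk.
have hk1 : s <= k.+1%:R^-1 by rewrite -[s]invrK lef_pV2 ?posrE ?invr_gt0.
have hk2 : k.+2%:R^-1 <= s by rewrite -[s]invrK lef_pV2 ?posrE ?invr_gt0// ltW.
have q1 := hN1 k (leq_trans (leq_maxl _ _) Nk).
have q2 := hN1 k.+1 (leqW (leq_trans (leq_maxl _ _) Nk)).
have lk := hN2 k (leq_trans (leq_maxr _ _) Nk).
rewrite /= in q1 q2 lk.
have ku : k.+1%:R^-1 = k.+2%:R^-1 + k.+1%:R^-1 * k.+2%:R^-1 :> R.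
  have := ltr0Sn R k; rewrite -(natr1 k.+1); move: (k.+1%:R : R) => z z0.
  by field; rewrite !gt_eqF// ltr_wpDl// ltW.
have F1 : F (y + s) <= F (y + k.+1%:R^-1) by apply: homoF; rewrite lerD2l.
have F2 : F (y + k.+2%:R^-1) <= F (y + s) by apply: homoF; rewrite lerD2l.
have u0 : 0 < k.+1%:R^-1 :> R by rewrite invr_gt0.
have u0' : 0 < k.+2%:R^-1 :> R by rewrite invr_gt0.
have u1 : k.+1%:R^-1 <= 1 :> R by rewrite invf_le1// ler1n.
clear -quot e0 F1 F2 u0 u0' u1 q1 q2 lk ku hk1 hk2 s0.
have {}q1 := quot _ u0 q1; have {}q2 := quot _ u0' q2.
move: q1 q2 lk ku F1 F2 u0 u0' u1 hk1 hk2.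
set u : R := k.+1%:R^-1; set u' : R := k.+2%:R^-1.
set A := F (y + s); set B := F (y + u); set B' := F (y + u').
move: u u' A B B' => u u' A B B' q1 q2 lk ku F1 F2 u0 u0' u1 us u's.
have lu : `|l| * u <= e / 2.
  rewrite ltr_pdivlMr ?ltr_wpDl// in lk.
  by apply: le_trans (ltW lk); rewrite mulrC ler_pM2l// lerDl.
have uus : u * u' <= u * s by rewrite ler_pM2l.
have us1 : u * u' <= u' by rewrite ler_piMl// ltW.
have d1 : `|l * (u - s)| <= e / 2 * s.
  rewrite normrM [`|u - s|]ger0_norm ?subr_ge0//.
  apply: (@le_trans _ _ (`|l| * (u * s))); first by rewrite ler_wpM2l//; lra.
  by rewrite mulrA ler_pM2r.
have d2 : `|l * (s - u')| <= e / 2 * s.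
  rewrite normrM [`|s - u'|]ger0_norm ?subr_ge0//.
  apply: (@le_trans _ _ (`|l| * (u * s))); first by rewrite ler_wpM2l//; lra.
  by rewrite mulrA ler_pM2r.
have eu : e / 4 * u <= e / 2 * s.
  apply: (@le_trans _ _ (e / 4 * (2 * s))); last by lra.
  by rewrite ler_pM2l ?divr_gt0//; lra.
have eu' : e / 4 * u' <= e / 2 * s.
  apply: (@le_trans _ _ (e / 4 * s)); last by rewrite ler_pM2r//; lra.
  by rewrite ler_pM2l ?divr_gt0.
move: q1 q2 d1 d2; rewrite !ler_norml => /andP[a1 a2] /andP[b1 b2] /andP[c1 c2] /andP[d1 d2].
apply/andP; split; lra.
Qed.

(** The left quotients reduce to right ones for [- F (- z)], which is again nondecreasing.
    Differentiability thus depends on countably many quotients, and this will make an exceptional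
    set in the plane measurable. *)
Lemma monotone_quotients_deriv01 (F : R -> R) (y l : R) : {homo F : s t / s <= t} ->
  (fun k => (F (y + k.+1%:R^-1) - F y) / k.+1%:R^-1) @ \oo --> l ->
  (fun k => (F (y + - k.+1%:R^-1) - F y) / - k.+1%:R^-1) @ \oo --> l ->
  is_deriv01 F y l.
Proof.
move=> homoF cr cl e e0.
have [d1 d10 h1] := monotone_quotient_right homoF cr e0.
have homoF' : {homo (fun z => - F (- z)) : s t / s <= t}.
  by move=> s t st; rewrite lerN2 homoF// lerN2.
have cl' : (fun k => (- F (- (- y + k.+1%:R^-1)) - - F (- - y)) / k.+1%:R^-1) @ \oo --> l.
  rewrite (_ : (fun k => _) = fun k => (F (y + - k.+1%:R^-1) - F y) / - k.+1%:R^-1)//.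
  apply/funext => k; rewrite opprD !opprK invrN mulrN -mulNr opprB; congr (_ * _).
  by rewrite addrC.
have [d2 d20 h2] := monotone_quotient_right homoF' cl' e0.
exists (Num.min d1 d2); first by rewrite lt_min d10.
move=> t _; rewrite lt_min => /andP[td1 td2].
have [yt|/ltW ty] := leP y t.
  rewrite [X in e * X]ger0_norm ?subr_ge0//; apply: h1 => //.
  by apply: le_lt_trans td1; exact: ler_norm.
have := h2 (- t); rewrite !opprK lerN2 => /(_ ty).
have E : `|t - y| = - t + y by rewrite distrC ger0_norm ?subr_ge0// addrC.
rewrite E in td2 *; move=> /(_ td2); congr (_ <= _); rewrite -normrN; congr (`|_|); ring.
Qed.

End Primitive.

Lemma measurable_cvg0 (d : measure_display) (T : measurableType d) (R : realType)
    (u : nat -> T -> R) : (forall k, measurable_fun [set: T] (u k)) ->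
  measurable [set x | u ^~ x @ \oo --> (0 : R)].
Proof.
move=> mu.
rewrite (_ : [set x | _] = \bigcap_m \bigcup_N \bigcap_(k in [set k | (N <= k)%N])
   [set x | `|u k x| <= m.+1%:R^-1]).
  apply: bigcapT_measurable => m; apply: bigcup_measurable => N _.
  apply: bigcap_measurable => [|k _]; first by exists N => /=.
  rewrite -[X in measurable X]setTI; apply: measurable_fun_le => //.
  by apply: measurableT_comp => //; exact: mu.
apply/seteqP; split => x /=.
  move=> /cvgr0Pnorm_le ux m _.
  have [N _ hN] := ux m.+1%:R^-1 ltac:(by rewrite invr_gt0).
  by exists N => // k /= Nk; exact: hN.
move=> h; apply/cvgr0Pnorm_le => e e0.
have [m _ hm] := near_infty_natSinv_lt (PosNum e0).
have [N _ hN] := h m I; exists N => // k Nk.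
by rewrite (le_trans (hN k Nk))// ltW//; apply: (hm m (leqnn m)).
Qed.

(** * Mass of a nonnegative density in lower-left quadrants *)

Section PlanePrimitive.
Variable R : realType.
Local Notation mu := (@lebesgue_measure R).
Local Notation mu2 := (borel_leb2 R).
Local Notation T2 := (measurableTypeR R * measurableTypeR R)%type.
Variable H : R * R -> R.
Hypothesis mH : measurable_fun [set: R * R] H.
Hypothesis H0 : forall p, 0 <= H p.
Hypothesis iH : mu2.-integrable [set: R * R] (EFin \o H).

Definition lower (x y : R) : set (R * R) := `]-oo, x]%classic `*` `]-oo, y]%classic.

Definition mass (x y : R) : R := \int[mu2]_(p in lower x y) H p.

(** The candidate for the derivative of [mass] in [x]. Being real-valued, it is 0 where the section
    has infinite integral, which happens for almost no [t]. *)
Definition strip (y t : R) : R := primitive (fun s => H (t, s)) y.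

Let mHE : measurable_fun [set: R * R] (EFin \o H).
Proof. exact/measurable_EFinP. Qed.

Let HE0 p : (0 <= (EFin \o H) p)%E.
Proof. by rewrite lee_fin. Qed.

Lemma measurable_lower x y : measurable (lower x y : set T2).
Proof. by apply: measurableX; exact: measurable_itv. Qed.

Lemma strip_measurable : measurable_fun [set: R * R] (fun p : R * R => strip p.2 p.1).
Proof.
(* The condition [s <= y] becomes a factor of the integrand, so the domain no longer depends on [y]
   and Tonelli gives joint measurability in [(t, y)]. *)
pose F (q : (R * R) * R) : \bar R := ((q.2 <= q.1.2)%R%:R * H (q.1.1, q.2))%:E.
have -> : (fun p : R * R => strip p.2 p.1) = fine \o (fun p => \int[mu]_s F (p, s))%E.
  apply/funext => -[t y] /=; rewrite /strip /primitive /Rintegral integral_mkcond.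
  congr fine; apply: eq_integral => s _; rewrite patchE /F/=.
  case: ifPn; rewrite ?inE ?notin_setE/= in_itv/=; first by move=> ->; rewrite mul1r.
  by move=> /negP/negbTE ->; rewrite mul0r.
apply: measurableT_comp; first exact: (fine_measurable measurableT).
apply: (@measurable_fun_fubini_tonelli_F _ _ _ _ R mu F).
  apply/measurable_EFinP; apply: measurable_funM.
    rewrite (_ : (fun q : (R * R) * R => _) = fun q => if q.2 <= q.1.2 then 1 else 0); last first.
      by apply/funext => q; case: (_ <= _).
    apply: measurable_fun_ifT; [|exact: measurable_cst|exact: measurable_cst].
    apply: measurable_fun_ler; first exact: measurable_snd.
    by apply: measurableT_comp; [exact: measurable_snd|exact: measurable_fst].
  apply: (measurableT_comp mH); apply: measurable_fun_pair; last exact: measurable_snd.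
  by apply: measurableT_comp; [exact: measurable_fst|exact: measurable_fst].
by move=> q; rewrite lee_fin mulr_ge0.
Qed.

Lemma strip1_measurable y : measurable_fun [set: R] (strip y).
Proof.
apply: (measurableT_comp strip_measurable (g := fun t => (t, y))).
by apply: measurable_fun_pair; [exact: measurable_id|exact: measurable_cst].
Qed.

Lemma section_measurable t : measurable_fun [set: R] (fun s => H (t, s)).
Proof.
apply: (measurableT_comp mH (g := fun s => (t, s))).
by apply: measurable_fun_pair; [exact: measurable_cst|exact: measurable_id].
Qed.

Lemma ae_section_integrable :
  {ae mu, forall t, mu.-integrable [set: R] (EFin \o (fun s => H (t, s)))}.
Proof. exact: (ae_integrable1 iH). Qed.

Lemma strip_ge0 y t : 0 <= strip y t.
Proof. exact: Rintegral_ge0. Qed.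

Let inner y t := (\int[mu]_(s in `]-oo, y]) (H (t, s))%:E)%E.

Let inner_ge0 y t : (0 <= inner y t)%E.
Proof. by apply: integral_ge0 => s _; rewrite lee_fin. Qed.

Let inner_measurable y : measurable_fun [set: R] (inner y).
Proof. by apply: (@measurable_section_integral1 R (EFin \o H)) => //; exact: measurable_itv. Qed.

Lemma strip_integrable y : mu.-integrable [set: R] (EFin \o strip y).
Proof.
apply/integrableP; split; first by apply/measurable_EFinP; exact: strip1_measurable.
have /integrableP[_ iH'] := iH.
apply: le_lt_trans iH'.
have -> : (\int[mu2]_p `|(EFin \o H) p| = \int[mu2]_(p in [set: R] `*` [set: R]) (EFin \o H) p)%E.
  by rewrite setXTT; apply: eq_integral => p _; rewrite gee0_abs.
rewrite fubini_rect1//.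
apply: ge0_le_integral => //.
- by apply: measurableT_comp => //; apply/measurable_EFinP; exact: strip1_measurable.
- by apply: measurable_section_integral1.
- move=> t _; rewrite gee0_abs ?lee_fin ?strip_ge0//.
  apply: (@le_trans _ _ (inner y t)).
    rewrite [leLHS](_ : _ = (fine (inner y t))%:E)//.
    by case: (inner y t) (inner_ge0 y t) => [r _|_|]//=; rewrite leey.
  apply: ge0_subset_integral => //; last by move=> s _; rewrite lee_fin.
  by apply/measurable_EFinP; exact: section_measurable.
Qed.

Let lower_integrable x y : mu2.-integrable (lower x y) (EFin \o H).
Proof. by apply: integrableS iH => //; exact: measurable_lower. Qed.

Lemma massE x y : mass x y = primitive (strip y) x.
Proof.
rewrite /mass /primitive /Rintegral [in LHS](@fubini_rect1 R (EFin \o H)) ?measurable_itv//.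
congr fine; apply: ae_eq_integral.
- exact: measurable_itv.
- exact: measurable_funTS (inner_measurable y).
- by apply: measurable_funTS; apply/measurable_EFinP; exact: strip1_measurable.
- move: ae_section_integrable; apply: filterS; first exact: (ae_filter_ringOfSetsType mu).
  move=> t it _.
  rewrite /strip /primitive /Rintegral fineK//.
  by apply: integrable_fin_num => //; exact: integrableS it.
Qed.

Lemma massB x x' y : x <= x' -> mass x' y - mass x y =
  \int[mu2]_(p in `]x, x']%classic `*` `]-oo, y]%classic) H p.
Proof.
move=> xx'.
have UE : lower x' y = lower x y `|` (`]x, x']%classic `*` `]-oo, y]%classic).
  apply/seteqP; split => -[s t]; rewrite /lower/= !in_itv/=; last first.
    by move=> [[sx ->]|[/andP[_ ->] ->]]//; rewrite (le_trans sx xx').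
  by move=> [sx' ->]; have [sx|xs] := leP s x; [left|right; rewrite sx'].
rewrite {1}/mass UE Rintegral_setU.
- by rewrite addrAC subrr add0r.
- exact: measurable_lower.
- by apply: measurableX; exact: measurable_itv.
- by rewrite -UE; exact: lower_integrable.
- apply/disj_setPS => -[s t] [] [/= + _] [/= + _]; rewrite !in_itv/= => sx /andP[xs _].
  by move: sx; rewrite leNgt xs.
Qed.

(** The increment in [x] is a mass over a vertical band cut at height [y]. Its monotonicity in [y]
    is what allows squeezing between rational heights and gives moduli of continuity uniform in
    [y]. *)
Lemma massB_le x x' y y' : x <= x' -> y <= y' -> mass x' y - mass x y <= mass x' y' - mass x y'.
Proof.
move=> xx' yy'; rewrite !massB//.
have iS z : mu2.-integrable (`]x, x']%classic `*` `]-oo, z]%classic) (EFin \o H).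
  by apply: integrableS iH => //; apply: measurableX; exact: measurable_itv.
have mS z : measurable (`]x, x']%classic `*` `]-oo, z]%classic : set T2).
  by apply: measurableX; exact: measurable_itv.
apply: fine_le; [exact: integrable_fin_num|exact: integrable_fin_num|].
apply: ge0_subset_integral => //; first exact: measurable_funTS mHE.
  by move=> p _; rewrite lee_fin.
by apply: setSX => // s; rewrite /= !in_itv/= => sy; exact: le_trans yy'.
Qed.

End PlanePrimitive.

Lemma squeeze_increment (R : realFieldType) (D L U K KL KU S E : R) : L <= D -> D <= U ->
  `|L - KL * S| <= E / 2 -> `|U - KU * S| <= E / 2 ->
  `|(K - KL) * S| <= E / 2 -> `|(K - KU) * S| <= E / 2 -> `|D - K * S| <= E.
Proof.
rewrite !ler_norml => LD DU /andP[a1 a2] /andP[b1 b2] /andP[c1 c2] /andP[d1 d2].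
by apply/andP; split; lra.
Qed.

Section PlaneDerivatives.
Variable R : realType.
Local Notation mu := (@lebesgue_measure R).
Local Notation mu2 := (borel_leb2 R).
Local Notation T2 := (measurableTypeR R * measurableTypeR R)%type.
Variable H : R * R -> R.
Hypothesis mH : measurable_fun [set: R * R] H.
Hypothesis H0 : forall p, 0 <= H p.
Hypothesis iH : mu2.-integrable [set: R * R] (EFin \o H).

(* The derivative exists at rational heights by Lebesgue's theorem; the other
   heights are squeezed, the increments of [mass] being monotone in [y]. *)
Lemma mass_ae_derivable : {ae mu, forall t,
  mu.-integrable [set: R] (EFin \o (fun s => H (t, s))) /\
  forall y, is_deriv01 (fun x => mass H x y) t (strip H y t)}.
Proof.
have aeq : {ae mu, forall t, forall n : nat, if @unpickle rat n is Some q
    then is_deriv01 (fun x => mass H x (ratr q)) t (strip H (ratr q) t) else True}.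
  apply: ae_foralln => n; case: (unpickle n) => [q|]; last exact: aeW.
  move: (primitive_ae_derivable (strip_integrable mH H0 iH (ratr q))).
  apply: filterS; first exact: (ae_filter_ringOfSetsType mu).
  move=> t [dt et]; rewrite (_ : (fun x => mass H x (ratr q)) = primitive (strip H (ratr q))).
    exact: derive1_is_deriv01.
  by apply/funext => x; exact: massE.
move: (ae_section_integrable iH) aeq; apply: filterS2.
  exact: (ae_filter_ringOfSetsType mu).
move=> t it aeq; split=> // y e e0.
have hq (q : rat) : is_deriv01 (fun x => mass H x (ratr q)) t (strip H (ratr q) t).
  by have := aeq (pickle q); rewrite pickleK.
have e2 : 0 < e / 2 by rewrite divr_gt0.
have [d d0 hd] := primitive_uniform it e2.
have dy1 : y - d < y by rewrite ltrBlDr ltrDl.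
have dy2 : y < y + d by rewrite ltrDl.
have [q1 q1i] := rat_in_itvoo dy1; have [q2 q2i] := rat_in_itvoo dy2.
move: q1i q2i; rewrite !in_itv/= => /andP[y1 y2] /andP[y3 y4].
have k1 : `|strip H y t - strip H (ratr q1) t| < e / 2.
  by apply: hd; rewrite ger0_norm; lra.
have k2 : `|strip H (ratr q2) t - strip H y t| < e / 2.
  by apply: hd; rewrite ger0_norm; lra.
have [d1 d10 h1] := hq q1 _ e2; have [d2 d20 h2] := hq q2 _ e2.
exists (Num.min d1 d2); first by rewrite lt_min d10.
move=> s s01; rewrite lt_min => /andP[sd1 sd2].
have {}h1 := h1 s s01 sd1; have {}h2 := h2 s s01 sd2.
have hm := @massB_le R H mH H0 iH.
have {}k1 : `|(strip H y t - strip H (ratr q1) t) * (s - t)| <= e * `|s - t| / 2.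
  by rewrite normrM mulrAC ler_wpM2r// ltW.
have {}k2 : `|(strip H y t - strip H (ratr q2) t) * (s - t)| <= e * `|s - t| / 2.
  by rewrite normrM mulrAC ler_wpM2r// distrC ltW.
rewrite mulrAC in h1; rewrite mulrAC in h2.
have [ts|/ltW st] := leP t s.
  by apply: squeeze_increment h1 h2 k1 k2; apply: hm => //; exact: ltW.
apply: squeeze_increment h2 h1 k2 k1; rewrite -lerN2 !opprB; apply: hm => //; exact: ltW.
Qed.

Lemma ae_fst (P : R -> Prop) : {ae mu, forall t, P t} -> {ae mu2, forall p : R * R, P p.1}.
Proof.
move=> [A [mA A0 hA]]; exists (A `*` [set: R]); split.
- exact: measurableX.
- by rewrite /borel_leb2/= product_measure1E// [X in (X * _)%E]A0 mul0e.
- by move=> p /= Pp; split => //; apply: hA.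
Qed.

(** On almost every vertical line this is Lebesgue differentiation of the section. Going from lines
    to the plane requires a measurable exceptional set with null sections. *)
Lemma strip_ae_derivable : {ae mu2, forall p : R * R,
  is_deriv01 (fun y => strip H y p.1) p.2 (H p)}.
Proof.
pose r (k : nat) (p : R * R) :=
  (strip H (p.2 + k.+1%:R^-1) p.1 - strip H p.2 p.1) / k.+1%:R^-1 - H p.
pose l (k : nat) (p : R * R) :=
  (strip H (p.2 + - k.+1%:R^-1) p.1 - strip H p.2 p.1) / - k.+1%:R^-1 - H p.
have mS (c : R) : measurable_fun [set: R * R] (fun p : R * R => strip H (p.2 + c) p.1).
  apply: (measurableT_comp (strip_measurable mH H0) (g := fun p : R * R => (p.1, p.2 + c))).
  apply: measurable_fun_pair; first exact: measurable_fst.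
  by apply: measurable_funD; [exact: measurable_snd|exact: measurable_cst].
have mq (c : R) : measurable_fun [set: R * R]
   (fun p : R * R => (strip H (p.2 + c) p.1 - strip H p.2 p.1) / c - H p).
  apply: measurable_funB => //; apply: measurable_funM; last exact: measurable_cst.
  by apply: measurable_funB; [exact: mS|exact: strip_measurable].
(* Convergence along the increments [1/(k+1)] and their opposites is a countable condition, hence
   measurable; monotonicity of [strip] in [y] recovers the full derivative off this set. *)
pose N := ~` ([set p | r ^~ p @ \oo --> (0 : R)] `&` [set p | l ^~ p @ \oo --> (0 : R)]).
have mN : measurable (N : set T2).
  by apply: measurableC; apply: measurableI; apply: measurable_cvg0 => k; exact: mq.
have u0 : (fun k => k.+1%:R^-1 : R) @ \oo --> (0 : R) by exact: cvg_harmonic.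
have sub0 (v : nat -> R) (c : R) : v @ \oo --> c -> (fun k => v k - c) @ \oo --> (0 : R).
  by move=> vc; rewrite -(subrr c); apply: cvgB => //; exact: cvg_cst.
have N0 : mu2 N = 0%E.
  rewrite /borel_leb2/= /product_measure1/=.
  transitivity (\int[mu]_(x in [set: R]) (cst 0%E : R -> \bar R) x)%E; last exact: integral0.
  apply: ge0_ae_eq_integral => //; first exact: measurable_fun_xsection.
  move: (ae_section_integrable iH); apply: filterS; first exact: (ae_filter_ringOfSetsType mu).
  move=> t it _.
  apply/negligibleP; first exact: measurable_xsection.
  have [A [mA A0 hA]] := primitive_ae_derivable it.
  exists A; split => // y /xsectionP yN; apply: hA => /= -[dy ey]; apply: yN; split.
    by rewrite /= /r /=; apply: sub0; rewrite -ey; apply: derivable_quotient_cvg.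
  rewrite /= /l /=; apply: sub0; rewrite -ey; apply: derivable_quotient_cvg => //.
    by rewrite -oppr0; exact: cvgN.
have aeN : {ae mu2, forall p : R * R, ~ N p}.
  by apply/negligibleP => //; rewrite setCK.
move: (ae_fst (ae_section_integrable iH)) aeN; apply: filterS2; first exact: (ae_filter_ringOfSetsType mu2).
move=> p it /contrapT[hr hl].
apply: monotone_quotients_deriv01.
- by move=> y y'; apply: primitive_le.
- exact: cvg_sub0 hr (cvg_cst _).
- exact: cvg_sub0 hl (cvg_cst _).
Qed.

End PlaneDerivatives.

Section MassTranspose.
Variable R : realType.
Local Notation mu2 := (borel_leb2 R).

Lemma measurable_transpose (G : R * R -> R) : measurable_fun [set: R * R] G ->
  measurable_fun [set: R * R] (transpose G).
Proof.
by move=> mG; exact: (measurableT_comp mG (measurable_fun_pair measurable_snd measurable_fst)).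
Qed.

Lemma integral_rect_transpose (G : R * R -> \bar R) (A B : set R) : measurable A -> measurable B ->
  measurable_fun [set: R * R] G -> (forall p, (0 <= G p)%E) ->
  (\int[mu2]_(p in A `*` B) G (p.2, p.1) = \int[mu2]_(p in B `*` A) G p)%E.
Proof.
move=> mA mB mG G0; rewrite (@fubini_rect2 R G)// (@fubini_rect1 R (fun p => G (p.2, p.1)))//.
exact: (measurableT_comp mG (measurable_fun_pair measurable_snd measurable_fst)).
Qed.

Lemma ae_transpose (P : R * R -> Prop) : {ae mu2, forall p, P p} ->
  {ae mu2, forall p, P (p.2, p.1)}.
Proof.
move=> [N [mN N0 hN]].
have mS : measurable_fun [set: R * R] (fun p : R * R => (p.2, p.1)).
  exact: measurable_fun_pair measurable_snd measurable_fst.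
exists ((fun p : R * R => (p.2, p.1)) @^-1` N); split.
- by rewrite -[X in measurable X]setTI; exact: mS.
- have := @integral_rect_transpose (EFin \o \1_N) setT setT measurableT measurableT.
  rewrite setXTT.
  rewrite (_ : (fun p => (EFin \o \1_N) (p.2, p.1)) =
    EFin \o \1_((fun p : R * R => (p.2, p.1)) @^-1` N))//.
  rewrite !integral_indic ?setIT//; last by rewrite -[X in measurable X]setTI; exact: mS.
  rewrite N0; apply; last by move=> p; rewrite lee_fin.
  by apply/measurable_EFinP; exact: measurable_indic.
- by move=> p /= Pp; apply: hN.
Qed.

Section Mass.
Variable H : R * R -> R.
Hypothesis mH : measurable_fun [set: R * R] H.
Hypothesis H0 : forall p, 0 <= H p.
Hypothesis iH : mu2.-integrable [set: R * R] (EFin \o H).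

Lemma integrable_transpose : mu2.-integrable [set: R * R] (EFin \o transpose H).
Proof.
apply/integrableP; split; first by apply/measurable_EFinP; exact: measurable_transpose.
have /integrableP[_] := iH; rewrite -setXTT -integral_rect_transpose//.
by apply: measurableT_comp => //; apply/measurable_EFinP.
Qed.

Lemma mass_transpose x y : mass (transpose H) x y = mass H y x.
Proof.
rewrite /mass /Rintegral; congr fine.
apply: (@integral_rect_transpose (EFin \o H)); try exact: measurable_itv.
  exact/measurable_EFinP.
by move=> p; rewrite lee_fin.
Qed.

End Mass.

(** Among heights [y <= 1] the increment in [x] is largest at [y = 1], so the modulus of the single
    primitive at that height works for all of them. *)
Lemma mass_uniform1 (H : R * R -> R) (e : R) : measurable_fun [set: R * R] H -> (forall p, 0 <= H p) ->
  mu2.-integrable [set: R * R] (EFin \o H) -> 0 < e ->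
  exists2 d, 0 < d & forall x x' y, y <= 1 -> `|x' - x| < d -> `|mass H x' y - mass H x y| < e.
Proof.
move=> mH H0 iH e0; have [d d0 hd] := primitive_uniform (strip_integrable mH H0 iH 1) e0.
exists d => // x x' y y1.
wlog : x x' / x <= x'.
  move=> W xx'; have [le|/ltW le] := leP x x'; first exact: W.
  by rewrite distrC; apply: W => //; rewrite distrC.
move=> xx' /hd; apply: le_lt_trans; rewrite -!massE//.
have m0 := massB_le mH H0 iH xx' y1.
have m1 z : 0 <= mass H x' z - mass H x z.
  by rewrite massB// Rintegral_ge0.
by rewrite !ger0_norm.
Qed.

Lemma mass_uniform (H : R * R -> R) (e : R) : measurable_fun [set: R * R] H -> (forall p, 0 <= H p) ->
  mu2.-integrable [set: R * R] (EFin \o H) -> 0 < e ->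
  exists2 d, 0 < d & forall x x' y y', x <= 1 -> y' <= 1 -> `|x' - x| < d -> `|y' - y| < d ->
    `|mass H x' y' - mass H x y| < e.
Proof.
move=> mH H0 iH e0; have e2 : 0 < e / 2 by rewrite divr_gt0.
have [d1 d10 h1] := mass_uniform1 mH H0 iH e2.
have [|d2 d20 h2] := mass_uniform1 (measurable_transpose mH) _ (integrable_transpose mH iH) e2.
  by move=> p; exact: H0.
exists (Num.min d1 d2); first by rewrite lt_min d10.
move=> x x' y y' x1 y1; rewrite !lt_min => /andP[xd _] /andP[_ yd].
have k1 := h1 x x' y' y1 xd; have := h2 y y' x x1 yd; rewrite !mass_transpose// => k2.
have -> : mass H x' y' - mass H x y = (mass H x' y' - mass H x y') + (mass H x y' - mass H x y).
  by rewrite addrA subrK.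
by rewrite (le_lt_trans (ler_normD _ _))// (splitr e) ltrD.
Qed.

End MassTranspose.

(** * Mixed derivatives *)

Section PositivePart.
Variable R : realType.
Local Notation mu := (@lebesgue_measure R).
Local Notation mu2 := (borel_leb2 R).
Variable h : R * R -> R.
Hypothesis mh : measurable_fun [set: R * R] h.
Hypothesis ih : mu2.-integrable (unit_square R) (EFin \o h).

(** Cut off to 0 outside the square so that primitives can start at [-oo]. Applied to [h] and to
    [- h] it gives the two nonnegative parts, for which the monotonicity arguments are available. *)
Definition square_pos (h : R * R -> R) (p : R * R) : R := \1_(unit_square R) p * Num.max (h p) 0.

Lemma square_pos_ge0 p : 0 <= square_pos h p.
Proof. by rewrite mulr_ge0// le_max lexx orbT. Qed.

Lemma square_posE p : unit_square R p -> square_pos h p = Num.max (h p) 0.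
Proof. by move=> sp; rewrite /square_pos indicE mem_set// mul1r. Qed.

Lemma square_pos_out p : ~ unit_square R p -> square_pos h p = 0.
Proof. by move=> sp; rewrite /square_pos indicE memNset// mul0r. Qed.

Lemma square_pos_measurable : measurable_fun [set: R * R] (square_pos h).
Proof.
apply: measurable_funM; first exact: measurable_indic (@measurable_unit_square R).
by apply: measurable_maxr => //; exact: measurable_cst.
Qed.

Lemma square_pos_integrable : mu2.-integrable [set: R * R] (EFin \o square_pos h).
Proof.
have : mu2.-integrable [set: R * R] ((EFin \o h) \_ (unit_square R)).
  by rewrite -integrable_mkcond//; exact: measurable_unit_square.
apply: le_integrable => //.
  by apply/measurable_EFinP; exact: square_pos_measurable.
move=> p _; rewrite patchE; case: ifPn => [|/negP sp].
  rewrite inE => sp /=; rewrite square_posE// lee_fin ger0_norm ?le_max ?lexx ?orbT//.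
  by rewrite ge_max ler_norm normr_ge0.
by rewrite /= square_pos_out ?normr0// => sp'; apply: sp; rewrite inE.
Qed.

Lemma corner_mass x y : 0 <= x <= 1 -> 0 <= y <= 1 ->
  (\int[mu2]_(p in corner x y) (square_pos h p)%:E = (mass (square_pos h) x y)%:E)%E.
Proof.
move=> x01 y01.
have half (G : R -> \bar R) z : 0 <= z -> measurable_fun [set: R] G -> (forall s, (0 <= G s)%E) ->
    (forall s, s < 0 -> G s = 0%E) ->
    (\int[mu]_(s in `[0%R, z[) G s = \int[mu]_(s in `]-oo, z]) G s)%E.
  move=> z0 mG G0 Gneg.
  rewrite (@itv_bndbnd_setU _ _ -oo%O (BLeft 0) (BRight z))//.
  rewrite ge0_integral_setU//=; last first.
    apply/disj_setPS => s [] /=; rewrite !in_itv/= => s0 /andP[s0' _].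
    by move: s0; rewrite ltNge s0'.
    exact: measurable_funTS.
  rewrite [X in (_ = X + _)%E]integral0_eq ?add0e.
    by rewrite integral_itv_bndo_bndc//; exact: measurable_funTS.
  by move=> s /=; rewrite in_itv/= => /Gneg.
have mP : measurable_fun [set: R * R] (EFin \o square_pos h).
  by apply/measurable_EFinP; exact: square_pos_measurable.
have P0 p : (0 <= (EFin \o square_pos h) p)%E by rewrite lee_fin square_pos_ge0.
rewrite /mass /Rintegral fineK; last first.
  apply: integrable_fin_num; first exact: measurable_lower.
  by apply: integrableS square_pos_integrable => //; exact: measurable_lower.
have F (A B : set R) : measurable A -> measurable B ->
    (\int[mu2]_(p in A `*` B) (square_pos h p)%:E =
     \int[mu]_(x in A) \int[mu]_(y in B) (square_pos h (x, y))%:E)%E.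
  by move=> mA mB; exact: fubini_rect1.
transitivity (\int[mu]_(s in `[0%R, x[) \int[mu]_(t in `[0%R, y[) (square_pos h (s, t))%:E)%E.
  by apply: F; exact: measurable_itv.
transitivity (\int[mu]_(s in `]-oo, x]) \int[mu]_(t in `]-oo, y]) (square_pos h (s, t))%:E)%E; last first.
  by apply/esym; apply: F; exact: measurable_itv.
rewrite half; last 1 first.
- by move=> s s0; apply: integral0_eq => t _ /=; rewrite square_pos_out// => /unit_squareP[]/andP[]; rewrite leNgt s0.
- apply: eq_integral => s _; apply: half => //.
  + by case/andP: y01.
  + by apply/measurable_EFinP; apply: section_measurable; exact: square_pos_measurable.
  + by move=> t; rewrite lee_fin square_pos_ge0.
  + by move=> t t0 /=; rewrite square_pos_out// => /unit_squareP[_ /andP[]]; rewrite leNgt t0.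
- by case/andP: x01.
- by apply: (@measurable_section_integral1 R (EFin \o square_pos h)) => //; exact: measurable_itv.
- by move=> s; apply: integral_ge0 => t _; rewrite lee_fin square_pos_ge0.
Qed.

End PositivePart.

Section MixedDerivative.
Variable R : realType.
Local Notation mu := (@lebesgue_measure R).
Local Notation mu2 := (borel_leb2 R).
Variables f h : R * R -> R.
Hypothesis fx : forall p, unit_square R p -> has_dx f p.
Hypothesis mh : measurable_fun [set: R * R] h.
Hypothesis ih : mu2.-integrable (unit_square R) (EFin \o h).

Let hN : R * R -> R := fun p => - h p.

Let mhN : measurable_fun [set: R * R] hN.
Proof. exact: measurableT_comp. Qed.

Let ihN : mu2.-integrable (unit_square R) (EFin \o hN).
Proof. by have := integrableN ih. Qed.

Let P := square_pos h.
Let N := square_pos hN.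

Lemma square_pos_sub p : unit_square R p -> P p - N p = h p.
Proof.
move=> sp; rewrite /P /N !square_posE// /hN.
case/orP: (le_total 0 (h p)) => h0.
  by rewrite max_l// max_r ?oppr_le0// subr0.
by rewrite max_r// max_l ?oppr_ge0// sub0r opprK.
Qed.

Lemma corner_integral_mass x y : 0 <= x <= 1 -> 0 <= y <= 1 ->
  (\int[mu2]_(p in corner x y) (h p)%:E = (mass P x y - mass N x y)%:E)%E.
Proof.
move=> x01 y01; have mC := measurable_corner x y.
rewrite EFinB -(corner_mass mh ih x01 y01) -(corner_mass mhN ihN x01 y01).
have iC G : mu2.-integrable [set: R * R] G -> mu2.-integrable (corner x y) G.
  by move=> iG; apply: integrableS iG.
have := integralB mC (iC _ (square_pos_integrable mh ih)) (iC _ (square_pos_integrable mhN ihN)).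
move=> <-; apply: eq_integral => p; rewrite inE => cp /=; rewrite -EFinB square_pos_sub//.
by apply: corner_sub cp; [case/andP: x01|case/andP: y01].
Qed.

Hypothesis fh : forall x y : R, 0 <= x <= 1 -> 0 <= y <= 1 ->
  rect_incr f 0 x 0 y = mass P x y - mass N x y.

(** The exceptional set of [x] is the same for all [y], because [mass] is differentiable in [x] at
    all heights simultaneously. At such [x] the given derivative of [f] and the derivative of its
    representation by masses agree by uniqueness. *)
Lemma dx_formula : {ae mu, forall x : R, 0 <= x <= 1 ->
  [/\ mu.-integrable [set: R] (EFin \o (fun s => P (x, s))),
      mu.-integrable [set: R] (EFin \o (fun s => N (x, s))) &
      forall y, 0 <= y <= 1 -> dx f (x, y) = dx f (x, 0) + (strip P y x - strip N y x)]}.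
Proof.
move: (mass_ae_derivable (square_pos_measurable mh) (square_pos_ge0 h) (square_pos_integrable mh ih))
  (mass_ae_derivable (square_pos_measurable mhN) (square_pos_ge0 hN) (square_pos_integrable mhN ihN)).
apply: filterS2; first exact: (ae_filter_ringOfSetsType mu).
move=> x [ip dp] [iN dN] x01; split => // y y01.
have z01 : 0 <= (0 : R) <= 1 by rewrite lexx ler01.
have d z : 0 <= z <= 1 -> is_deriv01 (fun t => f (t, z)) x (dx f (x, z)).
  by move=> z01'; apply: derivable01_is_deriv; apply: (fx (p := (x, z))); exact/unit_squareP.
apply: (deriv01_unique x01 (d y y01)).
(* As functions of [t], [f (t, y)] and [f (t, 0) + mass P t y - mass N t y] differ by the constant
   [f (0, y) - f (0, 0)], so they have the same increments. *)
have D := is_deriv01_lin 1 (d 0 z01) (is_deriv01_lin (-1) (dp y) (dN y)).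
rewrite mul1r mulN1r in D.
move=> e e0; have [dl dl0 hdl] := D e e0; exists dl => // t t01 tx.
apply: le_trans (hdl t t01 tx); rewrite le_eqVlt; apply/orP; left; apply/eqP; congr (`|_|).
have := fh t01 y01; have := fh x01 y01; rewrite /rect_incr => e1 e2.
rewrite -/P -/N; move: (strip P y x) (strip N y x) (dx f (x, 0)) => a b c; lra.
Qed.

Lemma dx_continuous : {ae mu, forall x : R, 0 <= x <= 1 ->
  {within unit_itv R, continuous (fun y => dx f (x, y))}}.
Proof.
move: dx_formula; apply: filterS; first exact: (ae_filter_ringOfSetsType mu).
move=> x hx x01; have [iP iN hf] := hx x01.
apply/subspace_continuousP => y; rewrite /unit_itv/= in_itv/= => y01.
apply/cvgrPdist_lt => e e0; have e2 : 0 < e / 2 by rewrite divr_gt0.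
have [d1 d10 h1] := primitive_uniform iP e2; have [d2 d20 h2] := primitive_uniform iN e2.
rewrite near_withinE; apply/nbhs_ballP; exists (Num.min d1 d2); first by rewrite /= lt_min d10.
move=> t; rewrite /ball/= lt_min => /andP[t1 t2]; rewrite in_itv/= => t01.
rewrite /from_subspace/= (hf y y01) (hf t t01); have := h1 t y t1; have := h2 t y t2.
move: (dx f (x, 0)) => z; rewrite !ltr_norml /strip; move: (primitive _ _) (primitive _ _) (primitive _ _) (primitive _ _) => a b c d.
by move=> /andP[? ?] /andP[? ?]; apply/andP; split; lra.
Qed.

Lemma dy_dx_ae : {ae mu2, forall p, unit_square R p ->
  has_dy (dx f) p /\ dy (dx f) p = h p}.
Proof.
move: (ae_fst dx_formula) (strip_ae_derivable (square_pos_measurable mh) (square_pos_ge0 h) (square_pos_integrable mh ih)) (strip_ae_derivable (square_pos_measurable mhN) (square_pos_ge0 hN) (square_pos_integrable mhN ihN)).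
apply: filterS3; first exact: (ae_filter_ringOfSetsType mu2).
move=> [x y] /= hx dP dN sp; have /unit_squareP[x01 y01] := sp; have [_ _ hf] := hx x01.
apply: is_deriv01_derivable => //=.
have D := is_deriv01_lin (-1) dP dN; rewrite mulN1r square_pos_sub// in D.
move=> e e0; have [dl dl0 hdl] := D e e0; exists dl => // t t01 tx.
apply: le_trans (hdl t t01 tx); rewrite (hf t t01) (hf y y01) le_eqVlt; apply/orP; left; apply/eqP; congr (`|_|).
by rewrite /P /N; ring.
Qed.

End MixedDerivative.

(** * Return to the completed measures, and joint continuity *)

Section Consequences.
Variable R : realType.
Local Notation mu := (@lebesgue_measure R).
Local Notation mu2 := (borel_leb2 R).

Lemma ae_unit_itv_full (P : R -> Prop) : {ae mu, forall x, 0 <= x <= 1 -> P x} ->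
  exists A : set R, [/\ A `<=` unit_itv R, leb1_measurable A,
    completed_lebesgue_measure A = 1%E & forall x, A x -> P x].
Proof.
move=> [N [mN N0 hN]].
have mI : measurable (unit_itv R) by exact: measurable_unit_itv.
have mA : measurable (unit_itv R `\` N) by exact: measurableD.
exists (unit_itv R `\` N); split.
- by move=> x [].
- exact: sub_caratheodory.
- have : mu (unit_itv R) = (mu (unit_itv R `\` N) + mu (unit_itv R `&` N))%E by exact: measureDI.
  rewrite (@subset_measure0 _ _ _ mu (unit_itv R `&` N) N) ?adde0//; last exact: measurableI.
  by rewrite lebesgue_measure_itv/= lte_fin ltr01 oppr0 adde0 => ->.
- move=> x [/= Ix Nx]; apply: contrapT => Px; apply: Nx; apply: hN => /=.
  by move: Ix; rewrite /unit_itv/= in_itv/= => Ix /(_ Ix).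
Qed.

(** A mixed derivative is known only up to a null set and takes default values where it does not
    exist; completeness of [leb2] is what makes it measurable. *)
Lemma ae_eq_square_integrable (g h : R * R -> R) : measurable_fun [set: R * R] h ->
  (\int[mu2]_(p in unit_square R) (h p ^+ 2)%:E < +oo)%E ->
  {ae leb2 R, forall p : R * R, unit_square R p -> g p = h p} ->
  square_integrable (leb2 R) (unit_square R) g.
Proof.
move=> mh ih gh.
have mS := @measurable_unit_square R; have mSc := leb2_measurable mS.
(* One statement for both powers: [k = 1] gives measurability of [g], [k = 2] the integral of its
   square. *)
have hg k : ae_eq (leb2 R) (unit_square R) (fun p => (h p ^+ k)%:E) (fun p => (g p ^+ k)%:E).
  move: gh; apply: filterS; first exact: (ae_filter_ringOfSetsType (leb2 R)).
  by move=> p gp Dp; rewrite gp.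
have mhk k : measurable_fun [set: R * R] (fun p => (h p ^+ k)%:E).
  by apply/measurable_EFinP; exact: measurable_funX.
have mhc k : measurable_fun (unit_square R : set (caratheodory_type (mu2^*)%mu))
    (fun p => (h p ^+ k)%:E).
  by apply: (leb2_measurable_fun mS); apply: measurable_funTS; exact: mhk.
have mg k : measurable_fun (unit_square R : set (caratheodory_type (mu2^*)%mu))
    (fun p => (g p ^+ k)%:E).
  exact: (ae_measurable_fun (@leb2_complete R) (hg k)).
split.
  by apply/measurable_EFinP; exact: (mg 1%N).
apply/integrableP; split => //.
have -> : (\int[leb2 R]_(p in unit_square R) `|(g p ^+ 2)%:E| =
    \int[leb2 R]_(p in unit_square R) (g p ^+ 2)%:E)%E.
  by apply: eq_integral => p _; rewrite gee0_abs// lee_fin sqr_ge0.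
rewrite -(ae_eq_integral _ _ mSc (mhc 2%N) (mg 2%N) (hg 2%N)).
rewrite leb2_integral; [exact: ih|exact: mS|exact: mhk|].
by move=> p; rewrite lee_fin sqr_ge0.
Qed.

Lemma square_pos_transpose (h : R * R -> R) :
  square_pos (transpose h) = transpose (square_pos h).
Proof.
apply/funext => p; rewrite /transpose.
have [sp|sp] := pselect (unit_square R p).
  by rewrite !square_posE//; exact: unit_square_swap.
rewrite !square_pos_out// => /unit_square_swap/=.
by case: p sp => x y.
Qed.

Lemma square_jointly_continuous (f P N : R * R -> R) :
  (forall p, unit_square R p -> has_dx f p) -> (forall p, unit_square R p -> has_dy f p) ->
  measurable_fun [set: R * R] P -> (forall p, 0 <= P p) ->
  mu2.-integrable [set: R * R] (EFin \o P) ->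
  measurable_fun [set: R * R] N -> (forall p, 0 <= N p) ->
  mu2.-integrable [set: R * R] (EFin \o N) ->
  (forall x y : R, 0 <= x <= 1 -> 0 <= y <= 1 ->
     rect_incr f 0 x 0 y = mass P x y - mass N x y) ->
  {within unit_square R, continuous f}.
Proof.
move=> fx fy mP P0 iP mN N0 iN fPN.
have z01 : 0 <= (0 : R) <= 1 by rewrite lexx ler01.
(* Two edge functions, continuous because differentiable, and two masses, uniformly continuous: four
   terms, each allowed [e / 4]. *)
have fE (x y : R) : 0 <= x <= 1 -> 0 <= y <= 1 ->
    f (x, y) = f (x, 0) + f (0, y) - f (0, 0) + mass P x y - mass N x y.
  move=> x01 y01; have := fPN x y x01 y01; rewrite /rect_incr.
  by move: (mass P x y) (mass N x y) => a b; lra.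
apply/subspace_continuousP => -[x y] /unit_squareP[x01 y01].
apply/cvgrPdist_lt => e e0; have e4 : 0 < e / 4 by rewrite divr_gt0.
have [d1 d10 h1] := mass_uniform mP P0 iP e4; have [d2 d20 h2] := mass_uniform mN N0 iN e4.
have near_deriv (v : R -> R) z l : is_deriv01 v z l ->
    exists2 d, 0 < d & forall t, 0 <= t <= 1 -> `|z - t| < d -> `|v z - v t| < e / 4.
  move=> /is_deriv01_cvg/cvgrPdist_lt/(_ _ e4); rewrite near_withinE => /nbhs_ballP[d /= d0 hd].
  by exists d => // t t01 zt; apply: hd => //; rewrite /unit_itv/= in_itv.
have dx0 : is_deriv01 (fun t => f (t, 0)) x (dx f (x, 0)).
  by apply: derivable01_is_deriv; apply: (fx (x, 0)); exact/unit_squareP.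
have dy0 : is_deriv01 (fun t => f (0, t)) y (dy f (0, y)).
  by apply: derivable01_is_deriv; apply: (fy (0, y)); exact/unit_squareP.
have [d3 d30 h3] := near_deriv _ _ _ dx0; have [d4 d40 h4] := near_deriv _ _ _ dy0.
rewrite near_withinE; apply/nbhs_ballP.
exists (Num.min (Num.min d1 d2) (Num.min d3 d4)); first by rewrite /= !lt_min d10 d20 d30.
move=> [s t] []; rewrite /ball/= !lt_min => /andP[/andP[x1 x2] /andP[x3 _]].
move=> /andP[/andP[y1 y2] /andP[_ y4]] /unit_squareP[s01 t01].
rewrite /from_subspace/= (fE x y x01 y01) (fE s t s01 t01).
have s1 : s <= 1 by case/andP: s01.
have y1' : y <= 1 by case/andP: y01.
have k1 := h1 s x t y s1 y1' x1 y1; have k2 := h2 s x t y s1 y1' x2 y2.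
have k3 := h3 s s01 x3; have k4 := h4 t t01 y4; move: k1 k2 k3 k4; clear.
move: (mass P x y) (mass P s t) (mass N x y) (mass N s t) => a b c d.
rewrite !ltr_norml => /andP[? ?] /andP[? ?] /andP[? ?] /andP[? ?]; apply/andP; split; lra.
Qed.

End Consequences.

Theorem theorem4p1 (R : realType) (f : R * R -> R)
    (ex_fx : forall p, unit_square R p -> has_dx f p)
    (ex_fxx : forall p, unit_square R p -> has_dx (dx f) p)
    (ex_fy : forall p, unit_square R p -> has_dy f p)
    (ex_fyy : forall p, unit_square R p -> has_dy (dy f) p)
    (sq_fxx : square_integrable (leb2 R) (unit_square R) (dx (dx f)))
    (sq_fyy : square_integrable (leb2 R) (unit_square R) (dy (dy f))) :
  [/\ [/\ {ae leb2 R, forall p : R * R, unit_square R p ->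
             [/\ has_dy (dx f) p, has_dx (dy f) p
               & dy (dx f) p = dx (dy f) p]},
          square_integrable (leb2 R) (unit_square R) (dy (dx f))
        & square_integrable (leb2 R) (unit_square R) (dx (dy f))],
      (exists A : set R,
         [/\ A `<=` unit_itv R,
             leb1_measurable A,
             completed_lebesgue_measure A = 1%E
           & forall x, A x ->
               {within unit_itv R, continuous (fun y => dx f (x, y))}])
    & {within unit_square R, continuous f}].
Proof.
have [C C0 fC] := variation_bound ex_fx ex_fxx ex_fy ex_fyy sq_fxx sq_fyy.
have [h [mh h2 ih hF]] := mixed_density C0 ex_fx ex_fy fC.
have h2y := le_lt_trans h2 (ltry C).
pose P := square_pos h; pose N := square_pos (fun p => - h p).
have mhN : measurable_fun [set: R * R] (fun p => - h p) by exact: measurableT_comp.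
have ihN : (borel_leb2 R).-integrable (unit_square R) (EFin \o (fun p => - h p)).
  by have := integrableN ih.
have fh (x y : R) : 0 <= x <= 1 -> 0 <= y <= 1 ->
    rect_incr f 0 x 0 y = mass P x y - mass N x y.
  by move=> x01 y01; apply: EFin_inj; rewrite hF// corner_integral_mass.
have ht : (borel_leb2 R).-integrable (unit_square R) (EFin \o transpose h).
  apply/integrableP; split.
    by apply: measurable_funTS; apply/measurable_EFinP; exact: measurable_transpose.
  have /integrableP[_] := ih.
  rewrite -(@integral_square_transpose R (abse \o (EFin \o h)))//; last by move=> p; exact: abse_ge0.
  by apply: measurableT_comp => //; exact/measurable_EFinP.
(* Increments over rectangles are symmetric in the variables, so the transposed function has the
   transposed density. Both mixed derivatives are therefore compared with the same [h], which yields
   their equality. *)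
have fht (x y : R) : 0 <= x <= 1 -> 0 <= y <= 1 -> rect_incr (transpose f) 0 x 0 y =
    mass (square_pos (transpose h)) x y - mass (square_pos (fun p => - transpose h p)) x y.
  move=> x01 y01; rewrite (square_pos_transpose (fun p => - h p)) square_pos_transpose.
  rewrite (mass_transpose (square_pos_measurable mh) (square_pos_ge0 h)).
  rewrite (mass_transpose (square_pos_measurable mhN) (square_pos_ge0 _)) -fh//.
  by rewrite /rect_incr /transpose/=; ring.
have ftx p : unit_square R p -> has_dx (transpose f) p.
  by move=> sp; exact: (ex_fy (p.2, p.1) (unit_square_swap sp)).
have ae1 : {ae leb2 R, forall p : R * R, unit_square R p ->
    has_dy (dx f) p /\ dy (dx f) p = h p}.
  by apply: leb2_negligible; exact: (dy_dx_ae ex_fx mh ih fh).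
have ae2 : {ae leb2 R, forall p : R * R, unit_square R p ->
    has_dx (dy f) p /\ dx (dy f) p = h p}.
  apply: leb2_negligible; move: (ae_transpose (dy_dx_ae ftx (measurable_transpose mh) ht fht)).
  apply: filterS; first exact: (ae_filter_ringOfSetsType (borel_leb2 R)).
  by move=> [x y] hp sp; have := hp (unit_square_swap sp).
split; first split.
- move: ae1 ae2; apply: filterS2; first exact: (ae_filter_ringOfSetsType (leb2 R)).
  by move=> p h1 h3 sp; have [? ->] := h1 sp; have [? ->] := h3 sp.
- apply: ae_eq_square_integrable mh h2y _.
  move: ae1; apply: filterS; first exact: (ae_filter_ringOfSetsType (leb2 R)).
  by move=> p hp /hp[].
- apply: ae_eq_square_integrable mh h2y _.
  move: ae2; apply: filterS; first exact: (ae_filter_ringOfSetsType (leb2 R)).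
  by move=> p hp /hp[].
- exact: ae_unit_itv_full (dx_continuous ex_fx mh ih fh).
- apply: (square_jointly_continuous ex_fx ex_fy _ _ _ _ _ _ fh).
  + exact: square_pos_measurable.
  + exact: square_pos_ge0.
  + exact: square_pos_integrable.
  + exact: square_pos_measurable.
  + exact: square_pos_ge0.
  + exact: square_pos_integrable.
Qed.
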